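(* Let $\lambda,c\in\mathbb{C}$ and $\mu=-\frac{\lambda}{2}$. Let $W$ be a simple restricted $\mathcal{G}_{\lambda,\mu}$-module on which $C$ acts as the scalar $c$ (central charge $c$). Then $W$ naturally carries the structure of a simple weak $V(c)$-module; that is, there is a $V(c)$-module structure $(W,d,Y_W)$ on $W$ with $$Y_W(L_{-2}\mathbf{1},x)=L(x),\quad Y_W(Y_{-\frac32}\mathbf{1},x)=\tilde{Y}(x),\quad Y_W(M_{-1}\mathbf{1},x)=M(x),$$ and this $V(c)$-module is simple.
   Context: $\mathbb{N}$ denotes the nonnegative integers and $\mathbb{Z}_+$ the positive integers. For $\lambda,\mu\in\mathbb{C}$, $\mathcal{G}_{\lambda,\mu}$ (the deformative Schrödinger–Virasoro algebra) is the complex Lie algebra with basis $\{L_m, M_m, Y_{m-\frac12}, C\mid m\in\mathbb{Z}\}$ and brackets, for $m,n\in\mathbb{Z}$, $$[L_m,L_n]=(n-m)L_{m+n}+\delta_{m+n,0}\tfrac{m^3-m}{12}C,\quad [L_m,Y_{n-\frac12}]=\Big(n-\tfrac{\lambda+1}{2}m+\mu-\tfrac12\Big)Y_{m+n-\frac12},$$ $$[Y_{m-\frac12},Y_{n-\frac12}]=(m-n)M_{m+n-1},\quad [L_m,M_n]=(n-\lambda m+2\mu)M_{m+n},$$ $$[M_m,M_n]=[M_m,Y_{n-\frac12}]=[\mathcal{G}_{\lambda,\mu},C]=0.$$ The algebra is $\frac12\mathbb{Z}$-graded, $\mathcal{G}_{\lambda,\mu}=\bigoplus_{r\in\frac12\mathbb{Z}}\mathcal{G}_{\lambda,\mu}^{(r)}$,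 where $L_m,M_m$ have degree $m$, $Y_{m-\frac12}$ has degree $m-\frac12$, and $C$ has degree $0$. A module $W$ is restricted if for every $v\in W$ there exists $n\in\mathbb{N}$ such that $\mathcal{G}_{\lambda,\mu}^{(n+i)}v=0$ for all $i\in\frac12\mathbb{Z}_+$. Generating functions: $L(x)=\sum_{n\in\mathbb{Z}}L_nx^{-n-2}$, $\tilde{Y}(x)=\sum_{n\in\mathbb{Z}}Y_{n-\frac12}x^{-n-1}$, $M(x)=\sum_{n\in\mathbb{Z}}M_nx^{-n-1}$. The vertex algebra $V(c)$: let $\mathcal{G}=\mathcal{G}_{\lambda,-\lambda/2}$ and $\mathcal{G}_+=\mathrm{Span}_{\mathbb{C}}\{L_{n-1},Y_{n-\frac12},M_n,C\mid n\in\mathbb{N}\}$, a subalgebra. Let $\mathbb{C}$ be the one-dimensional $\mathcal{G}_+$-module on which $C$ acts as $c$ and all $L_{n-1},Y_{n-\frac12},M_n$ ($n\in\mathbb{N}$) act as zero. Set $V(c)=\mathcal{U}(\mathcal{G})\otimes_{\mathcal{U}(\mathcal{G}_+)}\mathbb{C}$ and $\mathbf{1}=1\otimes 1$. There is a unique vertex algebra structure $(V(c),Y,\mathbf{1},D)$ on $V(c)$ with vacuum vector $\mathbf{1}$, $Y(L_{-2}\mathbf{1},x)=L(x)$, $Y(Y_{-\frac32}\mathbf{1},x)=\tilde{Y}(x)$ and $Y(M_{-1}\mathbf{1},x)=M(x)$. A module for a vertex algebra $(V,Y,\mathbf{1},D)$ is a triple $(W,d,Y_W)$ with $W$ a vector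 space, $d\in\mathrm{End}(W)$ and $Y_W(\cdot,z):V\to\mathrm{End}(W)[[z,z^{-1}]]$ linear, $Y_W(v,z)=\sum_nv_nz^{-n-1}$, such that: $v_nu=0$ for $n$ sufficiently large, for all $v\in V$, $u\in W$; $[d,Y_W(v,z)]=Y_W(D(v),z)=\frac{\mathrm{d}}{\mathrm{d}z}Y_W(v,z)$; $Y_W(\mathbf{1},z)=\mathrm{Id}_W$; and the Jacobi identity $$z_0^{-1}\delta\Big(\tfrac{z_1-z_2}{z_0}\Big)Y_W(u,z_1)Y_W(v,z_2)-z_0^{-1}\delta\Big(\tfrac{-z_2+z_1}{z_0}\Big)Y_W(v,z_2)Y_W(u,z_1)=z_2^{-1}\delta\Big(\tfrac{z_1-z_0}{z_2}\Big)Y_W(Y(u,z_0)v,z_2)$$ holds for $u,v\in V$. A weak $V(c)$-module means a module for $V(c)$ regarded as a vertex algebra. *)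

(* Defs.v *)
From HB Require Import structures.
From mathcomp Require Import all_boot all_order all_algebra.
From mathcomp Require Import generic_quotient.
From mathcomp Require Import boolp classical_sets fsbigop reals.
From mathcomp Require Import finmap complex monalg ring zify.

Set Implicit Arguments.
Unset Strict Implicit.
Unset Printing Implicit Defensive.

Import Order.TTheory GRing.Theory Num.Theory.
Local Open Scope ring_scope.
Local Open Scope quotient_scope.

HB.mixin Record Lmodule_isLieAlgebra (K : fieldType) g of GRing.Lmodule K g := {
  lie : g -> g -> g;
  lie_linl : forall y, linear (fun x => lie x y);
  lie_linr : forall x, linear (lie x);
  liexx : forall x, lie x x = 0;
  lie_jacobi : forall x y z,
    lie x (lie y z) + lie y (lie z x) + lie z (lie x y) = 0
}.

#[short(type="lieAlgType")]
HB.structure Definition LieAlgebra (K : fieldType) :=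
  { g of GRing.Lmodule K g & Lmodule_isLieAlgebra K g }.

Record lieModule (K : fieldType) (g : lieAlgType K) (W : lmodType K) :=
  LieModule {
    lact :> g -> W -> W;
    lact_linl : forall w, linear (fun x => lact x w);
    lact_linr : forall x, linear (lact x);
    lact_lie : forall x y w,
      lact (lie x y) w = lact x (lact y w) - lact y (lact x w)
  }.

Definition simple_lieModule (K : fieldType) (g : lieAlgType K)
    (W : lmodType K) (rho : lieModule g W) : Prop :=
  (exists w : W, w != 0) /\
  forall U : {pred W}, submod_closed U ->
    (forall x w, w \in U -> rho x w \in U) ->
    U =i pred1 0 \/ U =i predT.

Record algModule (K : fieldType) (A : algType K) (N : lmodType K) :=
  AlgModule {
    aact :> A -> N -> N;
    aact_linl : forall n, linear (fun a => aact a n);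
    aact_linr : forall a, linear (aact a);
    aact1 : forall n, aact 1 n = n;
    aactM : forall a b n, aact (a * b) n = aact a (aact b n)
  }.

Record lieSubalg (K : fieldType) (g : lieAlgType K) := LieSubalg {
  lsub : {pred g};
  lsub_submod : submod_closed lsub;
  lsub_lie : forall x y, x \in lsub -> y \in lsub -> lie x y \in lsub
}.

Section SubLie.
Context (K : fieldType) (g : lieAlgType K) (S : lieSubalg g).

HB.instance Definition _ :=
  GRing.isSubmodClosed.Build K g (lsub S) (lsub_submod S).

Record subLie := SubLie { subLie_val :> g; subLie_valP : subLie_val \in lsub S }.

HB.instance Definition _ := [isSub for subLie_val].
HB.instance Definition _ := [Choice of subLie by <:].
HB.instance Definition _ := [SubChoice_isSubLmodule of subLie by <:].

Definition sub_lie (x y : subLie) : subLie :=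
  SubLie (lsub_lie (subLie_valP x) (subLie_valP y)).

Fact sub_lie_linl y : linear (fun x => sub_lie x y).
Proof.
move=> a x x'; apply/val_inj.
by rewrite linearP /= (lie_linl _ a (val x) (val x')).
Qed.
Fact sub_lie_linr x : linear (sub_lie x).
Proof.
move=> a y y'; apply/val_inj.
by rewrite linearP /= (lie_linr _ a (val y) (val y')).
Qed.
Fact sub_liexx x : sub_lie x x = 0.
Proof. by apply/val_inj; rewrite raddf0 /= liexx. Qed.
Fact sub_lie_jacobi x y z :
  sub_lie x (sub_lie y z) + sub_lie y (sub_lie z x) + sub_lie z (sub_lie x y) = 0.
Proof. by apply/val_inj; rewrite raddf0 !raddfD /= lie_jacobi. Qed.
HB.instance Definition _ := Lmodule_isLieAlgebra.Build K subLie
  sub_lie_linl sub_lie_linr sub_liexx sub_lie_jacobi.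

Definition subLieAlg : lieAlgType K := LieAlgebra.clone K subLie _.
End SubLie.

(** [Uenv g] is the unital associative algebra presented by the generators
    [UVar x], [x] in [g], subject to linearity of [x |-> UVar x] and to
    [UVar [x, y] = UVar x * UVar y - UVar y * UVar x]: formal expressions modulo
    the least congruence [ueq] containing these relations and the axioms of
    unital associative algebras. *)

Section Enveloping.
Context (K : fieldType) (g : lieAlgType K).

Inductive uterm : Type :=
| UVar of g
| UZero
| UOne
| UAdd of uterm & uterm
| UScale of K & uterm
| UMul of uterm & uterm.

Inductive ueq : uterm -> uterm -> Prop :=
| ueq_refl s : ueq s s
| ueq_sym s t : ueq s t -> ueq t s
| ueq_trans s t u : ueq s t -> ueq t u -> ueq s u
| ueq_add s s' t t' : ueq s s' -> ueq t t' -> ueq (UAdd s t) (UAdd s' t')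
| ueq_scale a s s' : ueq s s' -> ueq (UScale a s) (UScale a s')
| ueq_mul s s' t t' : ueq s s' -> ueq t t' -> ueq (UMul s t) (UMul s' t')
| ueq_addA s t u : ueq (UAdd s (UAdd t u)) (UAdd (UAdd s t) u)
| ueq_addC s t : ueq (UAdd s t) (UAdd t s)
| ueq_add0 s : ueq (UAdd UZero s) s
| ueq_addN s : ueq (UAdd (UScale (-1) s) s) UZero
| ueq_scaleA a b s : ueq (UScale a (UScale b s)) (UScale (a * b) s)
| ueq_scale1 s : ueq (UScale 1 s) s
| ueq_scaleDr a s t :
    ueq (UScale a (UAdd s t)) (UAdd (UScale a s) (UScale a t))
| ueq_scaleDl a b s :
    ueq (UScale (a + b) s) (UAdd (UScale a s) (UScale b s))
| ueq_mulA s t u : ueq (UMul s (UMul t u)) (UMul (UMul s t) u)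
| ueq_mul1l s : ueq (UMul UOne s) s
| ueq_mul1r s : ueq (UMul s UOne) s
| ueq_mulDl s t u : ueq (UMul (UAdd s t) u) (UAdd (UMul s u) (UMul t u))
| ueq_mulDr s t u : ueq (UMul u (UAdd s t)) (UAdd (UMul u s) (UMul u t))
| ueq_scaleAl a s t : ueq (UScale a (UMul s t)) (UMul (UScale a s) t)
| ueq_scaleAr a s t : ueq (UScale a (UMul s t)) (UMul s (UScale a t))
| ueq_varD x y : ueq (UVar (x + y)) (UAdd (UVar x) (UVar y))
| ueq_varZ a x : ueq (UVar (a *: x)) (UScale a (UVar x))
| ueq_var_lie x y :
    ueq (UVar (lie x y))
        (UAdd (UMul (UVar x) (UVar y)) (UScale (-1) (UMul (UVar y) (UVar x)))).

HB.instance Definition _ := gen_eqMixin uterm.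
HB.instance Definition _ := gen_choiceMixin uterm.

Definition ueqb (s t : uterm) : bool := `[< ueq s t >].

Fact ueqb_refl : reflexive ueqb.
Proof. by move=> s; apply/asboolP/ueq_refl. Qed.
Fact ueqb_sym : symmetric ueqb.
Proof.
by move=> s t; apply/idP/idP=> /asboolP h; apply/asboolP; apply: ueq_sym.
Qed.
Fact ueqb_trans : transitive ueqb.
Proof.
move=> t s u /asboolP h1 /asboolP h2; apply/asboolP.
exact: ueq_trans h1 h2.
Qed.

Canonical ueq_equiv := EquivRel ueqb ueqb_refl ueqb_sym ueqb_trans.

Definition Uenv : Type := {eq_quot ueq_equiv}.

HB.instance Definition _ := Choice.on Uenv.

Definition Upi (t : uterm) : Uenv := \pi_({eq_quot ueq_equiv}) t.
Definition Urepr (a : Uenv) : uterm := repr (a : {eq_quot ueq_equiv}).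

Lemma UpiP s t : Upi s = Upi t <-> ueq s t.
Proof.
split=> [/eqmodP/asboolP //|h].
exact/eqmodP/asboolP.
Qed.
Lemma UreprK a : Upi (Urepr a) = a.
Proof. exact: reprK. Qed.
Lemma ueq_repr t : ueq (Urepr (Upi t)) t.
Proof. by apply/UpiP; rewrite UreprK. Qed.
Lemma U_ind (P : Uenv -> Prop) : (forall t, P (Upi t)) -> forall a, P a.
Proof. by move=> h a; rewrite -(UreprK a). Qed.

Definition uadd (a b : Uenv) : Uenv := Upi (UAdd (Urepr a) (Urepr b)).
Definition uscale (k : K) (a : Uenv) : Uenv := Upi (UScale k (Urepr a)).
Definition umul (a b : Uenv) : Uenv := Upi (UMul (Urepr a) (Urepr b)).

Lemma uaddE s t : uadd (Upi s) (Upi t) = Upi (UAdd s t).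
Proof. by apply/UpiP/ueq_add; apply: ueq_repr. Qed.
Lemma uscaleE k s : uscale k (Upi s) = Upi (UScale k s).
Proof. by apply/UpiP/ueq_scale; apply: ueq_repr. Qed.
Lemma umulE s t : umul (Upi s) (Upi t) = Upi (UMul s t).
Proof. by apply/UpiP/ueq_mul; apply: ueq_repr. Qed.

Let uE := (uaddE, uscaleE, umulE).

Fact uaddA : associative uadd.
Proof.
by elim/U_ind=> s; elim/U_ind=> t; elim/U_ind=> u; rewrite !uE;
  apply/UpiP/ueq_addA.
Qed.
Fact uaddC : commutative uadd.
Proof. by elim/U_ind=> s; elim/U_ind=> t; rewrite !uE; apply/UpiP/ueq_addC. Qed.
Fact uadd0 : left_id (Upi UZero) uadd.
Proof. by elim/U_ind=> s; rewrite !uE; apply/UpiP/ueq_add0. Qed.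
Fact uaddN : left_inverse (Upi UZero) (uscale (-1)) uadd.
Proof. by elim/U_ind=> s; rewrite !uE; apply/UpiP/ueq_addN. Qed.
HB.instance Definition _ := GRing.isZmodule.Build Uenv uaddA uaddC uadd0 uaddN.

Fact uscaleA a b (v : Uenv) : uscale a (uscale b v) = uscale (a * b) v.
Proof. by elim/U_ind: v => s; rewrite !uE; apply/UpiP/ueq_scaleA. Qed.
Fact uscale1 : left_id 1 uscale.
Proof. by elim/U_ind=> s; rewrite !uE; apply/UpiP/ueq_scale1. Qed.
Fact uscaleDr : right_distributive uscale +%R.
Proof.
move=> a; elim/U_ind=> s; elim/U_ind=> t.
by rewrite /GRing.add /= !uE; apply/UpiP/ueq_scaleDr.
Qed.
Fact uscaleDl (v : Uenv) : {morph uscale^~ v : a b / a + b}.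
Proof.
move=> a b; elim/U_ind: v => s.
by rewrite [in RHS]/GRing.add /= !uE; apply/UpiP/ueq_scaleDl.
Qed.
HB.instance Definition _ :=
  GRing.Zmodule_isLmodule.Build K Uenv uscaleA uscale1 uscaleDr uscaleDl.

Fact umulA : associative umul.
Proof.
by elim/U_ind=> s; elim/U_ind=> t; elim/U_ind=> u; rewrite !uE;
  apply/UpiP/ueq_mulA.
Qed.
Fact umul1l : left_id (Upi UOne) umul.
Proof. by elim/U_ind=> s; rewrite !uE; apply/UpiP/ueq_mul1l. Qed.
Fact umul1r : right_id (Upi UOne) umul.
Proof. by elim/U_ind=> s; rewrite !uE; apply/UpiP/ueq_mul1r. Qed.
Fact umulDl : left_distributive umul +%R.
Proof.
elim/U_ind=> s; elim/U_ind=> t; elim/U_ind=> u.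
by rewrite /GRing.add /= !uE; apply/UpiP/ueq_mulDl.
Qed.
Fact umulDr : right_distributive umul +%R.
Proof.
elim/U_ind=> u; elim/U_ind=> s; elim/U_ind=> t.
by rewrite /GRing.add /= !uE; apply/UpiP/ueq_mulDr.
Qed.

Section Eval.
Context (N : lmodType K) (rho : lieModule g N).

Fixpoint ueval (t : uterm) (n : N) : N :=
  match t with
  | UVar x => rho x n
  | UZero => 0
  | UOne => n
  | UAdd s t => ueval s n + ueval t n
  | UScale a s => a *: ueval s n
  | UMul s t => ueval s (ueval t n)
  end.

Lemma ueval_linear t : linear (ueval t).
Proof.
elim: t => [x|||s IHs t IHt|a s IHs|s IHs t IHt] k m n /=.
- exact: lact_linr.
- by rewrite scaler0 addr0.
- by [].
- by rewrite IHs IHt scalerDr addrACA.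
- by rewrite IHs scalerDr !scalerA mulrC.
- by rewrite IHt IHs.
Qed.

Lemma ueval_ueq s t : ueq s t -> ueval s =1 ueval t.
Proof.
have uevalD t' m n : ueval t' (m + n) = ueval t' m + ueval t' n.
  by have := ueval_linear t' 1 m n; rewrite !scale1r.
have ueval0 t' : ueval t' 0 = 0.
  by apply: (addIr (ueval t' 0)); rewrite -uevalD !add0r.
have uevalZ t' a n : ueval t' (a *: n) = a *: ueval t' n.
  by have := ueval_linear t' a n 0; rewrite ueval0 !addr0.
elim=> {s t} /=.
- by [].
- by move=> s t _ IH n; rewrite IH.
- by move=> s t u _ IH1 _ IH2 n; rewrite IH1 IH2.
- by move=> s s' t t' _ IH1 _ IH2 n; rewrite IH1 IH2.
- by move=> a s s' _ IH n; rewrite IH.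
- by move=> s s' t t' _ IH1 _ IH2 n; rewrite IH1 IH2.
- by move=> s t u n; rewrite addrA.
- by move=> s t n; rewrite addrC.
- by move=> s n; rewrite add0r.
- by move=> s n; rewrite scaleN1r addNr.
- by move=> a b s n; rewrite scalerA.
- by move=> s n; rewrite scale1r.
- by move=> a s t n; rewrite scalerDr.
- by move=> a b s n; rewrite scalerDl.
- by [].
- by [].
- by [].
- by [].
- by move=> s t u n; rewrite uevalD.
- by [].
- by move=> a s t n; rewrite uevalZ.
- move=> x y n; have := lact_linl rho n 1 x y.
  by rewrite !scale1r.
- move=> a x n; have rho0 : rho 0 n = 0.
    apply: (addIr (rho 0 n)); have := lact_linl rho n 1 0 0.
    by rewrite !scale1r !add0r => <-.
  by have := lact_linl rho n a x 0; rewrite rho0 !addr0.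
- by move=> x y n; rewrite lact_lie scaleN1r.
Qed.
End Eval.

Fact trivial_lact_linl (N : lmodType K) (w : N) : linear (fun _ : g => 0 : N).
Proof.
by move=> a x' y; rewrite -[RHS]/(a *: (0 : N) + (0 : N)) scaler0 addr0.
Qed.
Fact trivial_lact_linr (N : lmodType K) (x : g) : linear (fun _ : N => 0 : N).
Proof.
by move=> a x' y; rewrite -[RHS]/(a *: (0 : N) + (0 : N)) scaler0 addr0.
Qed.
Fact trivial_lact_lie (N : lmodType K) (x y : g) (w : N) : (0 : N) = 0 - 0.
Proof. by rewrite subr0. Qed.
Definition trivial_lieModule (N : lmodType K) : lieModule g N :=
  @LieModule K g N (fun _ _ => 0) (@trivial_lact_linl N) (@trivial_lact_linr N)
    (@trivial_lact_lie N).

Fact uone_neq0 : Upi UOne != 0.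
Proof.
apply/eqP=> /UpiP /(ueval_ueq (trivial_lieModule K^o)) /(_ 1) /= /eqP.
by rewrite oner_eq0.
Qed.

HB.instance Definition _ :=
  GRing.Zmodule_isNzRing.Build Uenv umulA umul1l umul1r umulDl umulDr uone_neq0.

Fact uscaleAl (a : K) (u v : Uenv) : a *: (u * v) = (a *: u) * v.
Proof.
elim/U_ind: u => s; elim/U_ind: v => t.
by rewrite /GRing.scale /GRing.mul /= !uE; apply/UpiP/ueq_scaleAl.
Qed.
HB.instance Definition _ := GRing.Lmodule_isLalgebra.Build K Uenv uscaleAl.

Fact uscaleAr (a : K) (u v : Uenv) : a *: (u * v) = u * (a *: v).
Proof.
elim/U_ind: u => s; elim/U_ind: v => t.
by rewrite /GRing.scale /GRing.mul /= !uE; apply/UpiP/ueq_scaleAr.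
Qed.
HB.instance Definition _ := GRing.Lalgebra_isAlgebra.Build K Uenv uscaleAr.

Definition Uvar (x : g) : Uenv := Upi (UVar x).

Lemma Uvar_linear : linear Uvar.
Proof.
move=> a x y; rewrite /Uvar /GRing.add /GRing.scale /= !uE.
apply/UpiP/(ueq_trans (ueq_varD _ _))/ueq_add; last exact: ueq_refl.
exact: ueq_varZ.
Qed.
Lemma Uvar_lie x y : Uvar (lie x y) = Uvar x * Uvar y - Uvar y * Uvar x.
Proof.
rewrite -scaleN1r /Uvar /GRing.add /GRing.scale /GRing.mul /= !uE.
exact/UpiP/ueq_var_lie.
Qed.

Section Act.
Context (N : lmodType K) (rho : lieModule g N).

Definition U_act (a : Uenv) (n : N) : N := ueval rho (Urepr a) n.

Lemma U_actE t n : U_act (Upi t) n = ueval rho t n.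
Proof. exact/ueval_ueq/ueq_repr. Qed.

Fact U_act_linl n : linear (fun a => U_act a n).
Proof.
move=> k; elim/U_ind=> s; elim/U_ind=> t.
by rewrite /GRing.add /GRing.scale /= !uE !U_actE.
Qed.
Fact U_act_linr a : linear (U_act a).
Proof. exact: ueval_linear. Qed.
Fact U_act1 n : U_act 1 n = n.
Proof. exact: U_actE. Qed.
Fact U_actM a b n : U_act (a * b) n = U_act a (U_act b n).
Proof.
elim/U_ind: a => s; elim/U_ind: b => t.
by rewrite {1}/GRing.mul /= uE !U_actE.
Qed.
Definition U_module : algModule Uenv N :=
  AlgModule U_act_linl U_act_linr U_act1 U_actM.
End Act.
End Enveloping.

Section EnvelopingSub.
Context (K : fieldType) (g : lieAlgType K) (S : lieSubalg g).

Fixpoint uterm_incl (t : uterm (subLieAlg S)) : uterm g :=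
  match t with
  | UVar x => UVar (subLie_val x)
  | UZero => UZero g
  | UOne => UOne g
  | UAdd s t => UAdd (uterm_incl s) (uterm_incl t)
  | UScale a s => UScale a (uterm_incl s)
  | UMul s t => UMul (uterm_incl s) (uterm_incl t)
  end.

Lemma ueq_incl s t : ueq s t -> ueq (uterm_incl s) (uterm_incl t).
Proof.
elim=> {s t}.
- by move=> s; apply ueq_refl.
- by move=> *; apply ueq_sym.
- by move=> s t u _ h1 _ h2; apply (ueq_trans h1 h2).
- by move=> *; apply ueq_add.
- by move=> *; apply ueq_scale.
- by move=> *; apply ueq_mul.
- by move=> *; apply ueq_addA.
- by move=> *; apply ueq_addC.
- by move=> *; apply ueq_add0.
- by move=> *; apply ueq_addN.
- by move=> *; apply ueq_scaleA.
- by move=> *; apply ueq_scale1.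
- by move=> *; apply ueq_scaleDr.
- by move=> *; apply ueq_scaleDl.
- by move=> *; apply ueq_mulA.
- by move=> *; apply ueq_mul1l.
- by move=> *; apply ueq_mul1r.
- by move=> *; apply ueq_mulDl.
- by move=> *; apply ueq_mulDr.
- by move=> *; apply ueq_scaleAl.
- by move=> *; apply ueq_scaleAr.
- move=> x y; have e : subLie_val (x + y) = subLie_val x + subLie_val y
    by exact: (raddfD val).
  exact (eq_ind _ (fun z => ueq (UVar z) _) (ueq_varD _ _) _ (esym e)).
- move=> a x; have e : subLie_val (a *: x) = a *: subLie_val x
    by exact: (linearZZ val).
  exact (eq_ind _ (fun z => ueq (UVar z) _) (ueq_varZ _ _) _ (esym e)).
- by move=> x y; apply ueq_var_lie.
Qed.

(** The algebra morphism [Uenv(S) -> Uenv(g)] induced by the inclusion. *)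
Definition U_incl (b : Uenv (subLieAlg S)) : Uenv g := Upi (uterm_incl (Urepr b)).

Lemma U_inclE t : U_incl (Upi t) = Upi (uterm_incl t).
Proof. exact/UpiP/ueq_incl/ueq_repr. Qed.
End EnvelopingSub.

(** [tensor f act] is [A (x)_B N], where [A] is a right [B]-module through
    [f : B -> A] and [N] a left [B]-module through [act], presented like [Uenv]
    by generators [TPure a n] and relations. *)

Section Tensor.
Context (K : fieldType) (A B : algType K) (f : B -> A).
Context (N : lmodType K) (act : algModule B N).

Inductive tterm : Type :=
| TPure of A & N
| TZero
| TAdd of tterm & tterm
| TScale of K & tterm.

Inductive teq : tterm -> tterm -> Prop :=
| teq_refl s : teq s s
| teq_sym s t : teq s t -> teq t s
| teq_trans s t u : teq s t -> teq t u -> teq s u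
| teq_add s s' t t' : teq s s' -> teq t t' -> teq (TAdd s t) (TAdd s' t')
| teq_scale a s s' : teq s s' -> teq (TScale a s) (TScale a s')
| teq_addA s t u : teq (TAdd s (TAdd t u)) (TAdd (TAdd s t) u)
| teq_addC s t : teq (TAdd s t) (TAdd t s)
| teq_add0 s : teq (TAdd TZero s) s
| teq_addN s : teq (TAdd (TScale (-1) s) s) TZero
| teq_scaleA a b s : teq (TScale a (TScale b s)) (TScale (a * b) s)
| teq_scale1 s : teq (TScale 1 s) s
| teq_scaleDr a s t :
    teq (TScale a (TAdd s t)) (TAdd (TScale a s) (TScale a t))
| teq_scaleDl a b s :
    teq (TScale (a + b) s) (TAdd (TScale a s) (TScale b s))
| teq_pureDl a a' n : teq (TPure (a + a') n) (TAdd (TPure a n) (TPure a' n))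
| teq_pureDr a n n' : teq (TPure a (n + n')) (TAdd (TPure a n) (TPure a n'))
| teq_pureZl k a n : teq (TPure (k *: a) n) (TScale k (TPure a n))
| teq_pureZr k a n : teq (TPure a (k *: n)) (TScale k (TPure a n))
| teq_balanced a b n : teq (TPure (a * f b) n) (TPure a (act b n)).

HB.instance Definition _ := gen_eqMixin tterm.
HB.instance Definition _ := gen_choiceMixin tterm.

Definition teqb (s t : tterm) : bool := `[< teq s t >].

Fact teqb_refl : reflexive teqb.
Proof. by move=> s; apply/asboolP/teq_refl. Qed.
Fact teqb_sym : symmetric teqb.
Proof.
by move=> s t; apply/idP/idP=> /asboolP h; apply/asboolP; apply: teq_sym.
Qed.
Fact teqb_trans : transitive teqb.
Proof.
move=> t s u /asboolP h1 /asboolP h2; apply/asboolP.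
exact: teq_trans h1 h2.
Qed.

Canonical teq_equiv := EquivRel teqb teqb_refl teqb_sym teqb_trans.

Definition tensor : Type := {eq_quot teq_equiv}.

HB.instance Definition _ := Choice.on tensor.

Definition Tpi (t : tterm) : tensor := \pi_({eq_quot teq_equiv}) t.
Definition Trepr (a : tensor) : tterm := repr (a : {eq_quot teq_equiv}).

Lemma TpiP s t : Tpi s = Tpi t <-> teq s t.
Proof.
split=> [/eqmodP/asboolP //|h].
exact/eqmodP/asboolP.
Qed.
Lemma TreprK a : Tpi (Trepr a) = a.
Proof. exact: reprK. Qed.
Lemma teq_repr t : teq (Trepr (Tpi t)) t.
Proof. by apply/TpiP; rewrite TreprK. Qed.
Lemma tensor_ind (P : tensor -> Prop) : (forall t, P (Tpi t)) -> forall a, P a.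
Proof. by move=> h a; rewrite -(TreprK a). Qed.

Definition tadd (a b : tensor) : tensor := Tpi (TAdd (Trepr a) (Trepr b)).
Definition tscale (k : K) (a : tensor) : tensor := Tpi (TScale k (Trepr a)).

Lemma taddE s t : tadd (Tpi s) (Tpi t) = Tpi (TAdd s t).
Proof. by apply/TpiP/teq_add; apply: teq_repr. Qed.
Lemma tscaleE k s : tscale k (Tpi s) = Tpi (TScale k s).
Proof. by apply/TpiP/teq_scale; apply: teq_repr. Qed.

Let tE := (taddE, tscaleE).

Fact taddA : associative tadd.
Proof.
by elim/tensor_ind=> s; elim/tensor_ind=> t; elim/tensor_ind=> u; rewrite !tE;
  apply/TpiP/teq_addA.
Qed.
Fact taddC : commutative tadd.
Proof.
by elim/tensor_ind=> s; elim/tensor_ind=> t; rewrite !tE; apply/TpiP/teq_addC.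
Qed.
Fact tadd0 : left_id (Tpi TZero) tadd.
Proof. by elim/tensor_ind=> s; rewrite !tE; apply/TpiP/teq_add0. Qed.
Fact taddN : left_inverse (Tpi TZero) (tscale (-1)) tadd.
Proof. by elim/tensor_ind=> s; rewrite !tE; apply/TpiP/teq_addN. Qed.
HB.instance Definition _ := GRing.isZmodule.Build tensor taddA taddC tadd0 taddN.

Fact tscaleA a b (v : tensor) : tscale a (tscale b v) = tscale (a * b) v.
Proof. by elim/tensor_ind: v => s; rewrite !tE; apply/TpiP/teq_scaleA. Qed.
Fact tscale1 : left_id 1 tscale.
Proof. by elim/tensor_ind=> s; rewrite !tE; apply/TpiP/teq_scale1. Qed.
Fact tscaleDr : right_distributive tscale +%R.
Proof.
move=> a; elim/tensor_ind=> s; elim/tensor_ind=> t.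
by rewrite /GRing.add /= !tE; apply/TpiP/teq_scaleDr.
Qed.
Fact tscaleDl (v : tensor) : {morph tscale^~ v : a b / a + b}.
Proof.
move=> a b; elim/tensor_ind: v => s.
by rewrite [in RHS]/GRing.add /= !tE; apply/TpiP/teq_scaleDl.
Qed.
HB.instance Definition _ :=
  GRing.Zmodule_isLmodule.Build K tensor tscaleA tscale1 tscaleDr tscaleDl.

Lemma TpiD s t : Tpi (TAdd s t) = Tpi s + Tpi t.
Proof. exact/esym/taddE. Qed.
Lemma TpiZ k s : Tpi (TScale k s) = k *: Tpi s.
Proof. exact/esym/tscaleE. Qed.

Definition tpure (a : A) (n : N) : tensor := Tpi (TPure a n).

Fixpoint tterm_act (a : A) (t : tterm) : tterm :=
  match t with
  | TPure b n => TPure (a * b) n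
  | TZero => TZero
  | TAdd s t => TAdd (tterm_act a s) (tterm_act a t)
  | TScale k s => TScale k (tterm_act a s)
  end.

Lemma teq_act a s t : teq s t -> teq (tterm_act a s) (tterm_act a t).
Proof.
elim=> {s t} /=.
- by move=> s; apply teq_refl.
- by move=> *; apply teq_sym.
- by move=> s t u _ h1 _ h2; apply (teq_trans h1 h2).
- by move=> *; apply teq_add.
- by move=> *; apply teq_scale.
- by move=> *; apply teq_addA.
- by move=> *; apply teq_addC.
- by move=> *; apply teq_add0.
- by move=> *; apply teq_addN.
- by move=> *; apply teq_scaleA.
- by move=> *; apply teq_scale1.
- by move=> *; apply teq_scaleDr.
- by move=> *; apply teq_scaleDl.
- by move=> b b' n; rewrite mulrDr; apply teq_pureDl.
- by move=> *; apply teq_pureDr.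
- by move=> k b n; rewrite -scalerAr; apply teq_pureZl.
- by move=> *; apply teq_pureZr.
- by move=> b c n; rewrite mulrA; apply teq_balanced.
Qed.

Definition tensor_act (a : A) (v : tensor) : tensor := Tpi (tterm_act a (Trepr v)).

Lemma tensor_actE a t : tensor_act a (Tpi t) = Tpi (tterm_act a t).
Proof. exact/TpiP/teq_act/teq_repr. Qed.

Fact tensor_act_linr a : linear (tensor_act a).
Proof.
move=> k; elim/tensor_ind=> s; elim/tensor_ind=> t.
by rewrite -TpiZ -TpiD !tensor_actE /= TpiD TpiZ.
Qed.
Fact tensor_act_linl v : linear (fun a => tensor_act a v).
Proof.
elim/tensor_ind: v => s k a b; rewrite !tensor_actE.
elim: s => [c n||s IHs t IHt|l s IHs] /=.
- rewrite mulrDl -scalerAl -TpiZ -TpiD; apply/TpiP.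
  apply: (teq_trans (teq_pureDl _ _ _)); apply: teq_add.
    by apply: teq_pureZl.
  by apply: teq_refl.
- by rewrite -[Tpi TZero]/(0 : tensor) scaler0 addr0.
- by rewrite !TpiD IHs IHt scalerDr addrACA.
- by rewrite !TpiZ IHs scalerDr !scalerA mulrC.
Qed.
Fact tensor_act1 v : tensor_act 1 v = v.
Proof.
elim/tensor_ind: v => s; rewrite tensor_actE; congr Tpi.
by elim: s => [b n||s IHs t IHt|k s IHs] /=; rewrite ?mul1r ?IHs ?IHt.
Qed.
Fact tensor_actM a b v : tensor_act (a * b) v = tensor_act a (tensor_act b v).
Proof.
elim/tensor_ind: v => s; rewrite !tensor_actE; congr Tpi.
by elim: s => [c n||s IHs t IHt|k s IHs] /=; rewrite ?mulrA ?IHs ?IHt.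
Qed.
Definition tensor_module : algModule A tensor :=
  AlgModule tensor_act_linl tensor_act_linr tensor_act1 tensor_actM.
End Tensor.

Section Restrict.
Context (K : fieldType) (g : lieAlgType K) (N : lmodType K).
Context (act : algModule (Uenv g) N).

Fact restrict_linl n : linear (fun x : g => act (Uvar x) n).
Proof. by move=> a x y; rewrite Uvar_linear aact_linl. Qed.
Fact restrict_lie x y n :
  act (Uvar (lie x y)) n
  = act (Uvar x) (act (Uvar y) n) - act (Uvar y) (act (Uvar x) n).
Proof.
rewrite Uvar_lie -!aactM addrC -scaleN1r aact_linl scaleN1r.
by rewrite addrC.
Qed.
Definition U_lieModule : lieModule g N :=
  LieModule restrict_linl (fun x => aact_linr act (Uvar x)) restrict_lie.
End Restrict.

(** Labels of the basis: [iY m] stands for [Y_{m - 1/2}]. *)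
Inductive dsv_index := iL of int | iM of int | iY of int | iC.

Definition dsv_index_code (i : dsv_index) : int + int + int + unit :=
  match i with
  | iL m => inl (inl (inl m))
  | iM m => inl (inl (inr m))
  | iY m => inl (inr m)
  | iC => inr tt
  end.
Definition dsv_index_decode (i : int + int + int + unit) : dsv_index :=
  match i with
  | inl (inl (inl m)) => iL m
  | inl (inl (inr m)) => iM m
  | inl (inr m) => iY m
  | inr _ => iC
  end.
Fact dsv_index_codeK : cancel dsv_index_code dsv_index_decode.
Proof. by case. Qed.
HB.instance Definition _ := Choice.copy dsv_index (can_type dsv_index_codeK).

Section LinearExtension.
Context (K : fieldType) (I : choiceType) (V : lmodType K).

(** The linear map on the space with basis [I] taking the values [f i] there. *)
Definition lext (f : I -> V) (x : {malg K[I]}) : V :=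
  \sum_(i <- msupp x) x@_i *: f i.

Lemma lextEw f x (d : {fset I}) : (msupp x `<=` d)%fset ->
  lext f x = \sum_(i <- d) x@_i *: f i.
Proof.
move=> le; rewrite /lext; apply: (big_fset_incl _ le) => i _ ni.
by rewrite mcoeff_outdom // scale0r.
Qed.

Lemma lext_linear f : linear (lext f).
Proof.
move=> a x y; pose d := (msupp (a *: x + y) `|` (msupp x `|` msupp y))%fset.
have sub z : z \in [:: a *: x + y; x; y] -> (msupp z `<=` d)%fset.
  by rewrite !inE => /or3P[] /eqP ->; apply/fsubsetP => i ix; rewrite !inE ix ?orbT.
rewrite !(@lextEw f _ d) ?sub ?inE ?eqxx ?orbT //.
rewrite scaler_sumr -big_split; apply: eq_bigr => i _ /=.
by rewrite mcoeffD mcoeffZ scalerDl scalerA.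
Qed.

Lemma lextU f i : lext f << i >> = f i.
Proof.
by rewrite /lext msuppU oner_eq0 big_seq_fset1 mcoeffUU scale1r.
Qed.

Lemma lext_linear_fun (f : {malg K[I]} -> I -> V) x :
  (forall i, linear (f^~ i)) -> linear (fun y => lext (f y) x).
Proof.
move=> lf a y z; rewrite /lext scaler_sumr -big_split; apply: eq_bigr => i _ /=.
by rewrite lf scalerDr !scalerA mulrC.
Qed.

Lemma malg_linear_ext (f h : {malg K[I]} -> V) :
  linear f -> linear h -> (forall i, f << i >> = h << i >>) -> f =1 h.
Proof.
move=> lf lh e x; rewrite (monalgE x).
have z0 (k : {malg K[I]} -> V) : linear k -> k 0 = 0.
  move=> lk; apply: (addIr (k 0)); rewrite add0r.
  by have := lk 1 0 0; rewrite !scale1r !add0r => <-.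
elim/big_ind: _ => [||i _].
- by rewrite !z0.
- move=> y z ey ez.
  by have := lf 1 y z; have := lh 1 y z; rewrite !scale1r ey ez => -> ->.
- have -> : << x@_i *g i >> = x@_i *: << i >> + 0 :> {malg K[I]}.
    rewrite addr0; apply/malgP => j.
    by rewrite mcoeffZ !mcoeffU mulr_natr.
  by rewrite lf lh e !z0.
Qed.
End LinearExtension.

Section Coefficients.
Context (K : numFieldType) (lam mu : K).

(** Coefficient of [Y_{m+n-1/2}] in [[L_m, Y_{n-1/2}]], of [M_{m+n}] in
    [[L_m, M_n]], and of [C] in [[L_m, L_n]]. *)
Definition brLY (m n : int) : K := n%:~R - (lam + 1) / 2 * m%:~R + mu - 2^-1.
Definition brLM (m n : int) : K := n%:~R - lam * m%:~R + 2 * mu.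
Definition brLLC (m n : int) : K :=
  (m + n == 0)%:R * ((m ^+ 3 - m)%:~R / 12).
End Coefficients.

Section JacobiFromRelations.
Context (K : numFieldType) (lam mu : K) (V : lmodType K) (b : V -> V -> V).
Context (bl : forall y, linear (fun x => b x y)) (br : forall x, linear (b x)).
Local Notation brLY := (brLY lam mu).
Local Notation brLM := (brLM lam mu).
Local Notation brLLC := (brLLC K).

Context (L M Y : int -> V) (C : V).

Context (LL : forall m n, b (L m) (L n) =
  (n - m)%:~R *: L (m + n) + brLLC m n *: C).
Context (LY : forall m n, b (L m) (Y n) = brLY m n *: Y (m + n)).
Context (YL : forall m n, b (Y n) (L m) = - (brLY m n *: Y (m + n))).
Context (LM : forall m n, b (L m) (M n) = brLM m n *: M (m + n)).
Context (ML : forall m n, b (M n) (L m) = - (brLM m n *: M (m + n))).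
Context (YY : forall m n, b (Y m) (Y n) = (m - n)%:~R *: M (m + n - 1)).
Context (xC : forall x, b x C = 0).

Let J x y z := b x (b y z) + b y (b z x) + b z (b x y).

Let b0 z : b z 0 = 0.
Proof.
apply: (addIr (b z 0)); rewrite add0r.
by have := br z 1 0 0; rewrite !scale1r add0r => <-.
Qed.
Let bD x y z : b z (x + y) = b z x + b z y.
Proof. by have := br z 1 x y; rewrite !scale1r. Qed.
Let bZ a x z : b z (a *: x) = a *: b z x.
Proof. by have := br z a x 0; rewrite b0 !addr0. Qed.
Let bN x z : b z (- x) = - b z x.
Proof. by rewrite -scaleN1r bZ scaleN1r. Qed.

Lemma jacobi_LYY m n p : J (L m) (Y n) (Y p) = 0.
Proof.
rewrite /J YY YL LY !(bZ, bN) LM !YY.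
have -> : n + (m + p) - 1 = m + (n + p - 1) by ring.
have -> : p + (m + n) - 1 = m + (n + p - 1) by ring.
rewrite !scalerA -scaleNr -!scalerDl.
rewrite (_ : _ + _ = 0 :> K) ?scale0r // /brLM /brLY !(rmorphB, rmorphD) /=.
by field.
Qed.

Lemma jacobi_LLY m n p : J (L m) (L n) (Y p) = 0.
Proof.
rewrite /J LL YL LY !(bZ, bN, bD) !LY !YL xC scaler0 addr0.
have -> : n + (m + p) = m + (n + p) by ring.
have -> : m + n + p = m + (n + p) by ring.
rewrite !scalerN -!scaleNr !scalerA -!scalerDl.
rewrite (_ : _ + _ = 0 :> K) ?scale0r // /brLY !(rmorphB, rmorphD) /=.
by field.
Qed.

Lemma jacobi_LLM m n p : J (L m) (L n) (M p) = 0.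
Proof.
rewrite /J LL ML LM !(bZ, bN, bD) !LM !ML xC scaler0 addr0.
have -> : n + (m + p) = m + (n + p) by ring.
have -> : m + n + p = m + (n + p) by ring.
rewrite !scalerN -!scaleNr !scalerA -!scalerDl.
rewrite (_ : _ + _ = 0 :> K) ?scale0r // /brLM !(rmorphB, rmorphD) /=.
by ring.
Qed.

Lemma jacobi_LLL m n p : J (L m) (L n) (L p) = 0.
Proof.
rewrite /J !LL !(bZ, bD, xC, scaler0, addr0) !LL.
have -> : n + (p + m) = m + (n + p) by ring.
have -> : p + (m + n) = m + (n + p) by ring.
rewrite !scalerDr !scalerA.
have sh (a a' c c' d d' : K) (x y : V) :
    a *: x + a' *: y + (c *: x + c' *: y) + (d *: x + d' *: y)
    = (a + c + d) *: x + (a' + c' + d') *: y.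
  by rewrite !scalerDl (addrACA (a *: x)) (addrACA (a *: x + c *: x)).
rewrite sh (_ : _ + _ + _ = 0 :> K) ?scale0r ?add0r; last first.
  by rewrite !(rmorphB, rmorphD) /=; ring.
rewrite (_ : _ + _ + _ = 0 :> K) ?scale0r // /brLLC.
have -> : (n + (p + m) == 0) = (m + (n + p) == 0) by congr (_ == _); ring.
have -> : (p + (m + n) == 0) = (m + (n + p) == 0) by congr (_ == _); ring.
case: eqP => [e|_]; last by rewrite !mul0r !mulr0 !addr0.
have -> : m = - n - p by rewrite -[LHS]addr0 -[0]oppr0 -e; ring.
rewrite !mul1r !mulrA -!mulrDl -!rmorphM -!rmorphD /=.
by rewrite (_ : _ + _ + _ = 0) ?mul0r //; ring.
Qed.

Context (YM : forall m n, b (Y m) (M n) = 0).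
Context (MY : forall m n, b (M m) (Y n) = 0).
Context (MM : forall m n, b (M m) (M n) = 0).
Context (Cx : forall x, b C x = 0).

Definition dsv_vector (i : dsv_index) : V :=
  match i with iL m => L m | iM m => M m | iY m => Y m | iC => C end.

Lemma jacobi_dsv_vector i j k :
  J (dsv_vector i) (dsv_vector j) (dsv_vector k) = 0.
Proof.
have cyc x y z : J x y z = 0 -> J z x y = 0.
  by move=> h; rewrite -[RHS]h /J [RHS]addrC addrA.
case: i j k => [m|m|m|] [n|n|n|] [p|p|p|] /=;
  by [ exact: jacobi_LLL | exact: jacobi_LLY | exact: jacobi_LLM
     | exact: jacobi_LYY | apply/cyc; exact: jacobi_LLY
     | apply/cyc; exact: jacobi_LLM | apply/cyc; exact: jacobi_LYY
     | apply/cyc/cyc; exact: jacobi_LLY | apply/cyc/cyc; exact: jacobi_LLM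
     | apply/cyc/cyc; exact: jacobi_LYY
     | rewrite /J ?(LL, LY, YL, LM, ML, YY, YM, MY, MM, xC, Cx)
         ?(bZ, bN, bD, b0) ?(YM, MY, MM, xC, Cx)
         ?(scaler0, oppr0, addr0) ].
Qed.

Lemma anti_dsv_vector i j :
  b (dsv_vector i) (dsv_vector j) = - b (dsv_vector j) (dsv_vector i).
Proof.
case: i j => [m|m|m|] [n|n|n|] /=;
  rewrite ?(LL, LY, YL, LM, ML, YY, YM, MY, MM, xC, Cx) ?oppr0 ?opprK //.
- rewrite opprD -!scaleNr -rmorphN opprB [n + m]addrC; congr (_ + _ *: _).
  rewrite /brLLC [n + m]addrC.
  case: eqP => [/eqP|_]; last by rewrite !mul0r oppr0.
  rewrite addrC addr_eq0 => /eqP ->; rewrite !mul1r -mulNr -rmorphN.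
  by congr (_%:~R / _); ring.
- by rewrite -scaleNr -rmorphN opprB [n + m]addrC.
Qed.

Lemma jacobi_cycle x y z : J x y z = 0 -> J z x y = 0.
Proof. by move=> h; rewrite -[RHS]h /J [RHS]addrC addrA. Qed.

Lemma jacobi_linear y z : linear (fun x => J x y z).
Proof.
move=> a x x'.
have sh (p p' q q' r r' : V) :
    p + p' + (q + q') + (r + r') = p + q + r + (p' + q' + r').
  by rewrite (addrACA p) (addrACA (p + q)).
by rewrite /J !(bl, br) !scalerDr sh.
Qed.
End JacobiFromRelations.

Definition dsv (K : numFieldType) (lam mu : K) : Type := {malg K[dsv_index]}.

Section DSV.
Context (K : numFieldType) (lam mu : K).

HB.instance Definition _ := GRing.Lmodule.on (dsv lam mu).

Local Notation dsv := (dsv lam mu).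

Definition dL (m : int) : dsv := << iL m >>.
Definition dM (m : int) : dsv := << iM m >>.
Definition dY (m : int) : dsv := << iY m >>.
Definition dC : dsv := << iC >>.

Definition dsv_br (i j : dsv_index) : dsv :=
  match i, j with
  | iL m, iL n => (n - m)%:~R *: dL (m + n) + brLLC K m n *: dC
  | iL m, iY n => brLY lam mu m n *: dY (m + n)
  | iY n, iL m => - (brLY lam mu m n *: dY (m + n))
  | iY m, iY n => (m - n)%:~R *: dM (m + n - 1)
  | iL m, iM n => brLM lam mu m n *: dM (m + n)
  | iM n, iL m => - (brLM lam mu m n *: dM (m + n))
  | _, _ => 0
  end.

Definition dsv_lie (x y : dsv) : dsv := lext (fun i => lext (dsv_br i) y) x.

Fact dsv_lie_linl y : linear (fun x => dsv_lie x y).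
Proof. exact: lext_linear. Qed.
Fact dsv_lie_linr x : linear (dsv_lie x).
Proof.
apply: (@lext_linear_fun _ _ _ (fun y i => lext (dsv_br i) y)) => i.
exact: lext_linear.
Qed.

Lemma dsv_lieE i j : dsv_lie << i >> << j >> = dsv_br i j.
Proof. by rewrite /dsv_lie !lextU. Qed.

Lemma lieCx x : dsv_lie dC x = 0.
Proof.
move: x; apply: malg_linear_ext; first exact: dsv_lie_linr.
- by move=> a x y; rewrite -[RHS]/(a *: (0 : dsv) + (0 : dsv)) scaler0 addr0.
by move=> i; rewrite dsv_lieE; case: i.
Qed.
Lemma liexC x : dsv_lie x dC = 0.
Proof.
move: x; apply: malg_linear_ext; first exact: dsv_lie_linl.
- by move=> a x y; rewrite -[RHS]/(a *: (0 : dsv) + (0 : dsv)) scaler0 addr0.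
by move=> i; rewrite dsv_lieE; case: i.
Qed.

Lemma dsv_vectorE i : dsv_vector dL dM dY dC i = << i >>.
Proof. by case: i. Qed.

Fact dsv_lieC x y : dsv_lie x y = - dsv_lie y x.
Proof.
have opp_lin (f : dsv -> dsv) (lf : linear f) : linear (fun z => - f z).
  by move=> a u v; rewrite lf opprD scalerN.
move: x; apply: malg_linear_ext.
- exact: dsv_lie_linl.
- exact/opp_lin/dsv_lie_linr.
move=> i; move: y; apply: malg_linear_ext.
- exact: dsv_lie_linr.
- exact/opp_lin/dsv_lie_linl.
move=> j; rewrite -!dsv_vectorE.
by apply: (@anti_dsv_vector K lam mu) => *; first [exact: dsv_lieE | exact: liexC | exact: lieCx].
Qed.

Fact dsv_liexx x : dsv_lie x x = 0.
Proof.
have /eqP := dsv_lieC x x; rewrite -subr_eq0 opprK -mulr2n -scaler_nat.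
by rewrite scaler_eq0 pnatr_eq0 /= => /eqP.
Qed.

Fact dsv_jacobi x y z : dsv_lie x (dsv_lie y z) + dsv_lie y (dsv_lie z x)
  + dsv_lie z (dsv_lie x y) = 0.
Proof.
have lin u v := jacobi_linear dsv_lie_linl dsv_lie_linr u v.
have lin0 : linear (fun _ : dsv => 0 : dsv).
  by move=> a u v; rewrite -[RHS]/(a *: (0 : dsv) + (0 : dsv)) scaler0 addr0.
move: x; apply: malg_linear_ext => [||i]; [exact: lin | exact: lin0 |].
apply: jacobi_cycle; move: y.
apply: malg_linear_ext => [||j]; [exact: lin | exact: lin0 |].
apply: jacobi_cycle; move: z.
apply: malg_linear_ext => [||k]; [exact: lin | exact: lin0 |].
rewrite -!dsv_vectorE.
by apply: (@jacobi_dsv_vector K lam mu) => *;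
  first [exact: dsv_lieE | exact: liexC | exact: lieCx | exact: dsv_lie_linr].
Qed.

HB.instance Definition _ := Lmodule_isLieAlgebra.Build K dsv
  dsv_lie_linl dsv_lie_linr dsv_liexx dsv_jacobi.
End DSV.

Section InducedModule.
Context (K : numFieldType) (lam : K).

Local Notation dsv := (dsv lam (- lam / 2)).

(** The basis elements [L_{n-1}], [Y_{n-1/2}], [M_n] ([n >= 0]) and [C]. *)
Definition dsv_plus_index (i : dsv_index) : bool :=
  match i with
  | iL m => -1 <= m
  | iM m => 0 <= m
  | iY m => 0 <= m
  | iC => true
  end.

Definition dsv_plus_pred : {pred dsv} :=
  [pred x : dsv | all dsv_plus_index (msupp x)].

Lemma dsv_plusP (x : dsv) :
  reflect (forall i, ~~ dsv_plus_index i -> x@_i = 0) (x \in dsv_plus_pred).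
Proof.
apply: (iffP allP) => [h i ni|h i].
  by apply: mcoeff_outdom; apply: contra ni; apply: h.
by rewrite -mcoeff_neq0; apply: contraR => /h ->.
Qed.

Fact dsv_plus_submod : submod_closed dsv_plus_pred.
Proof.
split=> [|a x y /dsv_plusP hx /dsv_plusP hy]; apply/dsv_plusP => i ni.
  exact: mcoeff0.
by rewrite [LHS]mcoeffD mcoeffZ hx // hy // mulr0 addr0.
Qed.

Lemma mcoeffZU (a : K) (i k : dsv_index) :
  (~~ dsv_plus_index k || (k == iC) -> i = k -> a = 0) ->
  ~~ dsv_plus_index k || (k == iC) ->
  (a *: << i >> : {malg K[dsv_index]})@_k = 0.
Proof.
move=> h nk; rewrite mcoeffZ mcoeffU.
by case: eqP => [e|_]; rewrite ?mulr0 // (h nk e) mul0r.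
Qed.

Lemma dsv_br_plus i j k : dsv_plus_index i -> dsv_plus_index j ->
  ~~ dsv_plus_index k || (k == iC) ->
  (dsv_br lam (- lam / 2) i j)@_k = 0.
Proof.
move=> hi hj nk; move: i j hi hj.
have LY m n : -1 <= m -> 0 <= n ->
    (brLY lam (- lam / 2) m n *: << iY (m + n) >> : {malg K[dsv_index]})@_k = 0.
  move=> hm hn; apply: (mcoeffZU _ nk) => + e; rewrite -e orbF /= => lt0.
  have -> : m = -1 by lia.
  have -> : n = 0 by lia.
  by rewrite /brLY; field.
have LM m n : -1 <= m -> 0 <= n ->
    (brLM lam (- lam / 2) m n *: << iM (m + n) >> : {malg K[dsv_index]})@_k = 0.
  move=> hm hn; apply: (mcoeffZU _ nk) => + e; rewrite -e orbF /= => lt0.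
  have -> : m = -1 by lia.
  have -> : n = 0 by lia.
  by rewrite /brLM; field.
case=> [m|m|m|] [n|n|n|] /= hm hn; rewrite /dL /dM /dY /dC.
all: try exact: mcoeff0.
- rewrite [LHS]mcoeffD -[RHS]addr0; congr (_ + _).
    apply: (mcoeffZU _ nk) => + e; rewrite -e orbF /= => lt0.
    by have -> : n - m = 0 by lia.
  apply: (mcoeffZU _ nk) => _ _; rewrite /brLLC.
  case: eqP => [e|_]; last by rewrite mul0r.
  have : m = -1 \/ m = 0 \/ m = 1 by lia.
  by case=> [->|[->|->]]; rewrite /= ?mul0r ?mulr0.
- exact: LM.
- exact: LY.
- by rewrite [LHS]mcoeffN LM ?oppr0.
- by rewrite [LHS]mcoeffN LY ?oppr0.
- apply: (mcoeffZU _ nk) => + e; rewrite -e orbF /= => lt0.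
  by have -> : m - n = 0 by lia.
Qed.

Lemma lext_coef0 (f : dsv_index -> {malg K[dsv_index]}) (x : dsv) k :
  (forall i, dsv_plus_index i -> (f i)@_k = 0) -> x \in dsv_plus_pred ->
  (lext f x)@_k = 0.
Proof.
move=> h /allP hx; rewrite /lext big_seq.
elim/big_rec: _ => [|i y /hx hi IH]; first exact: mcoeff0.
by rewrite mcoeffD mcoeffZ h // mulr0 IH addr0.
Qed.

Lemma dsv_lie_coef0 (x y : dsv) k :
  x \in dsv_plus_pred -> y \in dsv_plus_pred ->
  ~~ dsv_plus_index k || (k == iC) -> (lie x y)@_k = 0.
Proof.
move=> hx hy nk; apply: lext_coef0 hx => i hi.
apply: lext_coef0 hy => j hj.
exact: dsv_br_plus.
Qed.

Fact dsv_plus_lie (x y : dsv) : x \in dsv_plus_pred -> y \in dsv_plus_pred ->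
  lie x y \in dsv_plus_pred.
Proof.
move=> hx hy; apply/dsv_plusP => i ni.
by apply: dsv_lie_coef0; rewrite ?ni.
Qed.

Definition dsv_plus : lieSubalg dsv := LieSubalg dsv_plus_submod dsv_plus_lie.

Context (c : K).

(** [C] acts on the one-dimensional module as [c], the rest of the basis of
    [dsv_plus] as zero. *)
Definition vac_act (x : subLieAlg dsv_plus) (z : K^o) : K^o :=
  (subLie_val x)@_iC * c * z.

Fact vac_act_linl z : linear (fun x => vac_act x z).
Proof.
move=> a x y; rewrite /vac_act.
have -> : (subLie_val (a *: x + y : subLieAlg dsv_plus))@_iC
    = a * (subLie_val x)@_iC + (subLie_val y)@_iC.
  by rewrite -mcoeffZ -mcoeffD.
by rewrite !mulrDl /GRing.scale /= !mulrA.
Qed.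
Fact vac_act_linr x : linear (vac_act x).
Proof. by move=> a z z'; rewrite /vac_act mulrDr /GRing.scale /= mulrCA. Qed.
Fact vac_act_lie x y z :
  vac_act (lie x y) z = vac_act x (vac_act y z) - vac_act y (vac_act x z).
Proof.
rewrite /vac_act [X in X * c * z](_ : _ = 0).
  by rewrite !mul0r; apply/esym/eqP; rewrite subr_eq0; apply/eqP; ring.
by apply: dsv_lie_coef0; [exact: subLie_valP | exact: subLie_valP | exact: orbT].
Qed.
Definition vac_module : lieModule (subLieAlg dsv_plus) K^o :=
  LieModule vac_act_linl vac_act_linr vac_act_lie.

(** [V(c) = U(G) (x)_{U(G_+)} K], with its left [U(G)]-action, restricted to
    [G], and [1 (x) 1]. *)
Definition Vc : lmodType K := tensor (@U_incl K dsv dsv_plus) (U_module vac_module).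
Definition Vc_act : lieModule dsv Vc :=
  U_lieModule (tensor_module (@U_incl K dsv dsv_plus) (U_module vac_module)).
Definition Vc_vac : Vc := tpure _ _ 1 1.
End InducedModule.

(** Degrees in [1/2 Z] are rational numbers. *)
Definition dsv_degree (i : dsv_index) : rat :=
  match i with
  | iL m => m%:~R
  | iM m => m%:~R
  | iY m => m%:~R - 1 / 2
  | iC => 0
  end.

Definition dsv_homog (K : numFieldType) (lam mu : K) (r : rat)
    (x : dsv lam mu) : Prop :=
  forall i, x@_i != 0 -> dsv_degree i = r.

Definition restricted (K : numFieldType) (lam mu : K) (W : lmodType K)
    (rho : lieModule (dsv lam mu) W) : Prop :=
  forall v : W, exists n : nat, forall i : nat, (0 < i)%N ->
    forall x, dsv_homog (n%:R + i%:R / 2) x -> rho x v = 0.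

(** A series [a(z)] in [End(W)[[z, z^-1]]]: [a e] is the coefficient of [z^e]. *)
Definition fseries (W : Type) : Type := int -> W -> W.

Section GeneratingFunctions.
Context (K : numFieldType) (lam mu : K) (W : lmodType K).
Context (rho : lieModule (dsv lam mu) W).

(** [L(x) = sum_n L_n x^{-n-2}], [Y~(x) = sum_n Y_{n-1/2} x^{-n-1}],
    [M(x) = sum_n M_n x^{-n-1}]. *)
Definition genL : fseries W := fun e => rho (dL lam mu (- e - 2)).
Definition genY : fseries W := fun e => rho (dY lam mu (- e - 1)).
Definition genM : fseries W := fun e => rho (dM lam mu (- e - 1)).
End GeneratingFunctions.

Section VertexAlgebra.
Context (K : numFieldType).

(** [a_n], where [a(z) = sum_n a_n z^{-n-1}]. *)
Definition mode (W : Type) (a : fseries W) (n : int) : W -> W := a (- n - 1).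

Definition fderiv (W : lmodType K) (a : fseries W) : fseries W :=
  fun e w => (e + 1)%:~R *: a (e + 1) w.

Definition binz (n : int) (k : nat) : K :=
  (\prod_(i < k) (n - i%:Z)%:~R) / k`!%:R.

(** The coefficient of [z^ez x^ex y^ey] in
    [z^{-1} delta((a x + b y) / z) = sum_n z^{-n-1} (a x + b y)^n], where
    [(a x + b y)^n = sum_(k >= 0) binz n k (a x)^{n-k} (b y)^k]. *)
Definition delta_coef (a b : K) (ez ex ey : int) : K :=
  match ey with
  | Posz k => (ez + ex + ey == -1)%:R * (binz (ex + ey) k * a ^ ex * b ^+ k)
  | Negz _ => 0
  end.

Section Module.
Context (V : lmodType K) (Y : V -> fseries V) (vac : V) (D : V -> V).
Context (W : lmodType K) (d : W -> W) (YW : V -> fseries W).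

(** The coefficients of [z0^p z1^q z2^r]; the sums have finitely many nonzero
    terms because of the truncation condition. *)
Definition jacobi_identity : Prop :=
  forall (u v : V) (w : W) (p q r : int),
    \sum_(e \in [set: int * int]%classic)
       delta_coef 1 (-1) p (q - e.1) (r - e.2) *: YW u e.1 (YW v e.2 w)
  - \sum_(e \in [set: int * int]%classic)
       delta_coef (-1) 1 p (r - e.2) (q - e.1) *: YW v e.2 (YW u e.1 w)
  = \sum_(e \in [set: int * int]%classic)
       delta_coef 1 (-1) (r - e.2) q (p - e.1) *: YW (Y u e.1 v) e.2 w.

Record is_va_module : Prop := IsVAModule {
  vam_d_linear : linear d;
  vam_linear_l : forall e w, linear (fun v => YW v e w);
  vam_linear_r : forall v e, linear (YW v e);
  vam_trunc : forall v w, exists N : int, forall n, N <= n -> mode (YW v) n w = 0;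
  vam_comm : forall v e w, d (YW v e w) - YW v e (d w) = YW (D v) e w;
  vam_deriv : forall v e w, YW (D v) e w = fderiv (YW v) e w;
  vam_vac : forall e w, YW vac e w = if e == 0 then w else 0;
  vam_jacobi : jacobi_identity
}.

Definition simple_va_module : Prop :=
  (exists w : W, w != 0) /\
  forall U : {pred W}, submod_closed U ->
    (forall w, w \in U -> d w \in U) ->
    (forall v e w, w \in U -> YW v e w \in U) ->
    U =i pred1 0 \/ U =i predT.
End Module.

Record is_vertex_algebra (V : lmodType K) (Y : V -> fseries V) (vac : V)
    (D : V -> V) : Prop := IsVertexAlgebra {
  va_adjoint : is_va_module Y vac D D Y;
  va_creation : forall v e, e < 0 -> Y v e vac = 0;
  va_creation0 : forall v, Y v 0 vac = v
}.
End VertexAlgebra.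

(* Main.v *)
(** Write every field as its sequence of modes. The fields on [W], i.e. the maps
    from [W] to Laurent series in [W], form a module over the Lie algebra, a
    generator [a_k] acting on [f] by the [k]-th product
    [a_k f = Res_y ((y-x)^k a(y) f(x) - (-x+y)^k f(x) a(y))]. The identity field is
    a vacuum vector for it, so it extends to a homomorphism [psi] from [V(c)], and
    [Y_W(v, x) = psi(v)]. The homomorphism property is the iterate formula for
    [(a, v)]. The commutator formula for [(a, v)] is proved by induction on [v],
    and the two together give the Borcherds identity for [(a, v)], because the
    Borcherds identities satisfy the Pascal recursion in [(l, m, n)]. The vectors
    [u] for which it holds with all [v] are closed under [u -> a_k u], hence are
    all of [V(c)]. Finally [D] is [- L_(-1)], so that [d = - L_(-1)] on [W], and
    simplicity follows since the modes of the generators are vertex operators. *)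

(* On a fixed vector every sum of modes has finite support, so commutator and iterate formulas are
   handled directly as binomial sums over integer exponents. Since $V(c)$ is a quotient of formal
   tensors, maps out of it come from its universal property and statements about its vectors from
   induction on generator modes. The commutator formula is proved for all generators at once:
   passing from $v$ to $b_kv$ produces the field of $[a,b]$, which enters through the full Borcherds
   identity with the same $v$, not only through one slice of it. The condition $\mu=-\lambda/2$
   removes the constant terms from the brackets of modes. Then the nonnegative modes together with
   $C$ span a subalgebra, and $[L_{-1},a_n]=n\,a_{n-1}$ for every generator. This sign, opposite to
   the usual Virasoro convention, is why translation is $-L_{-1}$. *)
From HB Require Import structures.
Require Import Defs.
From mathcomp Require Import all_boot all_order all_algebra.
From mathcomp Require Import boolp classical_sets functions fsbigop.
From mathcomp Require Import monalg reals complex ring zify.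
Set Implicit Arguments.
Unset Strict Implicit.
Unset Printing Implicit Defensive.
Import Order.TTheory GRing.Theory Num.Theory.
Local Open Scope ring_scope.

(** * Binomial sums *)

Section Binomials.
Context (K : numFieldType).
Local Notation binz := (@binz K).

Lemma binz0 n : binz n 0 = 1.
Proof. by rewrite /binz big_ord0 fact0 divr1. Qed.

Lemma binz_fact n k : binz n k * k`!%:R = \prod_(i < k) (n - i%:Z)%:~R.
Proof. by rewrite /binz divfK // pnatr_eq0 -lt0n fact_gt0. Qed.

Lemma fact_neq0 k : k`!%:R != 0 :> K.
Proof. by rewrite pnatr_eq0 -lt0n fact_gt0. Qed.

Lemma prod_binzD n i j : \prod_(h < i + j) (n - h%:Z)%:~R
  = (\prod_(h < i) (n - h%:Z)%:~R) * \prod_(h < j) (n - i%:Z - h%:Z)%:~R :> K.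
Proof.
rewrite big_split_ord /=; congr (_ * _); apply: eq_bigr => h _.
by congr (_%:~R); rewrite PoszD; ring.
Qed.

Lemma binz_recl n k : binz n k.+1 * k.+1%:R = n%:~R * binz (n - 1) k.
Proof.
apply: (mulIf (fact_neq0 k)).
rewrite -mulrA -natrM -factS binz_fact big_ord_recl /= subr0 -mulrA binz_fact.
by congr (_ * _); apply: eq_bigr => i _; congr (_%:~R); rewrite /= /bump; lia.
Qed.

Lemma binz_recr n k : binz n k.+1 * k.+1%:R = (n - k%:Z)%:~R * binz n k.
Proof.
apply: (mulIf (fact_neq0 k)).
rewrite -mulrA -natrM -factS binz_fact big_ord_recr /= -mulrA binz_fact.
by rewrite mulrC.
Qed.

Lemma binz1 n : binz n 1 = n%:~R.
Proof. by have := binz_recl n 0; rewrite binz0 !mulr1. Qed.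

Lemma pascal n k : binz (n + 1) k.+1 = binz n k.+1 + binz n k.
Proof.
have h : k.+1%:R != 0 :> K by rewrite pnatr_eq0.
apply: (mulIf h).
rewrite binz_recl mulrDl binz_recr addrK [binz n k * _]mulrC -mulrDl.
by congr (_ * _); rewrite -[k.+1%:R]/(k.+1%:Z%:~R) -rmorphD /=; congr (_%:~R); lia.
Qed.

Lemma binz_small (n k : nat) : (n < k)%N -> binz n k = 0.
Proof.
move=> lt; apply: (mulIf (fact_neq0 k)); rewrite binz_fact mul0r.
by rewrite (bigD1 (Ordinal lt)) //= subrr mul0r.
Qed.

Lemma binz_diag (n : nat) : binz n n = 1.
Proof.
elim: n => [|n IH]; first exact: binz0.
have -> : n.+1%:Z = n%:Z + 1 by lia.
by rewrite pascal IH binz_small // add0r.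
Qed.

(** Both sides are $n(n-1)\cdots(n-i-j+1)/(i!\,j!)$. *)
Lemma binz_mulB n i j : binz n i * binz (n - i%:Z) j = binz n j * binz (n - j%:Z) i.
Proof.
apply: (mulIf (fact_neq0 i)); apply: (mulIf (fact_neq0 j)).
have e a b : binz n a * binz (n - a%:Z) b * (a`!%:R * b`!%:R)
    = \prod_(h < a + b) (n - h%:Z)%:~R.
  by rewrite mulrACA !binz_fact prod_binzD.
by rewrite -[LHS]mulrA -[RHS]mulrA e [i`!%:R * _]mulrC e addnC.
Qed.

(** Trinomial revision: after clearing factorials both sides are the same falling factorial of
    length $i+j$. It reorganizes double sums over $r\le j$ by the difference $j-r$. *)
Lemma binz_mulD n i j :
  binz n (i + j) * binz (i + j)%N i = binz n i * binz (n - i%:Z) j.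
Proof.
apply: (mulIf (fact_neq0 (i + j))); apply: (mulIf (fact_neq0 i)).
apply: (mulIf (fact_neq0 j)).
have -> : binz n i * binz (n - i%:Z) j * (i + j)`!%:R * i`!%:R * j`!%:R
    = (binz n i * i`!%:R) * (binz (n - i%:Z) j * j`!%:R) * (i + j)`!%:R by ring.
rewrite [in RHS]binz_fact [in RHS]binz_fact -prod_binzD -binz_fact.
have -> : (i + j)`!%:R = binz (i + j)%N i * i`!%:R * j`!%:R :> K; last by ring.
rewrite binz_fact -(bin_fact (leq_addr j i)) addKn mulnA bin_ffact natrM; congr (_ * _).
rewrite ffact_prod natr_prod; apply: eq_bigr => h _.
by rewrite -[(_ - _)%:R]/((_ - _)%N%:Z%:~R); congr (_%:~R); have := ltn_ord h; lia.
Qed.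

(** Upper negation: the negated factors $-(n-i)$, taken in reverse order, are $(k-1-n)-i$. *)
Lemma binz_upper n k : (-1) ^+ k * binz n k = binz (k%:Z - 1 - n) k.
Proof.
apply: (mulIf (fact_neq0 k)); rewrite -mulrA !binz_fact.
rewrite -[k in _ ^+ k]card_ord -prodrN (reindex_inj rev_ord_inj) /=.
by apply: eq_bigr => i _; rewrite -rmorphN /=; congr (_%:~R); have := ltn_ord i; lia.
Qed.
End Binomials.

(** * Sums of finite support and the binomial theorem for integer exponents *)

Section FiniteSums.
Context (K : numFieldType).
Local Notation binz := (@binz K).

Definition fin (W : zmodType) (f : nat -> W) : Prop :=
  exists N, forall i, (N <= i)%N -> f i = 0.

(** The support lies in a square, which is what exchanging two sums needs. *)
Definition fin2 (W : zmodType) (f : nat -> nat -> W) : Prop :=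
  exists N, forall i j, (N <= i)%N || (N <= j)%N -> f i j = 0.

(** Junk value: [isum f] is [0] when [f] has infinite support. *)
Definition isum (W : zmodType) (f : nat -> W) : W := \sum_(i \in [set: nat]) f i.

Section Sums.
Context (W : zmodType).
Implicit Types (f g : nat -> W) (F G : nat -> nat -> W).

Lemma isumE N f : (forall i, (N <= i)%N -> f i = 0) ->
  isum f = \sum_(i < N) f i.
Proof.
move=> h; rewrite /isum (fsbigE (iota 0 N)) ?iota_uniq //; last first.
  by move=> i _; rewrite mem_iota /= add0n -leqNgt; apply: h.
by rewrite big_mkcond /= -{1}(subn0 N) big_mkord; apply: eq_bigr => i _; rewrite in_setT.
Qed.

Lemma eq_isum f g : f =1 g -> isum f = isum g.
Proof. by move=> /funext ->. Qed.

Lemma isum0 f : (forall i, f i = 0) -> isum f = 0.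
Proof. by move=> h; rewrite (@isumE 0) // big_ord0. Qed.

Lemma finW f g : (forall i, f i = 0 -> g i = 0) -> fin f -> fin g.
Proof. by move=> h [N hN]; exists N => i /hN /h. Qed.

Lemma finD f g : fin f -> fin g -> fin (fun i => f i + g i).
Proof.
move=> [N hN] [M hM]; exists (maxn N M) => i.
by rewrite geq_max => /andP[/hN -> /hM ->]; rewrite addr0.
Qed.

Lemma finS f : fin f -> fin (fun i => f i.+1).
Proof. by move=> [N hN]; exists N => i hi; apply: hN; apply: ltnW. Qed.

Lemma isumD f g : fin f -> fin g -> isum (fun i => f i + g i) = isum f + isum g.
Proof.
move=> [N hN] [M hM]; rewrite !(@isumE (maxn N M)) -?big_split //.
all: by move=> i; rewrite geq_max => /andP[h1 h2]; rewrite ?hN ?hM ?addr0.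
Qed.

Lemma isum_recl f : fin f -> isum f = f 0%N + isum (fun i => f i.+1).
Proof.
move=> [N hN]; rewrite (@isumE N.+1) ?(@isumE N (fun i => f i.+1)).
- by rewrite big_ord_recl.
- by move=> i hi; apply/hN/ltnW.
- by move=> i hi; apply/hN/ltnW.
Qed.

Lemma isum1 k f : (forall i, i != k -> f i = 0) -> isum f = f k.
Proof.
move=> h; rewrite (@isumE k.+1) => [|i hi]; last by apply: h; lia.
rewrite big_ord_recr /= big1 ?add0r // => i _; apply: h.
by have := ltn_ord i; lia.
Qed.

Lemma fin2_row F i : @fin2 W F -> fin (F i).
Proof. by move=> [N h]; exists N => j hj; apply: h; rewrite hj orbT. Qed.

Lemma fin2_col F j : @fin2 W F -> fin (fun i => F i j).
Proof. by move=> [N h]; exists N => i hi; apply: h; rewrite hi. Qed.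

Lemma fin2_isum F : @fin2 W F -> fin (fun i => isum (F i)).
Proof.
by move=> [N h]; exists N => i hi; apply: isum0 => j; apply: h; rewrite hi.
Qed.

Lemma fin2C F : @fin2 W F -> fin2 (fun i j => F j i).
Proof. by move=> [N h]; exists N => i j hij; apply: h; rewrite orbC. Qed.

Lemma fin2W F G : (forall i j, F i j = 0 -> G i j = 0) ->
  @fin2 W F -> @fin2 W G.
Proof. by move=> h [N hN]; exists N => i j /hN /h. Qed.

Lemma isum_exch F : @fin2 W F ->
  isum (fun i => isum (F i)) = isum (fun j => isum (fun i => F i j)).
Proof.
move=> [N h].
rewrite (@isumE N) => [|i hi]; last by apply: isum0 => j; apply: h; rewrite hi.
rewrite [RHS](@isumE N) => [|j hj]; last by apply: isum0 => i; apply: h; rewrite hj orbT.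
rewrite (eq_bigr (fun i : 'I_N => \sum_(j < N) F i j)); last first.
  by move=> i _; apply: isumE => j hj; apply: h; rewrite hj orbT.
rewrite exchange_big; apply: eq_bigr => j _; apply/esym/isumE => i hi.
by apply: h; rewrite hi.
Qed.

(** The bound on $j$ may depend on the row, as happens for modes applied to varying vectors; only
    finitely many rows matter, so a maximum works. *)
Lemma fin2_intro F : (exists N, forall i, (N <= i)%N -> forall j, F i j = 0) ->
  (forall i, fin (F i)) -> @fin2 W F.
Proof.
move=> [N hN] /choice[M hM]; exists (maxn N (\max_(i < N) M i)) => i j.
case: (leqP N i) => [le _|lt]; first exact: hN.
rewrite !geq_max [(N <= i)%N]leqNgt lt /= => /andP[_ hj]; apply: hM.
by apply: leq_trans hj; apply: (leq_bigmax (Ordinal lt)).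
Qed.
End Sums.

Lemma isum_lin (V W : zmodType) (L : V -> W) (f : nat -> V) :
  (forall x y, L (x + y) = L x + L y) -> fin f ->
  L (isum f) = isum (fun i => L (f i)).
Proof.
move=> LD [N hN]; have L0 : L 0 = 0 by apply: (addrI (L 0)); rewrite -LD !addr0.
rewrite !(@isumE _ N) //; first by rewrite (big_morph L LD L0).
by move=> i hi; rewrite hN.
Qed.

Section ScaledSums.
Context (W : lmodType K).
Implicit Types (X : nat -> W).

Lemma isumZ a (f : nat -> W) : fin f -> isum (fun i => a *: f i) = a *: isum f.
Proof. by move=> hf; rewrite (isum_lin (L := fun x => a *: x)) //; exact: scalerDr. Qed.

(** With $S$ the shift of sequences this is the value at $0$ of $(1+S)^kX$; $S$ is nilpotent on a
    sequence of finite support, so negative $k$ makes sense. *)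
Definition bsum (k : int) X : W := isum (fun i => binz k i *: X i).

Lemma finZ (a : nat -> K) X : fin X -> fin (fun i => a i *: X i).
Proof. by apply: finW => i ->; rewrite scaler0. Qed.

Lemma bsum_pascal k X : fin X -> bsum (k + 1) X = bsum k X + bsum k (fun i => X i.+1).
Proof.
move=> fX; rewrite /bsum isum_recl ?[isum (fun i => binz k i *: X i)]isum_recl; try exact: finZ.
rewrite !binz0 -addrA -isumD; try by [apply: (finS (finZ _ fX)) | apply/finZ/finS].
by congr (_ + _); apply: eq_isum => i; rewrite pascal scalerDl.
Qed.

Lemma bsum0 X : bsum 0 X = X 0%N.
Proof.
rewrite /bsum (@isum1 _ 0) ?binz0 ?scale1r // => i hi.
by rewrite (@binz_small K 0) ?scale0r //; lia.
Qed.

(** Induction on [k] in both directions: the step down from [k + 1] to [k] is by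
    a second induction on the size of the support, which the shift decreases. *)
Lemma bsum_ind (P : int -> (nat -> W) -> Prop) :
  (forall X, fin X -> P 0 X) ->
  (forall k X, fin X -> P k X -> P k (fun i => X i.+1) -> P (k + 1) X) ->
  (forall k, P k (fun=> 0)) ->
  (forall k X, fin X -> P (k + 1) X -> P k (fun i => X i.+1) -> P k X) ->
  forall k X, fin X -> P k X.
Proof.
move=> P0 Pup Pz Pdown.
have dn k : (forall X, fin X -> P (k + 1) X) -> forall X, fin X -> P k X.
  move=> IH X [N]; elim: N X => [|N IHN] X hN.
    by have -> : X = fun=> 0 by apply/funext => i; apply: hN.
  apply: Pdown; [by exists N.+1 | by apply: IH; exists N.+1 |].
  by apply: IHN => i hi; apply: hN.
elim/int_rect => // k IH X fX.
  by rewrite -addn1 PoszD; apply: Pup => //; apply: IH => //; apply: finS.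
apply: (dn _ _ X fX) => X1 fX1; have -> : - k.+1%:Z + 1 = - k%:Z by lia.
exact: IH.
Qed.

(** Vandermonde convolution in the form $(1+S)^k(1+S)^{k'}=(1+S)^{k+k'}$: both sides obey the same
    Pascal rule in $k$. *)
Lemma bsum_conv k k' X : fin X ->
  bsum k (fun i => bsum k' (fun j => X (i + j)%N)) = bsum (k + k') X.
Proof.
have fin_sh Y i : fin Y -> fin (fun j => Y (i + j)%N).
  by move=> [N hN]; exists N => j hj; apply: hN; lia.
have fin_b Y : fin Y -> fin (fun i => bsum k' (fun j => Y (i + j)%N)).
  move=> [N hN]; exists N => i hi; apply: isum0 => j.
  by rewrite hN ?scaler0 //; lia.
move=> fX; move: k X fX.
apply: (@bsum_ind (fun k X =>
  bsum k (fun i => bsum k' (fun j => X (i + j)%N)) = bsum (k + k') X)) => [X fX|k X fX IH1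
    IH2|k|k X fX IH1 IH2].
- by rewrite bsum0 add0r.
- rewrite bsum_pascal; last exact: fin_b.
  have -> : k + 1 + k' = k + k' + 1 by ring.
  by rewrite bsum_pascal // -IH1 -IH2.
- have z k2 : bsum k2 (fun=> 0) = 0 by apply: isum0 => j; rewrite scaler0.
  by rewrite [RHS]z; apply: isum0 => j; rewrite [bsum _ _]z scaler0.
(* Downward step: the identity at $k+1$ is the sum of the identities at $k$ for the sequence and for
   its shift, and the latter cancels. *)
- move: IH1; rewrite bsum_pascal; last exact: fin_b.
  have -> : k + 1 + k' = k + k' + 1 by ring.
  by rewrite bsum_pascal // -IH2 => /addIr.
Qed.
End ScaledSums.
End FiniteSums.

(** * Double binomial sums and alternating signs *)

Section BinomialSums.
Context (K : numFieldType).
Local Notation binz := (@binz K).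
Implicit Types V W : lmodType K.

Lemma eq_bsum W k (X Y : nat -> W) : X =1 Y -> bsum k X = bsum k Y.
Proof. by move=> /funext ->. Qed.

Lemma bsum_eq0 W k (X : nat -> W) : (forall i, X i = 0) -> bsum k X = 0.
Proof. by move=> h; apply: isum0 => i; rewrite h scaler0. Qed.

Lemma bsumD W k (X Y : nat -> W) : fin X -> fin Y ->
  bsum k (fun i => X i + Y i) = bsum k X + bsum k Y.
Proof.
move=> fX fY; rewrite /bsum -isumD; try exact: finZ.
by apply: eq_isum => i; rewrite scalerDr.
Qed.

Lemma bsum_lin V W (L : V -> W) k (X : nat -> V) : linear L -> fin X ->
  L (bsum k X) = bsum k (fun i => L (X i)).
Proof.
move=> lL fX; have LD x y : L (x + y) = L x + L y.
  by have := lL 1 x y; rewrite !scale1r.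
have L0 : L 0 = 0 by apply: (addrI (L 0)); rewrite -LD !addr0.
rewrite /bsum (isum_lin LD); last exact: finZ.
by apply: eq_isum => i; have := lL (binz k i) (X i) 0; rewrite L0 !addr0.
Qed.

Lemma bsumZ W k a (X : nat -> W) : fin X ->
  bsum k (fun i => a *: X i) = a *: bsum k X.
Proof.
move=> fX; rewrite (bsum_lin (L := fun x => a *: x)) // => b x y.
by rewrite scalerDr !scalerA mulrC.
Qed.

Lemma bsumN W k (X : nat -> W) : fin X -> bsum k (fun i => - X i) = - bsum k X.
Proof.
by move=> fX; rewrite -scaleN1r -bsumZ //; apply: eq_bsum => i; rewrite scaleN1r.
Qed.

Lemma bsumB W k (X Y : nat -> W) : fin X -> fin Y ->
  bsum k (fun i => X i - Y i) = bsum k X - bsum k Y.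
Proof.
move=> fX fY; rewrite bsumD ?bsumN //.
by apply: finW fY => i ->; rewrite oppr0.
Qed.

Lemma fin2Z W (a : nat -> nat -> K) (F : nat -> nat -> W) :
  fin2 F -> fin2 (fun i j => a i j *: F i j).
Proof. by apply: fin2W => i j ->; rewrite scaler0. Qed.

Lemma fin2_bsum W (k : nat -> int) (F : nat -> nat -> W) : fin2 F ->
  fin (fun i => bsum (k i) (F i)).
Proof.
by move=> h; apply: (@fin2_isum _ (fun i j => binz (k i) j *: F i j)); apply: fin2Z.
Qed.

Lemma isum_exchZ W (a : nat -> K) (b : nat -> nat -> K) (F : nat -> nat -> W) :
  fin2 F ->
  isum (fun i => a i *: isum (fun j => b i j *: F i j))
  = isum (fun j => isum (fun i => (a i * b i j) *: F i j)).
Proof.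
move=> hF; rewrite -isum_exch; last exact: fin2Z.
apply: eq_isum => i; rewrite -isumZ; first by apply: eq_isum => j; rewrite scalerA.
by apply: finZ; apply: fin2_row.
Qed.

Lemma bsum_exch W k l (F : nat -> nat -> W) : fin2 F ->
  bsum k (fun i => bsum l (F i)) = bsum l (fun j => bsum k (fun i => F i j)).
Proof.
move=> hF; rewrite /bsum isum_exchZ // [RHS]isum_exchZ; last exact: fin2C.
rewrite isum_exch; last exact: fin2Z (fin2C hF).
by apply: eq_isum => i; apply: eq_isum => j; rewrite mulrC.
Qed.

(** With one shift in each index, both sides are $(1+S_1+S_2)^k$. *)
Lemma bsum_revise_down W k (F : nat -> nat -> W) : fin2 F ->
  bsum k (fun i => bsum (k - i%:Z) (F i))
  = bsum k (fun j => bsum (k - j%:Z) (fun i => F i j)).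
Proof.
move=> hF; rewrite /bsum isum_exchZ // [RHS]isum_exchZ; last exact: fin2C.
rewrite isum_exch; last exact: fin2Z (fin2C hF).
by apply: eq_isum => i; apply: eq_isum => j; rewrite binz_mulB.
Qed.

Lemma isum_shift W r (X : nat -> W) : (forall i, (i < r)%N -> X i = 0) -> fin X ->
  isum X = isum (fun i => X (r + i)%N).
Proof.
elim: r X => [//|r IH] X h fX.
rewrite isum_recl // h // add0r IH //; last exact: finS.
by move=> i hi; apply: h.
Qed.

(** This is $(1+S_2(1+S_1))^k=(1+S_2+S_1S_2)^k$; on the right $r$ counts the factors $S_1S_2$ and
    $h$ the factors $S_2$. *)
Lemma bsum_revise_up W k (F : nat -> nat -> W) : fin2 F ->
  bsum k (fun j => bsum j (fun r => F r j))
  = bsum k (fun r => bsum (k - r%:Z) (fun h => F r (r + h)%N)).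
Proof.
move=> hF.
have hF' : fin2 (fun r h => F r (r + h)%N).
  by have [N hN] := hF; exists N => i j hij; apply: hN; lia.
rewrite /bsum isum_exchZ; last exact: fin2C.
apply: eq_isum => r; rewrite (@isum_shift _ r).
- rewrite -isumZ; last by apply: finZ; apply: fin2_row hF' .
  by apply: eq_isum => h; rewrite binz_mulD scalerA.
- by move=> i hi; rewrite (binz_small _ hi) mulr0 scale0r.
- by apply: finZ; apply: fin2_row hF.
Qed.

(** $(1-S)^k$: the form in which the expansion of $(x-y)^k$ in $|x|>|y|$ acts on modes. *)
Definition sbsum W k (X : nat -> W) : W := bsum k (fun i => (-1) ^+ i *: X i).

Lemma finN1 W (X : nat -> W) : fin X -> fin (fun i => (-1) ^+ i *: X i : W).
Proof. exact: finZ. Qed.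

Lemma eq_sbsum W k (X Y : nat -> W) : X =1 Y -> sbsum k X = sbsum k Y.
Proof. by move=> /funext ->. Qed.

Lemma sbsumD W k (X Y : nat -> W) : fin X -> fin Y ->
  sbsum k (fun i => X i + Y i) = sbsum k X + sbsum k Y.
Proof.
move=> fX fY; rewrite /sbsum -bsumD; try exact: finN1.
by apply: eq_bsum => i; rewrite scalerDr.
Qed.

Lemma sbsum_lin V W (L : V -> W) k (X : nat -> V) : linear L -> fin X ->
  L (sbsum k X) = sbsum k (fun i => L (X i)).
Proof.
move=> lL fX; rewrite /sbsum (bsum_lin _ lL); last exact: finN1.
apply: eq_bsum => i; have := lL ((-1) ^+ i) (X i) 0.
have /eqP := lL (-1) 0 0; rewrite scaler0 scaleN1r addr0 addNr => /eqP -> .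
by rewrite !addr0.
Qed.

Lemma sbsumZ W k a (X : nat -> W) : fin X ->
  sbsum k (fun i => a *: X i) = a *: sbsum k X.
Proof.
move=> fX; rewrite (sbsum_lin (L := fun x => a *: x)) // => b x y.
by rewrite scalerDr !scalerA mulrC.
Qed.

Lemma sbsumB W k (X Y : nat -> W) : fin X -> fin Y ->
  sbsum k (fun i => X i - Y i) = sbsum k X - sbsum k Y.
Proof.
move=> fX fY; rewrite /sbsum -bsumB; try exact: finN1.
by apply: eq_bsum => i; rewrite scalerBr.
Qed.

Lemma fin2_sbsum W (k : nat -> int) (F : nat -> nat -> W) : fin2 F ->
  fin (fun i => sbsum (k i) (F i)).
Proof. by move=> h; apply: fin2_bsum; apply: fin2Z. Qed.

Lemma sbsum_exch W k l (F : nat -> nat -> W) : fin2 F ->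
  sbsum k (fun i => sbsum l (F i)) = sbsum l (fun j => sbsum k (fun i => F i j)).
Proof.
move=> hF; rewrite /sbsum.
transitivity (bsum k (fun i => bsum l (fun j => ((-1) ^+ i * (-1) ^+ j) *: F i j))).
  apply: eq_bsum => i; rewrite -bsumZ; last by apply: finZ; apply: fin2_row hF.
  by apply: eq_bsum => j; rewrite scalerA.
rewrite bsum_exch; last exact: fin2Z.
apply: eq_bsum => j; rewrite -bsumZ; last by apply: finZ; apply: fin2_col hF.
by apply: eq_bsum => i; rewrite scalerA mulrC.
Qed.

Lemma sbsum_bsum_exch W k l (F : nat -> nat -> W) : fin2 F ->
  sbsum k (fun i => bsum l (F i)) = bsum l (fun j => sbsum k (fun i => F i j)).
Proof.
move=> hF; rewrite /sbsum -bsum_exch; last exact: fin2Z.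
by apply: eq_bsum => i; rewrite bsumZ //; apply: fin2_row hF.
Qed.

Lemma sbsum_conv W k k' (X : nat -> W) : fin X ->
  sbsum k (fun i => sbsum k' (fun j => X (i + j)%N)) = sbsum (k + k') X.
Proof.
move=> [N hN]; rewrite /sbsum -bsum_conv; last by apply: finZ; exists N.
apply: eq_bsum => i; rewrite -bsumZ; last first.
  by exists N => j hj; rewrite hN ?scaler0 //; lia.
by apply: eq_bsum => j; rewrite scalerA exprD.
Qed.

Lemma sbsum_revise_up W k (F : nat -> nat -> W) : fin2 F ->
  sbsum k (fun j => bsum j (fun r => F r j))
  = sbsum k (fun r => sbsum (k - r%:Z) (fun h => F r (r + h)%N)).
Proof.
move=> hF; transitivity (bsum k (fun j => bsum j (fun r => (-1) ^+ j *: F r j))).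
  by apply: eq_bsum => j; rewrite bsumZ //; apply: fin2_col hF.
rewrite (@bsum_revise_up _ _ (fun r j => (-1) ^+ j *: F r j)); last exact: fin2Z.
apply: eq_bsum => r; rewrite -bsumZ; last first.
  by have [N hN] := hF; exists N => j hj; rewrite hN ?scaler0 //; lia.
by apply: eq_bsum => j; rewrite scalerA exprD.
Qed.

Lemma sbsum_revise_down W k (F : nat -> nat -> W) : fin2 F ->
  sbsum k (fun j => bsum (k - j%:Z) (F j))
  = bsum k (fun r => sbsum (k - r%:Z) (fun j => F j r)).
Proof.
move=> hF; rewrite /sbsum -(@bsum_revise_down _ _ (fun j r => (-1) ^+ j *: F j r)).
  by apply: eq_bsum => j; rewrite bsumZ //; apply: fin2_row hF.
exact: fin2Z.
Qed.

Lemma sbsum_pascal W k (X : nat -> W) : fin X ->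
  sbsum (k + 1) X = sbsum k X - sbsum k (fun i => X i.+1).
Proof.
move=> fX; rewrite /sbsum bsum_pascal; last exact: finN1.
rewrite -bsumN; last exact/finN1/finS.
by congr (_ + _); apply: eq_bsum => i; rewrite exprS mulN1r scaleNr.
Qed.

Lemma sbsum0 W (X : nat -> W) : sbsum 0 X = X 0%N.
Proof. by rewrite /sbsum bsum0 expr0 scale1r. Qed.
End BinomialSums.

(** * The Borcherds identity *)

Section Fields.
Context (K : numFieldType).
Local Notation binz := (@binz K).
Implicit Types V W : lmodType K.

Lemma linear_fun0 V W (L : V -> W) : linear L -> L 0 = 0.
Proof. by move=> /(_ (-1) 0 0); rewrite scaler0 scaleN1r addr0 addNr. Qed.
Lemma linear_funD V W (L : V -> W) : linear L -> forall x y, L (x + y) = L x + L y.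
Proof. by move=> lL x y; have := lL 1 x y; rewrite !scale1r. Qed.
Lemma linear_funZ V W (L : V -> W) : linear L -> forall a x, L (a *: x) = a *: L x.
Proof. by move=> lL a x; have := lL a x 0; rewrite (linear_fun0 lL) !addr0. Qed.
Lemma linear_funB V W (L : V -> W) : linear L -> forall x y, L (x - y) = L x - L y.
Proof.
by move=> lL x y; rewrite linear_funD // -scaleN1r linear_funZ // scaleN1r.
Qed.

Lemma signzB k (j : nat) : (-1) ^ (k - j%:Z) = (-1) ^ k * (-1) ^+ j :> K.
Proof. by rewrite exprzDr ?unitrN1 // -exprnN invr_sign. Qed.

(** A field [A(x) = sum_n A_n x^(-n-1)] is represented by its modes [A_n]. *)
Definition vfield W (A : int -> W -> W) : Prop :=
  (forall n, linear (A n)) /\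
  (forall w, exists N : int, forall n, N <= n -> A n w = 0).

Lemma vfield_lin W (A : int -> W -> W) n : vfield A -> linear (A n).
Proof. by case. Qed.

Lemma vfield0 W (A : int -> W -> W) n : vfield A -> A n 0 = 0.
Proof. by move=> fA; apply/linear_fun0/vfield_lin. Qed.

Lemma vfield_large W (A : int -> W -> W) w n : vfield A ->
  exists N : nat, forall i : nat, (N <= i)%N -> A (n + i%:Z) w = 0.
Proof.
move=> [_ /(_ w)[N hN]]; exists `|N - n|%N => i hi; apply: hN; lia.
Qed.

Lemma vfield_fin W (A : int -> W -> W) w (f : nat -> int) n : vfield A ->
  (forall i, f i = n + i%:Z) -> fin (fun i => A (f i) w).
Proof.
by move=> fA e; have [N h] := vfield_large w n fA; exists N => i /h; rewrite e.
Qed.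

(** [brak A B l m n] is the left-hand side of the Borcherds identity: the
    coefficient of [A(x) B(y)] expanded in [|x| > |y|] against [x^m y^n (x-y)^l],
    minus that of [B(y) A(x)] expanded in [|y| > |x|]. *)
Definition prodm W (A B : int -> W -> W) (l m n : int) (w : W) : W :=
  sbsum l (fun i => A (l + m - i%:Z) (B (n + i%:Z) w)).

Lemma prodm0 W (A B : int -> W -> W) m n w : prodm A B 0 m n w = A m (B n w).
Proof. by rewrite /prodm sbsum0; congr (A _ (B _ _)); lia. Qed.

Definition brak W (A B : int -> W -> W) (l m n : int) (w : W) : W :=
  prodm A B l m n w - (-1) ^ l *: prodm B A l n m w.

Section Product.
Context (W : lmodType K) (A B : int -> W -> W) (fA : vfield A) (fB : vfield B).

Lemma prodm_fin (f : nat -> int) n w : fin (fun i => A (f i) (B (n + i%:Z) w)).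
Proof.
by have [N h] := vfield_large w n fB; exists N => i /h ->; apply: vfield0.
Qed.

Lemma prodm_linear l m n : linear (prodm A B l m n).
Proof.
move=> c x y; rewrite /prodm -sbsumZ; last exact: prodm_fin.
rewrite -sbsumD; [|exact/finZ/prodm_fin |exact: prodm_fin].
apply: eq_sbsum => i.
by rewrite (vfield_lin (n + i%:Z) fB) (vfield_lin (l + m - i%:Z) fA).
Qed.

Lemma prodm_pascal l m n w :
  prodm A B (l + 1) m n w = prodm A B l (m + 1) n w - prodm A B l m (n + 1) w.
Proof.
rewrite /prodm sbsum_pascal; last exact: (prodm_fin (fun i => _ - i%:Z)).
congr (_ - _); apply: eq_sbsum => i.
  by congr (A _ _); ring.
by congr (A _ (B _ _)); lia.
Qed.
End Product.

(** The weight is multiplied by $x-y$. In the reversed product $x$ and $y$ exchange roles, and the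
    change of sign is absorbed by $(-1)^l$. *)
Lemma brak_pascal W (A B : int -> W -> W) (fA : vfield A) (fB : vfield B) l m n w :
  brak A B (l + 1) m n w = brak A B l (m + 1) n w - brak A B l m (n + 1) w.
Proof.
rewrite /brak !prodm_pascal // exprzDr ?unitrN1 // expr1z mulrN1 scaleNr opprK.
by rewrite scalerBr opprB addrACA [RHS]addrACA [- _ - _ in RHS]addrC.
Qed.

(** The next two lemmas expand both orderings of [c = a_k u] with [v], moving
    every mode of [a] to the far left or the far right; the modes of [a] that
    cross [v] produce the terms in [V_r = a_r v]. *)
Section NormalProduct.
Context (W : lmodType K) (a u v c : int -> W -> W) (V : nat -> int -> W -> W).
Context (fa : vfield a) (fu : vfield u) (fv : vfield v) (fV : forall r, vfield (V r)).
Context (V0 : exists R, forall r, (R <= r)%N -> forall n w, V r n w = 0).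
Context (av : forall s q w,
  a s (v q w) = v q (a s w) + bsum s (fun r => V r (s + q - r%:Z) w)).
Context (k : int).
Context (cE : forall p w, c p w =
  sbsum k (fun j => a (k - j%:Z) (u (p + j%:Z) w))
  - (-1) ^ k *: sbsum k (fun j => u (k + p - j%:Z) (a j%:Z w))).

Lemma prodm_normall l m n w : prodm c v l m n w =
  sbsum k (fun g => a (k - g%:Z) (prodm u v l (m + g%:Z) n w))
  - (-1) ^ k *: sbsum k (fun g => prodm u v l (m + k - g%:Z) n (a g%:Z w))
  - (-1) ^ k *: sbsum k (fun r => prodm u (V r) (l + k - r%:Z) m n w).
Proof.
have a0 s : a s 0 = 0 by apply: vfield0.
have u0 s : u s 0 = 0 by apply: vfield0.
have v0 s : v s 0 = 0 by apply: vfield0.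
have [N1 hv] := vfield_large w n fv.
(* [F1] is $a\,u\,v$, already in final order; moving $a$ past $v$ in $u\,a\,v$ gives $u\,v\,a$,
   which is [F2], and the commutator terms $u\,V_r$, which are [F3]. *)
pose F1 i j := a (k - j%:Z) (u (l + m - i%:Z + j%:Z) (v (n + i%:Z) w)).
pose F2 i j := u (k + (l + m - i%:Z) - j%:Z) (v (n + i%:Z) (a j%:Z w)).
pose F3 i j r := u (k + (l + m - i%:Z) - j%:Z) (V r (j%:Z + (n + i%:Z) - r%:Z) w).
have fin1 : fin2 F1.
  apply: fin2_intro; first by exists N1 => i hi j; rewrite /F1 hv // u0 a0.
  by move=> i; have [N hN] := vfield_large (v (n + i%:Z) w) (l + m - i%:Z) fu;
    exists N => j hj; rewrite /F1 hN // a0.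
have fin_2 : fin2 F2.
  apply: fin2C; apply: fin2_intro => [|j].
    have [N hN] := vfield_large w 0 fa; exists N => j hj i.
    by move: (hN j hj); rewrite add0r /F2 => ->; rewrite v0 u0.
  by have [N hN] := vfield_large (a j%:Z w) n fv; exists N => i hi; rewrite /F2 hN // u0.
have fin3i i : fin2 (fun r j => F3 i j r).
  have [R hR] := V0; apply: fin2_intro; first by exists R => r hr j; rewrite /F3 hR.
  move=> r; have [N hN] := vfield_large w (n + i%:Z - r%:Z) (fV r); exists N => j hj.
  by rewrite /F3 -(u0 (k + (l + m - i%:Z) - j%:Z)); congr (u _ _); rewrite -(hN j) //;
    congr (V _ _ _); ring.
have fin3 : fin2 (fun i j => bsum j (F3 i j)).
  have [R hR] := V0.
  (* Only the finitely many $r<R$ count, so one truncation bound serves them all; the index of $V_r$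
     in [F3] depends on $i+j$ only, which gives a square. *)
  have [N hN] : exists N, forall r, (r < R)%N -> forall t, (N <= t)%N -> V r (n - r%:Z +
    t%:Z) w = 0.
    have /choice[M hM] : forall r, exists N, forall i
      : nat, (N <= i)%N -> V r (n - r%:Z + i%:Z) w = 0.
      by move=> r; apply: vfield_large.
    exists (\max_(r < R) M r) => r hr t ht; apply: hM; apply: leq_trans ht.
    exact: (leq_bigmax (Ordinal hr)).
  exists N => i j hij; apply: bsum_eq0 => r; rewrite /F3.
  case: (leqP R r) => hr; first by rewrite hR.
  rewrite -(u0 (k + (l + m - i%:Z) - j%:Z)); congr (u _ _).
  by rewrite -(hN r hr (i + j)%N); [congr (V _ _ _); lia | lia].
have e i : c (l + m - i%:Z) (v (n + i%:Z) w) =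
    sbsum k (F1 i) - (-1) ^ k *: (sbsum k (F2 i) + sbsum k (fun j => bsum j (F3 i j))).
  rewrite cE; congr (_ - _ *: _); rewrite -sbsumD; [|exact: fin2_row|exact: fin2_row fin3].
  apply: eq_sbsum => j; rewrite av (linear_funD (vfield_lin _ fu)).
  congr (_ + _); rewrite (bsum_lin _ (vfield_lin _ fu)) //.
  have [R hR] := V0; exists R => r hr; exact: hR.
rewrite /prodm (eq_sbsum _ e) sbsumB; last 2 first.
- exact: (fin2_sbsum (fun=> k) fin1).
- by apply: finZ; apply: finD; apply: (fin2_sbsum (fun=> k)).
rewrite sbsumZ; last by apply: finD; apply: (fin2_sbsum (fun=> k)).
rewrite sbsumD; [|exact: (fin2_sbsum (fun=> k) fin_2)|exact: (fin2_sbsum (fun=> k) fin3)].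
rewrite scalerDr opprD addrA; congr (_ - _ *: _ - _ *: _).
- rewrite sbsum_exch //; apply: eq_sbsum => g.
  rewrite (sbsum_lin _ (vfield_lin _ fa)); last first.
    by apply: (prodm_fin fu fv (fun i => _ - i%:Z)).
  by apply: eq_sbsum => i; congr (a _ (u _ _)); ring.
- rewrite sbsum_exch //; apply: eq_sbsum => g.
  by apply: eq_sbsum => i; congr (u _ _); ring.
pose Y r t := u (l + k - r%:Z + m - t%:Z) (V r (n + t%:Z) w).
have finY r : fin (Y r) by apply: (prodm_fin fu (fV r) (fun t => _ - t%:Z)).
have finYR : fin2 Y.
  by have [R hR] := V0; apply: fin2_intro => //; exists R => r hr t; rewrite /Y hR.
(* After revision the summand depends on $i+h$ alone, so the powers $l$ and $k-r$ multiply to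
   $l+k-r$. *)
transitivity (sbsum l (fun i =>
    sbsum k (fun r => sbsum (k - r%:Z) (fun h => Y r (i + h)%N)))).
  apply: eq_sbsum => i; rewrite (sbsum_revise_up _ (fin3i i)); apply: eq_sbsum => r.
  by apply: eq_sbsum => h; rewrite /F3 /Y; congr (u _ (V _ _ _)); lia.
rewrite sbsum_exch; last first.
  have [N hN] := finYR; exists N => i r hir; apply: bsum_eq0 => h.
  by rewrite hN ?scaler0 //; lia.
apply: eq_sbsum => r; rewrite sbsum_conv //.
by have -> : l + (k - r%:Z) = l + k - r%:Z by ring.
Qed.

Lemma prodm_normalr l m n w : prodm v c l n m w =
  sbsum k (fun g => a (k - g%:Z) (prodm v u l n (m + g%:Z) w))
  - (-1) ^ k *: sbsum k (fun g => prodm v u l n (m + k - g%:Z) (a g%:Z w))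
  - bsum k (fun r => prodm (V r) u (l + k - r%:Z) n m w).
Proof.
have a0 s : a s 0 = 0 by apply: vfield0.
have u0 s : u s 0 = 0 by apply: vfield0.
have v0 s : v s 0 = 0 by apply: vfield0.
have V00 r s : V r s 0 = 0 by apply: vfield0.
have [N1 hu] := vfield_large w m fu.
pose F1 i j := a (k - j%:Z) (v (l + n - i%:Z) (u (m + i%:Z + j%:Z) w)).
pose F2 i j := v (l + n - i%:Z) (u (k + (m + i%:Z) - j%:Z) (a j%:Z w)).
(* Here the mode of $a$ that crosses $v$ has index $k-j$, so the binomial is $\binom{k-j}{r}$ and
   the revision goes downward. This is why the last sum of the conclusion is a [bsum] and has no
   sign in front. *)
pose F3 i j r := V r (k - j%:Z + (l + n - i%:Z) - r%:Z) (u (m + i%:Z + j%:Z) w).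
have uij i j : (N1 <= i)%N || (N1 <= j)%N -> u (m + i%:Z + j%:Z) w = 0.
  by move=> hij; rewrite -(hu (i + j)%N); [congr (u _ _); lia | lia].
have fin1 : fin2 F1 by exists N1 => i j hij; rewrite /F1 uij // v0 a0.
have fin_2 : fin2 F2.
  apply: fin2C; apply: fin2_intro => [|j].
    have [N hN] := vfield_large w 0 fa; exists N => j hj i.
    by move: (hN j hj); rewrite add0r /F2 => ->; rewrite u0 v0.
  have [N hN] := vfield_large (a j%:Z w) (k + m - j%:Z) fu; exists N => i hi.
  by rewrite /F2 -(v0 (l + n - i%:Z)) -(hN i hi); congr (v _ (u _ _)); ring.
have [R hR] := V0.
have fin3i i : fin2 (F3 i).
  apply: fin2_intro; first by exists N1 => j hj r; rewrite /F3 uij ?hj ?orbT.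
  by move=> j; exists R => r hr; apply: hR.
have fin3 : fin2 (fun i j => bsum (k - j%:Z) (F3 i j)).
  by exists N1 => i j hij; apply: bsum_eq0 => r; rewrite /F3 uij.
have e i : v (l + n - i%:Z) (c (m + i%:Z) w) = sbsum k (F1 i)
    - sbsum k (fun j => bsum (k - j%:Z) (F3 i j)) - (-1) ^ k *: sbsum k (F2 i).
  have fu1 : fin (fun j => u (m + i%:Z + j%:Z) w) by apply: vfield_fin fu _ => j.
  have fau : fin (fun j => a (k - j%:Z) (u (m + i%:Z + j%:Z) w)).
    by apply: finW fu1 => j ->.
  have fua : fin (fun j => u (k + (m + i%:Z) - j%:Z) (a j%:Z w)).
    by apply: finW (vfield_fin w (f := fun j => j%:Z) (n := 0) fa _) => [j ->|j]; rewrite ?add0r.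
  rewrite cE (linear_funB (vfield_lin _ fv)) (linear_funZ (vfield_lin _ fv)).
  rewrite !(sbsum_lin _ (vfield_lin _ fv)) //; congr (_ - _).
  rewrite -sbsumB; [|exact: fin2_row|exact: fin2_row fin3].
  by apply: eq_sbsum => j; rewrite /F1 av addrK.
rewrite /prodm (eq_sbsum _ e).
have fs1 := fin2_sbsum (fun=> k) fin1.
have fs2 := fin2_sbsum (fun=> k) fin_2.
have fs3 := fin2_sbsum (fun=> k) fin3.
rewrite sbsumB; last 2 first.
- by apply: finD => //; apply: finW fs3 => i ->; rewrite oppr0.
- exact: finZ.
rewrite sbsumB // sbsumZ // [LHS]addrAC; congr (_ - _ *: _ - _).
- rewrite sbsum_exch //; apply: eq_sbsum => g.
  rewrite (sbsum_lin _ (vfield_lin _ fa)); last first.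
    by apply: (prodm_fin fv fu (fun i => _ - i%:Z)).
  by apply: eq_sbsum => i; congr (a _ (v _ (u _ _))); ring.
- rewrite sbsum_exch //; apply: eq_sbsum => g.
  by apply: eq_sbsum => i; congr (v _ (u _ _)); ring.
pose Y r t := V r (l + k - r%:Z + n - t%:Z) (u (m + t%:Z) w).
have finY r : fin (Y r) by apply: (prodm_fin (fV r) fu (fun t => _ - t%:Z)).
transitivity (sbsum l (fun i =>
    bsum k (fun r => sbsum (k - r%:Z) (fun h => Y r (i + h)%N)))).
  apply: eq_sbsum => i; rewrite (sbsum_revise_down _ (fin3i i)); apply: eq_bsum => r.
  by apply: eq_sbsum => h; rewrite /F3 /Y; congr (V _ _ (u _ _)); lia.
rewrite sbsum_bsum_exch; last first.
  exists (maxn N1 R) => i r; rewrite !geq_max => hir; apply: bsum_eq0 => h.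
  case/orP: hir => /andP[h1 h2]; last by rewrite /Y hR ?scaler0.
  by rewrite /Y hu ?V00 ?scaler0 //; lia.
apply: eq_bsum => r; rewrite sbsum_conv //.
by have -> : l + (k - r%:Z) = l + k - r%:Z by ring.
Qed.
End NormalProduct.
End Fields.

(** * The Borcherds identity from its commutator and iterate slices *)

Section Borcherds.
Context (K : numFieldType).

(** Both sides of the Borcherds identity satisfy this recursion, so the identity
    follows from the commutator formula ([l = 0]) and the iterate formula
    ([m = 0]). *)
Lemma pascal_slices (W : zmodType) (Z : int -> int -> int -> W) :
  (forall l m n, Z (l + 1) m n = Z l (m + 1) n - Z l m (n + 1)) ->
  (forall m n, Z 0 m n = 0) -> (forall l n, Z l 0 n = 0) ->
  forall l m n, Z l m n = 0.
Proof.
move=> Zp Z0 Z1; elim/int_rect => [|l IH|l IH] m n; first exact: Z0.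
  by have -> : l.+1%:Z = l%:Z + 1 by [lia]; rewrite Zp !IH subrr.
set l' := - _.
(* Vanishing one level up makes [Z l'] constant along each line on which $m+n$ is fixed, and every
   such line meets the slice $m=0$. *)
have sh m' n' : Z l' (m' + 1) n' = Z l' m' (n' + 1).
  apply/eqP; rewrite -subr_eq0 -Zp; apply/eqP.
  by have -> : l' + 1 = - l%:Z by [rewrite /l'; lia]; exact: IH.
elim/int_rect: m n => [|m IHm|m IHm] n; first exact: Z1.
  by have -> : m.+1%:Z = m%:Z + 1 by [lia]; rewrite sh IHm.
have -> : n = n - 1 + 1 by ring.
by rewrite -sh; have -> : - m.+1%:Z + 1 = - m%:Z by [lia]; exact: IHm.
Qed.

Context (V W : lmodType K) (VY : V -> int -> V -> V) (VW : V -> int -> W -> W).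

(** The iterate side of the Borcherds identity. *)
Definition itprod (u v : V) (l m n : int) (w : W) : W :=
  bsum m (fun i => VW (VY u (l + i%:Z) v) (m + n - i%:Z) w).

Definition borcherds (u v : V) : Prop :=
  forall l m n w, brak (VW u) (VW v) l m n w = itprod u v l m n w.

Context (VYf : forall v, vfield (VY v)) (VWf : forall v, vfield (VW v)).
Context (VWl : forall n w, linear (fun v => VW v n w)).

Lemma VW0 n w : VW 0 n w = 0.
Proof. exact: (linear_fun0 (VWl n w)). Qed.

Lemma itprod_fin u v l (f : nat -> int) w :
  fin (fun i => VW (VY u (l + i%:Z) v) (f i) w).
Proof.
have [N hN] := vfield_large v l (VYf u).
by exists N => i /hN ->; apply: VW0.
Qed.

Lemma itprod_pascal u v l m n w :
  itprod u v (l + 1) m n w = itprod u v l (m + 1) n w - itprod u v l m (n + 1) w.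
Proof.
rewrite /itprod bsum_pascal; last exact: itprod_fin.
have e i : VW (VY u (l + i%:Z) v) (m + 1 + n - i%:Z) w
    = VW (VY u (l + i%:Z) v) (m + (n + 1) - i%:Z) w by congr (VW _ _ _); ring.
rewrite (eq_bsum _ e) [bsum _ _ + _]addrC addrK; apply: eq_bsum => i.
by congr (VW (VY _ _ _) _ _); lia.
Qed.

Lemma borcherds_slices u v :
  (forall m n w, VW u m (VW v n w) = VW v n (VW u m w)
     + bsum m (fun i => VW (VY u i%:Z v) (m + n - i%:Z) w)) ->
  (forall l n w, VW (VY u l v) n w = brak (VW u) (VW v) l 0 n w) ->
  borcherds u v.
Proof.
move=> hc hi l m n w; apply/eqP; rewrite -subr_eq0; apply/eqP.
apply: (@pascal_slices W (fun l m n => brak (VW u) (VW v) l m n w - itprod u v l m n w)).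
- move=> {}l {}m {}n; rewrite brak_pascal // itprod_pascal.
  by rewrite !opprD !opprK addrACA.
- move=> {}m {}n; rewrite /brak !prodm0 expr0z scale1r hc.
  rewrite [_ + bsum _ _]addrC addrK; apply/eqP; rewrite subr_eq0; apply/eqP.
  by apply: eq_bsum => i; rewrite add0r.
- by move=> {}l {}n; rewrite -hi /itprod bsum0 addr0 add0r subr0 subrr.
Qed.

Section Slices.
Context (u v : V) (uv : borcherds u v).

Lemma borcherds_comm m n w : VW u m (VW v n w) = VW v n (VW u m w)
     + bsum m (fun i => VW (VY u i%:Z v) (m + n - i%:Z) w).
Proof.
have := uv 0 m n w; rewrite /brak !prodm0 expr0z scale1r.
move=> /eqP; rewrite subr_eq addrC => /eqP ->; congr (_ + _).
Qed.

Lemma borcherds_iter l n w : VW (VY u l v) n w =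
  sbsum l (fun i => VW u (l - i%:Z) (VW v (n + i%:Z) w))
  - (-1) ^ l *: sbsum l (fun i => VW v (l + n - i%:Z) (VW u i%:Z w)).
Proof.
have := uv l 0 n w; rewrite /itprod bsum0 addr0 add0r subr0 => <-.
by congr (_ - _ *: _); apply: eq_sbsum => i; rewrite ?addr0 ?add0r.
Qed.
End Slices.

Section IterNormal.
Context (a u v c : V) (k : int).
Context (Vc : forall p, VY c p v =
  sbsum k (fun j => VY a (k - j%:Z) (VY u (p + j%:Z) v))
  - (-1) ^ k *: sbsum k (fun j => VY u (k + p - j%:Z) (VY a j%:Z v))).
Context (Wa : forall x, borcherds a x).

(** Counterpart of [prodm_normall] and [prodm_normalr] on the iterate side. The iterate formula in
    [V] opens $c=a_ku$, and the iterate formula for $(a,u_pv)$ in [W] moves the modes of $a$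
    outward. The three resulting families are those of the products, ready to be compared through
    the identities for $u$. *)
Lemma itprod_normal l m n w : itprod c v l m n w =
  sbsum k (fun g => VW a (k - g%:Z) (itprod u v l (m + g%:Z) n w))
  - (-1) ^ k *: sbsum k (fun g => itprod u v l (m + k - g%:Z) n (VW a g%:Z w))
  - (-1) ^ k *: sbsum k (fun r => itprod u (VY a r%:Z v) (l + k - r%:Z) m n w).
Proof.
have Va0 s : VY a s 0 = 0 by apply: vfield0.
have Vu0 s : VY u s 0 = 0 by apply: vfield0.
have Wa0 s : VW a s 0 = 0 by apply: vfield0.
have W0 x s : VW x s 0 = 0 by apply: vfield0.
have [T hT] := vfield_large v l (VYf u).
pose b t := VY u (l + t%:Z) v.
have b0 t : (T <= t)%N -> b t = 0 by apply: hT.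
have [A hA] := vfield_large w 0 (VWf a).
have a_w h : (A <= h)%N -> VW a h%:Z w = 0 by move=> /hA; rewrite add0r.
pose F3 i j := VW (VY u (k + (l + i%:Z) - j%:Z) (VY a j%:Z v)) (m + n - i%:Z) w.
pose FA i j h := VW a (k - j%:Z - h%:Z) (VW (b (i + j)%N) (m + n - i%:Z + h%:Z) w).
pose FB i j h := VW (b (i + j)%N) (k - j%:Z + (m + n - i%:Z) - h%:Z) (VW a h%:Z w).
have fin3 : fin2 F3.
  apply: fin2C; apply: fin2_intro => [|j].
    have [N hN] := vfield_large v 0 (VYf a); exists N => j hj i.
    by move: (hN j hj); rewrite add0r /F3 => ->; rewrite Vu0 VW0.
  have [N hN] := vfield_large (VY a j%:Z v) (k + l - j%:Z) (VYf u); exists N => i hi.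
  by rewrite /F3 -(VW0 (m + n - i%:Z) w) -(hN i hi); congr (VW (VY _ _ _) _ _); ring.
(* Only $t<T$ matter, so a single bound on $g$ serves every $b_t$. *)
have [Z hZ] : exists Z, forall t g, (T <= t)%N || (Z <= g)%N ->
    VW (b t) (m + n + g%:Z - t%:Z) w = 0.
  have /choice[M hM] t : exists N, forall g : nat, (N <= g)%N -> VW (b t) (m + n - t%:Z +
    g%:Z) w = 0.
    exact: vfield_large.
  exists (\max_(t < T) M t) => t g.
  case: (leqP T t) => [le _|lt /= hg]; first by rewrite b0 // VW0.
  rewrite -(hM t g); first by congr (VW _ _ _); ring.
  by apply: leq_trans hg; apply: (leq_bigmax (Ordinal lt)).
pose X g t := VW (b t) (m + n + g%:Z - t%:Z) w.
(* Grouping by $g=j+h$ fixes the mode $k-g$ of $a$ and leaves a sum over $j$ weighted by $\binom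
   gj$. *)
have eFA i j h : FA i j h = VW a (k - (j + h)%N%:Z) (X (j + h)%N (i + j)%N).
  by rewrite /FA /X; congr (VW _ _ (VW _ _ _)); lia.
pose GA i j g := VW a (k - g%:Z) (X g (i + j)%N).
have finGA i : fin2 (GA i).
  exists (maxn T Z) => j g; rewrite !geq_max => hjg; rewrite /GA /X hZ //.
  by case/orP: hjg => /andP[h1 h2]; rewrite ?h2 ?orbT //; apply/orP; left; lia.
have finA : fin2 (fun i g => bsum g (fun j => GA i j g)).
  exists (maxn T Z) => i g; rewrite !geq_max => hjg; apply: bsum_eq0 => j.
  rewrite /GA /X hZ //.
  by case/orP: hjg => /andP[h1 h2]; rewrite ?h2 ?orbT //; apply/orP; left; lia.
have finFB i : fin2 (FB i).
  exists (maxn T A) => j h; rewrite !geq_max => hjh; rewrite /FB.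
  case/orP: hjh => /andP[h1 h2]; last by rewrite a_w.
  by rewrite b0 ?VW0 //; lia.
have finFB' i : fin2 (fun j h => (-1) ^+ h *: FB i j h) by apply: fin2Z.
pose SA i := sbsum k (fun g => bsum g (fun j => GA i j g)).
pose SB i := sbsum k (fun h => bsum (k - h%:Z) (fun j => FB i j h)).
have finB : fin2 (fun i h => bsum (k - h%:Z) (fun j => FB i j h)).
  exists (maxn T A) => i h; rewrite !geq_max => hjh; apply: bsum_eq0 => j; rewrite /FB.
  case/orP: hjh => /andP[h1 h2]; last by rewrite a_w.
  by rewrite b0 ?VW0 //; lia.
have e i : VW (VY c (l + i%:Z) v) (m + n - i%:Z) w
    = SA i - (-1) ^ k *: SB i - (-1) ^ k *: sbsum k (F3 i).
  have fi1 : fin (fun j => VY a (k - j%:Z) (VY u (l + i%:Z + j%:Z) v)).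
    have [N hN] := vfield_large v (l + i%:Z) (VYf u).
    by exists N => j /hN ->.
  have fi2 : fin (fun j => VY u (k + (l + i%:Z) - j%:Z) (VY a j%:Z v)).
    have [N hN] := vfield_large v 0 (VYf a).
    by exists N => j /hN; rewrite add0r => ->.
  rewrite Vc (linear_funB (VWl _ _)) (linear_funZ (VWl _ _)).
  rewrite !(sbsum_lin _ (VWl _ _)) //; congr (_ - _ *: _).
  have fA : fin2 (FA i).
    have [N hN] := finGA i; exists (N + N)%N => j h hjh; rewrite eFA.
    by apply: hN; lia.
  transitivity (sbsum k (fun j => sbsum (k - j%:Z) (FA i j))
      - sbsum k (fun j => (-1) ^ (k - j%:Z) *: sbsum (k - j%:Z) (FB i j))).
    rewrite -sbsumB; last 2 first.
    - exact: (fin2_sbsum (fun j => k - j%:Z)).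
    - exact: finZ (fin2_sbsum (fun j => k - j%:Z) (finFB i)).
    apply: eq_sbsum => j; rewrite (borcherds_iter (Wa _)).
    congr (_ - _ *: _); apply: eq_sbsum => h; rewrite /FA /FB /b.
      by congr (VW _ _ (VW (VY _ _ _) _ _)); lia.
    by congr (VW (VY _ _ _) _ _); lia.
  congr (_ - _).
    rewrite /SA (sbsum_revise_up _ (finGA i)); apply: eq_sbsum => j.
    by apply: eq_sbsum => h; rewrite eFA.
  (* The sign $(-1)^{k-j}$ of the iterate formula cancels the $(-1)^j$ of the alternating sum,
     leaving an ordinary binomial sum. *)
  transitivity ((-1) ^ k *: bsum k (fun j => sbsum (k - j%:Z) (FB i j))).
    rewrite -bsumZ; last exact: (fin2_sbsum (fun j => k - j%:Z)).
    apply: eq_bsum => j; rewrite scalerA; congr (_ *: _).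
    by rewrite signzB mulrCA -exprD addnn -signr_odd odd_double mulr1.
  congr (_ *: _); rewrite /sbsum (bsum_revise_down _ (finFB' i)).
  apply: eq_bsum => h; rewrite bsumZ //; exact: (fin2_col _ (finFB i)).
rewrite /itprod (eq_bsum _ e).
have finSA : fin SA by apply: (fin2_sbsum (fun=> k) finA).
have finSB : fin SB by apply: (fin2_sbsum (fun=> k) finB).
have finS3 : fin (fun i => sbsum k (F3 i)) by apply: (fin2_sbsum (fun=> k) fin3).
rewrite bsumB; last 2 first.
- by apply: finD => //; apply: finW finSB => i ->; rewrite scaler0 oppr0.
- exact: finZ.
rewrite bsumB //; last exact: finZ.
rewrite !bsumZ //; congr (_ - _ *: _ - _ *: _).
- rewrite -sbsum_bsum_exch; last exact: fin2C finA.
  apply: eq_sbsum => g; have fX : fin (X g) by exists T => t ht; rewrite /X hZ ?ht.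
  rewrite (bsum_lin _ (vfield_lin _ (VWf a))); last exact: itprod_fin.
  rewrite /GA (bsum_conv _ _ (X := fun t => VW a (k - g%:Z) (X g t))); last first.
    by apply: finW fX => t ->.
  by apply: eq_bsum => t; rewrite /X; congr (VW _ _ (VW _ _ _)); ring.
- rewrite -sbsum_bsum_exch; last exact: fin2C finB.
  apply: eq_sbsum => h.
  pose X2 t := VW (b t) (k + m + n - h%:Z - t%:Z) (VW a h%:Z w).
  transitivity (bsum m (fun i => bsum (k - h%:Z) (fun j => X2 (i + j)%N))).
    by apply: eq_bsum => i; apply: eq_bsum => j; rewrite /FB /X2; congr (VW _ _ _); lia.
  rewrite bsum_conv; last by exists T => t /b0; rewrite /X2 => ->; exact: VW0.
  have -> : m + (k - h%:Z) = m + k - h%:Z by ring.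
  by apply: eq_bsum => t; rewrite /X2 /b; congr (VW _ _ _); ring.
- rewrite -sbsum_bsum_exch; last exact: fin2C fin3.
  apply: eq_sbsum => r; apply: eq_bsum => i.
  by rewrite /F3; congr (VW (VY _ _ _) _ _); ring.
Qed.
End IterNormal.
End Borcherds.

(** * Closure of the Borcherds identity under products *)

Section BorcherdsProduct.
Context (K : numFieldType).

Lemma subrACA (W : zmodType) (x y z t : W) : x - y - (z - t) = x - z - (y - t).
Proof. by rewrite !opprB [t - z]addrC addrACA [- y + t]addrC. Qed.

Lemma prodm_finl (W : lmodType K) (A B : int -> W -> W) l m n w :
  vfield A -> vfield B -> fin (fun g => prodm A B l (m + g%:Z) n w).
Proof.
move=> fA fB; have [N hN] := vfield_large w n fB.
have /choice[M hM] i : exists M, forall g : nat, (M <= g)%N ->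
    A (l + m - i%:Z + g%:Z) (B (n + i%:Z) w) = 0.
  exact: vfield_large.
exists (\max_(i < N) M i)%N => g hg; apply: bsum_eq0 => i.
case: (leqP N i) => [/hN ->|lt]; first by rewrite vfield0 ?scaler0.
rewrite (_ : A _ _ = 0) ?scaler0 // -(hM i g); first by congr (A _ _); ring.
by apply: leq_trans hg; apply: (leq_bigmax (Ordinal lt)).
Qed.

Lemma prodm_finr (W : lmodType K) (A B : int -> W -> W) l m n w :
  vfield A -> vfield B -> fin (fun g => prodm A B l m (n + g%:Z) w).
Proof.
move=> fA fB; have [N hN] := vfield_large w n fB.
exists N => g hg; apply: bsum_eq0 => i.
have -> : n + g%:Z + i%:Z = n + (g + i)%N%:Z by lia.
by rewrite hN ?vfield0 ?scaler0 //; lia.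
Qed.

Context (V W : lmodType K) (VY : V -> int -> V -> V) (VW : V -> int -> W -> W).
Context (VYf : forall v, vfield (VY v)) (VWf : forall v, vfield (VW v)).
Context (VWl : forall n w, linear (fun v => VW v n w)).

(** The expansions of the two sides are compared family by family: the first two through the
    identity for $(u,v)$, the third through that for $(u,a_rv)$. Hence the quantification over the
    second argument. *)
Lemma borcherds_nprod a u k :
  (forall v, borcherds VY VW a v) -> (forall v, borcherds VY VW u v) ->
  (forall v, borcherds VY VY a v) ->
  forall v, borcherds VY VW (VY a k u) v.
Proof.
move=> Wa Wu Va v l m n w.
pose Vr (r : nat) := VW (VY a r%:Z v).
have V0 : exists R, forall r, (R <= r)%N -> forall n w, Vr r n w = 0.
  have [R hR] := vfield_large v 0 (VYf a); exists R => r /hR.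
  by rewrite add0r /Vr => -> *; exact: (linear_fun0 (VWl _ _)).
have fVr r : vfield (Vr r) by apply: VWf.
have av := borcherds_comm (Wa v).
have cE := borcherds_iter (Wa u) k.
rewrite (itprod_normal VYf VWf VWl (fun p => borcherds_iter (Va u) k p v) Wa).
rewrite /brak (prodm_normall (VWf a) (VWf u) (VWf v) fVr V0 av cE).
rewrite (prodm_normalr (VWf a) (VWf u) (VWf v) fVr V0 av cE).
have a0 s : VW a s 0 = 0 by apply: vfield0.
set s := (-1) ^ k; set t := (-1) ^ l.
rewrite [in RHS](_ : sbsum k (fun g => VW a (k - g%:Z) (itprod VY VW u v l (m + g%:Z) n w))
  = sbsum k (fun g => VW a (k - g%:Z) (prodm (VW u) (VW v) l (m + g%:Z) n w))
  - t *: sbsum k (fun g => VW a (k - g%:Z) (prodm (VW v) (VW u) l n (m + g%:Z) w))); last first.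
  have f1 : fin (fun g => VW a (k - g%:Z) (prodm (VW u) (VW v) l (m + g%:Z) n w)).
    by apply: finW (prodm_finl l m n w (VWf u) (VWf v)) => g ->.
  have f2 : fin (fun g => VW a (k - g%:Z) (prodm (VW v) (VW u) l n (m + g%:Z) w)).
    by apply: finW (prodm_finr l n m w (VWf v) (VWf u)) => g ->.
  rewrite -sbsumZ // -sbsumB //; last exact: finZ.
  apply: eq_sbsum => g; rewrite -Wu /brak (linear_funB (vfield_lin _ (VWf a))).
  by rewrite (linear_funZ (vfield_lin _ (VWf a))).
have fa_w : fin (fun g => VW a g%:Z w).
  by apply: (vfield_fin w (f := fun j => j%:Z) (n := 0) (VWf a)) => i; rewrite add0r.
rewrite [in RHS](_ : sbsum k (fun g => itprod VY VW u v l (m + k - g%:Z) n (VW a g%:Z w))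
  = sbsum k (fun g => prodm (VW u) (VW v) l (m + k - g%:Z) n (VW a g%:Z w))
  - t *: sbsum k (fun g => prodm (VW v) (VW u) l n (m + k - g%:Z) (VW a g%:Z w))); last first.
  have f1 : fin (fun g => prodm (VW u) (VW v) l (m + k - g%:Z) n (VW a g%:Z w)).
    by apply: finW fa_w => g ->; exact/linear_fun0/prodm_linear.
  have f2 : fin (fun g => prodm (VW v) (VW u) l n (m + k - g%:Z) (VW a g%:Z w)).
    by apply: finW fa_w => g ->; exact/linear_fun0/prodm_linear.
  rewrite -sbsumZ // -sbsumB //; last exact: finZ.
  by apply: eq_sbsum => g; rewrite -Wu.
rewrite [in RHS](_ : s *: sbsum k (fun r => itprod VY VW u (VY a r%:Z v) (l + k - r%:Z) m n w)
  = s *: sbsum k (fun r => prodm (VW u) (Vr r) (l + k - r%:Z) m n w)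
  - t *: bsum k (fun r => prodm (Vr r) (VW u) (l + k - r%:Z) n m w)); last first.
  have [R hR] := V0.
  have f1 : fin (fun r => prodm (VW u) (Vr r) (l + k - r%:Z) m n w).
    exists R => r hr; apply: bsum_eq0 => i; rewrite hR // vfield0 ?scaler0 //.
  have f2 : fin (fun r => prodm (Vr r) (VW u) (l + k - r%:Z) n m w).
    by exists R => r hr; apply: bsum_eq0 => i; rewrite hR // scaler0.
  (* The identity for $(u,a_rv)$ carries $(-1)^{l+k-r}$; together with the $(-1)^r$ of the
     alternating sum it leaves $st$, and the prefactor $s$ turns this into $t$. *)
  have -> : t = s * (s * t).
    by rewrite mulrA -exprzMl ?unitrN1 // mulrNN mulr1 exp1rz mul1r.
  rewrite -scalerA -scalerBr; congr (_ *: _).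
  rewrite -bsumZ // /sbsum -bsumB; [|exact: finN1|exact: finZ].
  apply: eq_bsum => r; rewrite -Wu /brak scalerBr signzB exprzDr ?unitrN1 //.
  rewrite scalerA; congr (_ - _ *: _).
  by rewrite mulrCA -exprD addnn -signr_odd odd_double mulr1 mulrC.
move: (sbsum k _) (sbsum k _) (sbsum k _) (sbsum k _) (sbsum k _) (bsum k _).
move=> A1 B1 A2 B2 A3 B3.
rewrite !scalerBr !scalerA [t * s]mulrC [LHS]subrACA; congr (_ - _).
exact: subrACA.
Qed.
End BorcherdsProduct.

(** * Products with a field of prescribed commutators *)

Section NormalProducts.
Context (K : numFieldType).
Local Notation binz := (@binz K).

Section BinomialWeights.
Context (W : lmodType K).
Implicit Type X : nat -> W.

(** Bracket coefficients are polynomials in the mode indices, written as binomials $\binom ms$. The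
    absorption $\binom ki\binom ir=\binom kr\binom{k-r}{i-r}$ converts such a weight into a lower
    exponent. *)
Lemma bsum_weightr k r X : fin X ->
  bsum k (fun i => binz i r *: X i) = binz k r *: bsum (k - r%:Z) (fun h => X (r + h)%N).
Proof.
move=> fX; rewrite /bsum (@isum_shift _ _ r).
- rewrite -isumZ; last by apply: finZ; have [N hN] := fX; exists N => i hi; apply: hN; lia.
  by apply: eq_isum => h; rewrite !scalerA binz_mulD.
- by move=> i hi; rewrite (binz_small _ hi) scale0r scaler0.
- exact/finZ/finZ.
Qed.

Lemma bsum_weightl k r X : fin X ->
  bsum k (fun i => binz (k - i%:Z) r *: X i) = binz k r *: bsum (k - r%:Z) X.
Proof.
move=> fX; rewrite /bsum -isumZ; last exact: finZ.
by apply: eq_isum => h; rewrite !scalerA binz_mulB.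
Qed.

Lemma sbsum_weightr k r X : fin X -> sbsum k (fun i => binz i r *: X i)
  = (binz k r * (-1) ^+ r) *: sbsum (k - r%:Z) (fun h => X (r + h)%N).
Proof.
move=> fX; rewrite /sbsum.
rewrite (_ : bsum _ _ = bsum k (fun i => binz i r *: ((-1) ^+ i *: X i))); last first.
  by apply: eq_bsum => i; rewrite !scalerA mulrC.
rewrite bsum_weightr; last exact: finZ.
rewrite -[RHS]scalerA; congr (_ *: _); rewrite -bsumZ.
  by apply: eq_bsum => i; rewrite scalerA exprD.
by apply: finZ; have [N hN] := fX; exists N => i hi; apply: hN; lia.
Qed.

Lemma sbsum_weightl k r X : fin X ->
  sbsum k (fun i => binz (k - i%:Z) r *: X i) = binz k r *: sbsum (k - r%:Z) X.
Proof.
move=> fX; rewrite /sbsum -bsum_weightl; last exact: finZ.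
by apply: eq_bsum => i; rewrite !scalerA mulrC.
Qed.
End BinomialWeights.

Context (W : lmodType K).
Implicit Types a b e f : int -> W -> W.

(** Taking $m=0$ in the bracket is the residue that defines the $k$-th product of fields. *)
Definition nprod a k f : int -> W -> W := fun n w => brak a f k 0 n w.

Lemma nprodE a k f n w : nprod a k f n w =
  sbsum k (fun i => a (k - i%:Z) (f (n + i%:Z) w))
  - (-1) ^ k *: sbsum k (fun i => f (k + n - i%:Z) (a i%:Z w)).
Proof.
by rewrite /nprod /brak /prodm addr0.
Qed.

Lemma nprod_vfield a k f : vfield a -> vfield f -> vfield (nprod a k f).
Proof.
move=> fa ff; split=> [n c x y|w].
  rewrite /nprod /brak (prodm_linear fa ff) (prodm_linear ff fa).
  by rewrite [_ ^ k *: (_ + _)]scalerDr opprD addrACA scalerBr !scalerA mulrC.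
have [[_ /(_ w)[N hN]] [M hM]] := (ff, vfield_large w 0 fa).
have /choice[P hP] i : exists P : int, forall n, P <= n -> f n (a i%:Z w) = 0.
  by have [_] := ff; apply.
(* Beyond [N] every $f_{n+i}w$ vanishes; in the second sum only $i<M$ survive, and the other bound
   gives $k+n-i\ge P_i$ for these. *)
exists (Num.max N (\big[Num.max/0]_(i < M) (P i - k + i%:Z))) => n.
rewrite ge_max => /andP[h1 h2]; rewrite nprodE [X in X - _]bsum_eq0; last first.
  by move=> i; rewrite hN ?vfield0 ?scaler0 //; lia.
rewrite sub0r [X in _ *: X]bsum_eq0 ?scaler0 ?oppr0 // => i.
case: (leqP M i) => [/hM|lt].
  by rewrite add0r => ->; rewrite vfield0 ?scaler0.
rewrite hP ?scaler0 //; have := le_trans (le_bigmax 0 (fun i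
  : 'I_M => P i - k + i%:Z) (Ordinal lt)) h2.
by move=> /=; lia.
Qed.

Definition idf : int -> W -> W := fun n w => if n == -1 then w else 0.

Lemma idf_vfield : vfield idf.
Proof.
split=> [n c x y|w]; first by rewrite /idf; case: eqP => // _; rewrite scaler0 addr0.
by exists 0 => n hn; rewrite /idf; case: eqP => // e; lia.
Qed.

(** [x] and [y] stand for the mixed terms, with $f$ between $a$ and $b$; they cancel in the
    commutator of two products. *)
Lemma subr_cross (P1 P2 x y m1 m2 : W) :
  P1 - x - (y - m1) - (P2 - y - (x - m2)) = P1 - P2 - (m2 - m1).
Proof.
rewrite !opprB [P1 - x + _]addrACA [x - m2 + _]addrACA -[- x - y]opprD [LHS]addrA addrNK.
by rewrite [RHS]addrACA [- m2 - P2]addrC.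
Qed.

Section Bracket.
Context (f : int -> W -> W) (ff : vfield f).

Let f0 m : f m 0 = 0. Proof. exact: vfield0. Qed.

(** The contribution of a bracket [T] to the commutator of two products. *)
Let dsum (k k' n : int) (T : int -> int -> W -> W) w : W :=
  sbsum k (fun i => sbsum k' (fun j => T (k - i%:Z) (k' - j%:Z) (f (n + (i + j)%N%:Z) w)))
  - ((-1) ^ k * (-1) ^ k') *: sbsum k (fun i => sbsum k' (fun j =>
      f (k + k' + n - (i + j)%N%:Z) (T i%:Z j%:Z w))).

Let dsum_weight g s k k' n w : vfield g ->
  dsum k k' n (fun m m' w => binz m s *: g (m + m' - s%:Z) w) w
  = binz k s *: nprod g (k + k' - s%:Z) f n w.
Proof.
move=> fg.
rewrite /dsum nprodE scalerBr; congr (_ - _).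
- pose Y t := g (k + k' - s%:Z - t%:Z) (f (n + t%:Z) w).
  have fY : fin Y by apply: (prodm_fin fg ff (fun t => _ - t%:Z)).
  have fY2 : fin (fun i => sbsum k' (fun j => Y (i + j)%N)).
    have [N hN] := fY; exists N => i hi; apply: bsum_eq0 => j.
    by rewrite hN ?scaler0 //; lia.
  transitivity (sbsum k (fun i => binz (k - i%:Z) s *: sbsum k' (fun j => Y (i + j)%N))).
    apply: eq_sbsum => i; rewrite -sbsumZ; last first.
      by have [N hN] := fY; exists N => j hj; apply: hN; lia.
    by apply: eq_sbsum => j; congr (_ *: g _ _); lia.
  rewrite sbsum_weightl // sbsum_conv //.
  by have -> : k - s%:Z + k' = k + k' - s%:Z by ring.
- pose Y t := f (k + k' + n - s%:Z - t%:Z) (g t%:Z w).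
  have fY : fin Y.
    have [N hN] := vfield_large w 0 fg; exists N => t /hN.
    by rewrite add0r /Y => ->.
  (* [Y'] is [Y] delayed by $s$; the weight $\binom is$ discards $i<s$, so no negative mode $t-s$
     contributes. *)
  pose Y' t := f (k + k' + n - t%:Z) (g (t%:Z - s%:Z) w).
  have fY' : fin Y'.
    have [N hN] := fY; exists (N + s)%N => t ht; rewrite /Y' -(hN (t - s)%N); last by lia.
    by congr (f _ (g _ _)); lia.
  have fY2 : fin (fun i => sbsum k' (fun j => Y' (i + j)%N)).
    have [N hN] := fY'; exists N => i hi; apply: bsum_eq0 => j.
    by rewrite hN ?scaler0 //; lia.
  rewrite (_ : sbsum k _ = sbsum k (fun i => binz i s *: sbsum k' (fun j => Y' (i + j)%N)));
    last first.
    apply: eq_sbsum => i; rewrite -sbsumZ; last first.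
      by have [N hN] := fY'; exists N => j hj; apply: hN; lia.
    apply: eq_sbsum => j; rewrite (linear_funZ (vfield_lin _ ff)).
    by congr (_ *: f _ (g _ _)); lia.
  rewrite sbsum_weightr //.
  rewrite (_ : sbsum (k - s%:Z) _ = sbsum (k + k' - s%:Z) Y); last first.
    have -> : k + k' - s%:Z = k - s%:Z + k' by ring.
    rewrite -[RHS]sbsum_conv //; apply: eq_sbsum => i; apply: eq_sbsum => j.
    by rewrite /Y /Y'; congr (f _ (g _ _)); lia.
  rewrite !scalerA signzB exprzDr ?unitrN1 //; congr (_ *: _).
    by rewrite mulrCA !mulrA [RHS]mulrC; ring.
  by apply: eq_sbsum => t; rewrite /Y; congr (f _ _); ring.
Qed.

Let goodT (T : int -> int -> W -> W) : Prop :=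
  (forall (k k' n : int) w, fin2 (fun i j => T (k - i%:Z) (k' - j%:Z) (f (n + (i + j)%N%:Z) w)))
  /\ (forall (m : int) w, fin2 (fun i j => f (m - (i + j)%N%:Z) (T i%:Z j%:Z w))).

Let goodT_fin1 T (k k' n : int) w : goodT T -> fin (fun i => sbsum k' (fun j =>
  T (k - i%:Z) (k' - j%:Z) (f (n + (i + j)%N%:Z) w))).
Proof. by case=> h _; apply: (fin2_sbsum (fun=> k') (h k k' n w)). Qed.

Let goodT_fin2 T (k' m : int) w : goodT T -> fin (fun i => sbsum k' (fun j =>
  f (m - (i + j)%N%:Z) (T i%:Z j%:Z w))).
Proof. by case=> _ h; apply: (fin2_sbsum (fun=> k') (h m w)). Qed.

Let goodT_weight g (c : int -> int -> K) (s : int) : vfield g ->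
  goodT (fun m m' w => c m m' *: g (m + m' - s) w).
Proof.
move=> fg; split=> [k k' n w|m w].
  have [N hN] := vfield_large w n ff; exists N => i j hij.
  by rewrite hN ?vfield0 ?scaler0 //; lia.
have [N hN] := vfield_large w (- s) fg; exists N => i j hij.
rewrite (_ : g _ _ = 0) ?scaler0 // -(hN (i + j)%N); last by lia.
by congr (g _ _); lia.
Qed.

Let goodT_D T T' : goodT T -> goodT T' -> goodT (fun m m' w => T m m' w + T' m m' w).
Proof.
move=> [h1 h2] [h1' h2']; split=> [k k' n w|m w].
  have [[N hN] [M hM]] := (h1 k k' n w, h1' k k' n w).
  by exists (maxn N M) => i j hij; rewrite hN ?hM ?addr0 //; lia.
have [[N hN] [M hM]] := (h2 m w, h2' m w).
exists (maxn N M) => i j hij; rewrite (linear_funD (vfield_lin _ ff)).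
by rewrite hN ?hM ?addr0 //; lia.
Qed.

Let goodT_Z c T : goodT T -> goodT (fun m m' w => c *: T m m' w).
Proof.
move=> [h1 h2]; split=> [k k' n w|m w]; first by apply: fin2Z.
by apply: fin2W (h2 m w) => i j e; rewrite (linear_funZ (vfield_lin _ ff)) e scaler0.
Qed.

Let dsumD T T' k k' n w : goodT T -> goodT T' ->
  dsum k k' n (fun m m' w => T m m' w + T' m m' w) w = dsum k k' n T w + dsum k k' n T' w.
Proof.
move=> gT gT'; have [[h1 h2] [h1' h2']] := (gT, gT').
rewrite /dsum [RHS]addrACA -opprD -scalerDr -!sbsumD; try exact: goodT_fin1;
  try exact: goodT_fin2.
congr (_ - _ *: _); apply: eq_sbsum => i; rewrite -sbsumD //;
  try exact: (fin2_row i (h1 k k' n w)); try exact: (fin2_row i (h1' k k' n w));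
  try exact: (fin2_row i (h2 (k + k' + n) w)); try exact: (fin2_row i (h2' (k + k' + n) w)).
by apply: eq_sbsum => j; rewrite (linear_funD (vfield_lin _ ff)).
Qed.

Let dsumZ c T k k' n w : goodT T ->
  dsum k k' n (fun m m' w => c *: T m m' w) w = c *: dsum k k' n T w.
Proof.
move=> gT; have [h1 h2] := gT.
rewrite /dsum scalerBr; congr (_ - _).
  rewrite -sbsumZ; last exact: goodT_fin1.
  by apply: eq_sbsum => i; rewrite -sbsumZ //; apply: fin2_row i (h1 k k' n w).
rewrite [RHS]scalerA [c * _]mulrC -[RHS]scalerA; congr (_ *: _).
rewrite -sbsumZ; last exact: goodT_fin2.
apply: eq_sbsum => i; rewrite -sbsumZ; last exact: fin2_row i (h2 (k + k' + n) w).
by apply: eq_sbsum => j; rewrite (linear_funZ (vfield_lin _ ff)).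
Qed.

(** Reduces a weight in the second mode index to one in the first. *)
Let dsum_swap T k k' n w : goodT T ->
  dsum k k' n T w = dsum k' k n (fun m m' w => T m' m w) w.
Proof.
move=> [h1 h2]; rewrite /dsum [(-1) ^ k * _]mulrC [k + k']addrC.
rewrite [X in X - _ = _]sbsum_exch // [X in _ - _ *: X = _]sbsum_exch //.
by congr (_ - _ *: _); apply: eq_sbsum => i; apply: eq_sbsum => j; rewrite addnC.
Qed.

Lemma fin2_cross a b (fa : vfield a) (fb : vfield b) (k n : int) w :
  fin2 (fun i j => a (k - i%:Z) (f (n + i%:Z - j%:Z) (b j%:Z w))).
Proof.
apply: fin2C; apply: fin2_intro => [|j].
  have [N hN] := vfield_large w 0 fb; exists N => j /hN; rewrite add0r => -> i.
  by rewrite f0 vfield0.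
have [N hN] := vfield_large (b j%:Z w) (n - j%:Z) ff; exists N => i /hN e.
by rewrite -(vfield0 (k - i%:Z) fa) -e; congr (a _ (f _ _)); ring.
Qed.

Lemma fin2_in (c d : int -> W -> W) (m : int) w : vfield c -> vfield d ->
  fin2 (fun i j => f (m - (i + j)%N%:Z) (c j%:Z (d i%:Z w))).
Proof.
move=> fc fd; apply: fin2_intro => [|i].
  have [N hN] := vfield_large w 0 fd; exists N => i /hN; rewrite add0r => -> j.
  by rewrite vfield0.
have [N hN] := vfield_large (d i%:Z w) 0 fc; exists N => j /hN.
by rewrite add0r => ->.
Qed.

Lemma fin2_out a b (fa : vfield a) (fb : vfield b) (k k' n : int) w :
  fin2 (fun i j => a (k - i%:Z) (b (k' - j%:Z) (f (n + (i + j)%N%:Z) w))).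
Proof.
have [N hN] := vfield_large w n ff; exists N => i j hij.
by rewrite hN ?(vfield0 _ fb) ?(vfield0 _ fa) //; lia.
Qed.

Lemma nprod_nprod a b (fa : vfield a) (fb : vfield b) (k k' n : int) w
  : nprod a k (nprod b k' f) n w =
  sbsum k (fun i => sbsum k' (fun j =>
    a (k - i%:Z) (b (k' - j%:Z) (f (n + (i + j)%N%:Z) w))))
  - (-1) ^ k' *: sbsum k (fun i => sbsum k' (fun j =>
      a (k - i%:Z) (f (k' + n + i%:Z - j%:Z) (b j%:Z w))))
  - ((-1) ^ k *: sbsum k' (fun j => sbsum k (fun i =>
      b (k' - j%:Z) (f (k + n + j%:Z - i%:Z) (a i%:Z w))))
     - ((-1) ^ k * (-1) ^ k') *: sbsum k (fun i => sbsum k' (fun j =>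
      f (k + k' + n - (i + j)%N%:Z) (b j%:Z (a i%:Z w))))).
Proof.
have h1 := fin2_out fa fb k k' n w.
have h2 := fin2_cross fa fb k (k' + n) w.
have h3 := fin2C (fin2_cross fb fa k' (k + n) w).
have h4 := fin2_in (k + k' + n) w fb fa.
have e1 i : a (k - i%:Z) (nprod b k' f (n + i%:Z) w) =
    sbsum k' (fun j => a (k - i%:Z) (b (k' - j%:Z) (f (n + (i + j)%N%:Z) w)))
    - (-1) ^ k' *: sbsum k' (fun j => a (k - i%:Z) (f (k' + n + i%:Z - j%:Z) (b j%:Z w))).
  rewrite nprodE (linear_funB (vfield_lin _ fa)) (linear_funZ (vfield_lin _ fa)).
  rewrite !(sbsum_lin _ (vfield_lin _ fa)); last 2 first.
  - have [N hN] := vfield_large w 0 fb; exists N => j /hN.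
    by rewrite add0r => ->; rewrite f0.
  - have [N hN] := vfield_large w (n + i%:Z) ff; exists N => j /hN ->.
    exact: vfield0.
  congr (_ - _ *: _); apply: eq_sbsum => j.
    by congr (a _ (b _ (f _ _))); lia.
  by congr (a _ (f _ _)); ring.
have e2 i : nprod b k' f (k + n - i%:Z) (a i%:Z w) =
    sbsum k' (fun j => b (k' - j%:Z) (f (k + n + j%:Z - i%:Z) (a i%:Z w)))
    - (-1) ^ k' *: sbsum k' (fun j => f (k + k' + n - (i + j)%N%:Z) (b j%:Z (a i%:Z w))).
  rewrite nprodE; congr (_ - _ *: _); apply: eq_sbsum => j.
    by congr (b _ (f _ _)); ring.
  by congr (f _ _); lia.
rewrite nprodE (eq_sbsum _ e1) (eq_sbsum _ e2).
rewrite sbsumB; [|exact: (fin2_sbsum (fun=> k') h1)|exact: finZ (fin2_sbsum (fun=> k') h2)].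
rewrite sbsumB; [|exact: (fin2_sbsum (fun=> k') h3)|exact: finZ (fin2_sbsum (fun=> k') h4)].
rewrite !sbsumZ; [|exact: (fin2_sbsum (fun=> k') h4)|exact: (fin2_sbsum (fun=> k') h2)].
by rewrite [sbsum k (fun i => sbsum k' (fun j => b _ _))]sbsum_exch // scalerBr scalerA.
Qed.
Context (a b e : int -> W -> W) (p q z : K).
Context (fa : vfield a) (fb : vfield b) (fe : vfield e).
Context (ab : forall m n w, a m (b n w) - b n (a m w) =
  p *: (binz m 1 *: e (m + n - 1) w) + q *: (binz n 1 *: e (m + n - 1) w)
  + z *: (binz m 3 *: idf (m + n - 3) w)).

(** The operators $f\mapsto a_kf$ inherit the commutators of the modes: the mixed terms cancel, what
    remains is the contribution of $[a_m,b_{m'}]$, and each binomial weight is absorbed into the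
    exponent of a product with [e] or with the identity field. *)
Lemma nprod_lie k k' n w :
  nprod a k (nprod b k' f) n w - nprod b k' (nprod a k f) n w =
  (p * k%:~R + q * k'%:~R) *: nprod e (k + k' - 1) f n w
  + (z * binz k 3) *: nprod idf (k + k' - 3) f n w.
Proof.
transitivity (dsum k k' n (fun m m' w => a m (b m' w) - b m' (a m w)) w).
  rewrite (nprod_nprod fa fb) (nprod_nprod fb fa) /dsum.
  have h1 := fin2_out fa fb k k' n w.
  have h2 := fin2_out fb fa k' k n w.
  have h3 := fin2_in (k + k' + n) w fb fa.
  have h4 := fin2_in (k' + k + n) w fa fb.
  set X1 := sbsum k (fun i => sbsum k' (fun j => a _ (f _ _))).
  set X2 := sbsum k' (fun i => sbsum k (fun j => b _ (f _ _))).
  have -> : (-1) ^ k' * (-1) ^ k = (-1) ^ k * (-1) ^ k' :> K by rewrite mulrC.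
  rewrite subr_cross -scalerBr; congr (_ - _ *: _).
  - rewrite [X in _ - X]sbsum_exch // -sbsumB; last 2 first.
    + exact: (fin2_sbsum (fun=> k') h1).
    + exact: (fin2_sbsum (fun=> k') (fin2C h2)).
    apply: eq_sbsum => i; rewrite -sbsumB; last 2 first.
    + exact: fin2_row h1.
    + exact: fin2_row (fin2C h2).
    by apply: eq_sbsum => j; rewrite [(j + i)%N]addnC.
  - rewrite [X in X - _]sbsum_exch // -sbsumB; last 2 first.
    + exact: (fin2_sbsum (fun=> k') (fin2C h4)).
    + exact: (fin2_sbsum (fun=> k') h3).
    apply: eq_sbsum => i; rewrite -sbsumB; last 2 first.
    + exact: fin2_row (fin2C h4).
    + exact: fin2_row h3.
    apply: eq_sbsum => j; rewrite (linear_funB (vfield_lin _ ff)).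
    by rewrite [(j + i)%N]addnC [k' + k]addrC.
rewrite (_ : (fun m m' w => _) = (fun m m' w =>
    p *: (binz m 1 *: e (m + m' - 1) w) + q *: (binz m' 1 *: e (m + m' - 1) w)
    + z *: (binz m 3 *: idf (m + m' - 3) w))); last first.
  by apply/funext => m; apply/funext => m'; apply/funext => w'; rewrite ab.
have g1 := goodT_weight (fun m _ => binz m 1) 1 fe.
have g2 := goodT_weight (fun _ m => binz m 1) 1 fe.
have g3 := goodT_weight (fun m _ => binz m 3) 3 idf_vfield.
rewrite !dsumD ?dsumZ //; try by do ?[apply: goodT_D|apply: goodT_Z].
rewrite [X in _ + _ *: X + _]dsum_swap //.
rewrite (_ : (fun (m m' : int) w => binz m 1 *: e (m' + m - 1) w) =
   (fun (m m' : int) w => binz m 1 *: e (m + m' - 1%:Z) w)); last first.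
  by apply/funext => m; apply/funext => m'; apply/funext => w'; rewrite [m' + m]addrC.
rewrite !dsum_weight //; last exact: idf_vfield.
by rewrite !binz1 !scalerA scalerDl [k' + k]addrC.
Qed.

(** * Commutator of a mode with a product of fields *)

Section Commutator.
Context (m : int) (F : nat -> int -> W -> W) (fF : forall r, vfield (F r)).
Context (F0 : exists R, forall r, (R <= r)%N -> forall n w, F r n w = 0).
Context (af : forall n w,
  a m (f n w) = f n (a m w) + bsum m (fun r => F r (m + n - r%:Z) w)).
Context (k n : int) (w : W).

(** The contribution of $T_{m'}=[a_m,b_{m'}]$ when $a_m$ crosses the $b$ in $b_kf$. *)
Let csum (T : int -> W -> W) : W :=
  sbsum k (fun j => T (k - j%:Z) (f (n + j%:Z) w))
  - (-1) ^ k *: sbsum k (fun j => f (k + n - j%:Z) (T j%:Z w)).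

Let good T := fin (fun j => T (k - j%:Z) (f (n + j%:Z) w)) /\
  fin (fun j => f (k + n - j%:Z) (T j%:Z w)).

Let good_weight g (c : int -> K) (s : int) : vfield g ->
  good (fun m' w => c m' *: g (m + m' - s) w).
Proof.
move=> fg; split.
  have [N hN] := vfield_large w n ff; exists N => i /hN ->.
  by rewrite vfield0 ?scaler0.
have [N hN] := vfield_large w (m - s) fg; exists N => i hi.
rewrite (_ : g _ _ = 0) ?scaler0 // -(hN i hi).
by congr (g _ _); ring.
Qed.

Let good_D T T' : good T -> good T' -> good (fun m' w => T m' w + T' m' w).
Proof.
move=> [h1 h2] [h1' h2']; split; first exact: finD.
have [[N hN] [M hM]] := (h2, h2'); exists (maxn N M) => i hi.
by rewrite (linear_funD (vfield_lin _ ff)) hN ?hM ?addr0 //; lia.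
Qed.

Let good_Z c T : good T -> good (fun m' w => c *: T m' w).
Proof.
move=> [h1 h2]; split; first exact: finZ.
by apply: finW h2 => i h; rewrite (linear_funZ (vfield_lin _ ff)) h scaler0.
Qed.

Let csumD T T' : good T -> good T' ->
  csum (fun m' w => T m' w + T' m' w) = csum T + csum T'.
Proof.
move=> [h1 h2] [h1' h2']; rewrite /csum [RHS]addrACA -opprD -scalerDr -!sbsumD //.
by congr (_ - _ *: _); apply: eq_sbsum => i; rewrite (linear_funD (vfield_lin _ ff)).
Qed.

Let csumZ c T : good T -> csum (fun m' w => c *: T m' w) = c *: csum T.
Proof.
move=> [h1 h2]; rewrite /csum scalerBr; congr (_ - _); first by rewrite -sbsumZ.
rewrite [RHS]scalerA [c * _]mulrC -[RHS]scalerA -sbsumZ //; congr (_ *: _).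
by apply: eq_sbsum => i; rewrite (linear_funZ (vfield_lin _ ff)).
Qed.

Let csum_weightl g (s : nat) : vfield g ->
  csum (fun m' w => binz m s *: g (m + m' - s%:Z) w) = binz m s *: brak g f k (m - s%:Z) n w.
Proof.
move=> fg; rewrite /csum /brak scalerBr; congr (_ - _).
  rewrite -sbsumZ; last exact: (prodm_fin fg ff (fun j => k + (m - s%:Z) - j%:Z)).
  by apply: eq_sbsum => i; congr (_ *: g _ _); ring.
rewrite [RHS]scalerA mulrC -[RHS]scalerA; congr (_ *: _).
rewrite -sbsumZ; last exact: (prodm_fin ff fg (fun j => k + n - j%:Z)).
apply: eq_sbsum => i; rewrite (linear_funZ (vfield_lin _ ff)).
by congr (_ *: f _ (g _ _)); ring.
Qed.

(** A weight in the summed index lowers the exponent $k$. The result is a bracket at a general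
    triple, no longer a product slice, so the later induction needs full Borcherds identities. *)
Let csum_weightr g (s : nat) : vfield g ->
  csum (fun m' w => binz m' s *: g (m + m' - s%:Z) w) = binz k s *: brak g f (k - s%:Z) m n w.
Proof.
move=> fg; rewrite /csum /brak scalerBr; congr (_ - _).
  rewrite -sbsum_weightl; last exact: (prodm_fin fg ff (fun j => k - s%:Z + m - j%:Z)).
  by apply: eq_sbsum => i; congr (_ *: g _ _); ring.
pose X j := f (k + n - j%:Z) (g (m + j%:Z - s%:Z) w).
have fX : fin X.
  have [N hN] := vfield_large w (m - s%:Z) fg; exists N => j hj.
  by rewrite /X -(f0 (k + n - j%:Z)) -(hN j hj); congr (f _ (g _ _)); ring.
rewrite (_ : sbsum k _ = sbsum k (fun j => binz j s *: X j)); last first.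
  by apply: eq_sbsum => j; rewrite (linear_funZ (vfield_lin _ ff)).
rewrite sbsum_weightr // !scalerA signzB; congr (_ *: _); first by ring.
by apply: eq_sbsum => h; rewrite /X; congr (f _ (g _ _)); lia.
Qed.

(** Leibniz rule: crossing $f$ turns it into the $F_r$ and gives the products $b_kF_r$; crossing $b$
    gives the brackets with [e] and with the identity field. *)
Lemma nprod_comm : a m (nprod b k f n w) = nprod b k f n (a m w)
  + bsum m (fun r => nprod b k (F r) (m + n - r%:Z) w)
  + (p *: (binz m 1 *: brak e f k (m - 1) n w)
     + q *: (binz k 1 *: brak e f (k - 1) m n w)
     + z *: (binz m 3 *: brak idf f k (m - 3) n w)).
Proof.
have g1 := good_weight (fun _ => binz m 1) 1 fe.
have g2 := good_weight (fun m => binz m 1) 1 fe.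
have g3 := good_weight (fun _ => binz m 3) 3 idf_vfield.
have a0 s : a s 0 = 0 by apply: vfield0.
have b0 s : b s 0 = 0 by apply: vfield0.
have [R hR] := F0.
pose T m' w := p *: (binz m 1 *: e (m + m' - 1) w) + q *: (binz m' 1 *: e (m + m' - 1) w)
  + z *: (binz m 3 *: idf (m + m' - 3) w).
have gT : good T by apply: good_D; [apply: good_D|]; apply: good_Z.
rewrite (_ : p *: _ + _ + _ = csum T); last first.
  rewrite /T csumD; [|by apply: good_D; apply: good_Z|exact: good_Z].
  rewrite csumD; [|exact: good_Z|exact: good_Z]; rewrite (csumZ p) // (csumZ q) // (csumZ z) //.
  congr (_ *: _ + _ *: _ + _ *: _); apply: esym.
  - exact: (csum_weightl 1 fe).
  - exact: (csum_weightr 1 fe).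
  - exact: (csum_weightl 3 idf_vfield).
pose G1 (j r : nat) := b (k - j%:Z) (F r (m + (n + j%:Z) - r%:Z) w).
pose G2 (j r : nat) := F r (m + (k + n - j%:Z) - r%:Z) (b j%:Z w).
have fG1 : fin2 G1.
  apply: fin2C; apply: fin2_intro; first by exists R => r hr j; rewrite /G1 hR.
  move=> r; have [N hN] := vfield_large w (m + n - r%:Z) (fF r); exists N => j hj.
  by rewrite /G1 -(b0 (k - j%:Z)) -(hN j hj); congr (b _ (F _ _ _)); ring.
have [M hM] := vfield_large w 0 fb.
have fbw : fin (fun j => b j%:Z w) by exists M => j /hM; rewrite add0r.
have fG2 : fin2 G2.
  exists (maxn M R) => j r hjr; rewrite /G2; have [hr|hr] := leqP R r; first by rewrite hR.
  by move: (hM j); rewrite add0r => ->; rewrite ?vfield0 //; lia.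
have ffw x : fin (fun j => f (n + j%:Z) x) by apply: vfield_fin ff _ => j.
rewrite (_ : bsum m _ = sbsum k (fun j => bsum m (G1 j)) - (-1) ^ k *: sbsum k (fun j => bsum
  m (G2 j))); last first.
  rewrite !sbsum_bsum_exch // -bsumZ; last first.
    by apply: (fin2_sbsum (fun=> k)); apply: fin2C.
  rewrite -bsumB; last 2 first.
  - by apply: (fin2_sbsum (fun=> k)); apply: fin2C.
  - by apply: finZ; apply: (fin2_sbsum (fun=> k)); apply: fin2C.
  apply: eq_bsum => r; rewrite nprodE /G1 /G2; congr (_ - _ *: _); apply: eq_sbsum => j.
    by congr (b _ (F _ _ _)); ring.
  by congr (F _ _ _); ring.
have e1 j : a m (b (k - j%:Z) (f (n + j%:Z) w)) =
    b (k - j%:Z) (f (n + j%:Z) (a m w)) + bsum m (G1 j) + T (k - j%:Z) (f (n + j%:Z) w).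
  have /eqP := ab m (k - j%:Z) (f (n + j%:Z) w).
  rewrite subr_eq => /eqP ->; rewrite [LHS]addrC; congr (_ + _).
  rewrite af (linear_funD (vfield_lin _ fb)); congr (_ + _).
  by rewrite (bsum_lin _ (vfield_lin _ fb)) //; exists R => r hr; apply: hR.
have e2 j : a m (f (k + n - j%:Z) (b j%:Z w)) =
    f (k + n - j%:Z) (b j%:Z (a m w)) + bsum m (G2 j) + f (k + n - j%:Z) (T j%:Z w).
  rewrite af [RHS]addrAC; congr (_ + _).
  have /eqP := ab m j%:Z w; rewrite subr_eq => /eqP ->.
  by rewrite (linear_funD (vfield_lin _ ff)) [LHS]addrC.
rewrite !nprodE (linear_funB (vfield_lin _ fa)) (linear_funZ (vfield_lin _ fa)).
have h1 : fin (fun j => b (k - j%:Z) (f (n + j%:Z) w)).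
  by apply: finW (ffw w) => j ->.
have h2 : fin (fun j => f (k + n - j%:Z) (b j%:Z w)).
  by apply: finW fbw => j ->.
have h3 : fin (fun j => b (k - j%:Z) (f (n + j%:Z) (a m w))).
  by apply: finW (ffw (a m w)) => j ->.
have h4 : fin (fun j => f (k + n - j%:Z) (b j%:Z (a m w))).
  by have [N hN] := vfield_large (a m w) 0 fb; exists N => j /hN; rewrite add0r => ->.
have h5 := fin2_bsum (fun=> m) fG1.
have h6 := fin2_bsum (fun=> m) fG2.
have [h7 h8] := gT.
rewrite !(sbsum_lin _ (vfield_lin _ fa)) // (eq_sbsum _ e1) (eq_sbsum _ e2).
rewrite (sbsumD _ (finD h3 h5) h7) (sbsumD _ h3 h5).
rewrite (sbsumD _ (finD h4 h6) h8) (sbsumD _ h4 h6) /csum.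
move: (sbsum k _) (sbsum k _) (sbsum k _) (sbsum k _) (sbsum k _) (sbsum k _).
by move=> *; rewrite !scalerDr !opprD [LHS]addrACA [X in X + _ = _]addrACA.
Qed.
End Commutator.
End Bracket.
End NormalProducts.

(** * Products with the identity field *)

Section Vacuum.
Context (K : numFieldType).
Local Notation binz := (@binz K).

Lemma binzN1 k : (-1) ^+ k * binz (-1) k = 1.
Proof. by rewrite binz_upper (_ : _ - _ = k%:Z) ?binz_diag //; lia. Qed.

Context (W : lmodType K).
Implicit Types f : int -> W -> W.

Lemma sbsum1 (X : nat -> W) l j : (forall i, i != j -> X i = 0) ->
  sbsum l X = ((-1) ^+ j * binz l j) *: X j.
Proof.
move=> h; rewrite /sbsum /bsum (@isum1 _ j) ?scalerA 1?mulrC // => i hi.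
by rewrite h // !scaler0.
Qed.

Lemma nprod_idfl f l n w : vfield f ->
  nprod (@idf K W) l f n w = if l == -1 then f n w else 0.
Proof.
move=> ff; rewrite nprodE [X in _ - _ *: X]bsum_eq0 => [|i]; last first.
  by rewrite /idf (_ : (i%:Z == -1) = false) ?(vfield0 _ ff) ?scaler0 //; lia.
rewrite scaler0 subr0; case: eqP => [->|hl].
  rewrite (@sbsum1 _ _ 0%N) => [|i hi]; last first.
    by rewrite /idf (_ : (_ == _) = false) //; lia.
  rewrite expr0 mul1r binz0 scale1r /idf (_ : (_ == _) = true); last by lia.
  by congr (f _ _); lia.
(* A surviving term has $i=l+1$, so $l\ge0$ and $\binom l{l+1}=0$. *)
apply: isum0 => i; rewrite /idf; case: eqP => [e|_]; last by rewrite !scaler0.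
have [j hj] : exists j : nat, l = j by exists `|l|%N; lia.
rewrite hj (@binz_small K j) ?scale0r //; lia.
Qed.

(** At $l=0$ this says that $f$ commutes with the identity field; Pascal's rule raises $l$. At $m=0$
    it makes the identity field a vacuum vector. *)
Lemma brak_idfr_ge0 f (l : nat) m n w : vfield f -> brak f (@idf K W) l m n w = 0.
Proof.
move=> ff; elim: l m n => [|l IH] m n.
  rewrite /brak !prodm0 expr0z scale1r /idf; case: eqP => _; rewrite ?subrr //.
  by rewrite vfield0 // subr0.
have -> : l.+1%:Z = l%:Z + 1 by lia.
by rewrite brak_pascal ?IH ?subrr //; exact: idf_vfield.
Qed.

(** The two expansions of $(x-y)^{-1}$ return the modes $n<0$ and $n\ge0$ of $f$ respectively. *)
Lemma nprod_idfr f n w : vfield f -> nprod f (-1) (@idf K W) n w = f n w.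
Proof.
move=> ff; rewrite nprodE; have f0 m : f m 0 = 0 by apply: vfield0.
have [hn|hn] := ltP n 0.
  have [i hi] : exists i : nat, n = - 1 - i%:Z by exists `|(n + 1)%R|%N; lia.
  rewrite (@sbsum1 _ _ i) => [|j hj]; last first.
    by rewrite /idf (_ : (_ == _) = false) //; lia.
  rewrite binzN1 scale1r [X in _ *: X]bsum_eq0 => [|j]; last first.
    by rewrite /idf (_ : (_ == _) = false) ?scaler0 //; lia.
  by rewrite scaler0 subr0 /idf (_ : (_ == _) = true); [congr (f _ _); lia|lia].
have [i hi] : exists i : nat, n = i by exists `|n|%N; lia.
rewrite [X in X - _]bsum_eq0 => [|j]; last first.
  by rewrite /idf (_ : (_ == _) = false) ?f0 ?scaler0 //; lia.
rewrite (@sbsum1 _ _ i) => [|j hj]; last first.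
  by rewrite /idf (_ : (_ == _) = false) //; lia.
rewrite binzN1 scale1r sub0r -scaleNr /idf (_ : (_ == _) = true); last by lia.
by rewrite exprN1 invrN1 opprK scale1r hi.
Qed.

(** The same with $(x-y)^{-2}$, which yields the derivative of $f$; at $n=0$ neither expansion
    contributes. *)
Lemma nprod_idfr2 f n w : vfield f ->
  nprod f (-2) (@idf K W) n w = (- n)%:~R *: f (n - 1) w.
Proof.
move=> ff; have f0 m : f m 0 = 0 by apply: vfield0.
have binzN2 i : (-1) ^+ i * binz (-2) i = i.+1%:R.
  rewrite binz_upper (_ : _ - _ = i%:Z + 1); last by lia.
  elim: i => [|i IH]; first exact: binz0.
  have e : i.+1%:Z = i%:Z + 1 by lia.
  by rewrite pascal binz_diag e IH nat1r.
have s2 : (-1) ^ (-2) = 1 :> K by rewrite (signzB K 0 2) expr0z mul1r sqrrN expr1n.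
rewrite nprodE s2 scale1r.
have [hn|hn] := ltP n 0.
  have [i hi] : exists i : nat, n = - 1 - i%:Z by exists `|(n + 1)%R|%N; lia.
  rewrite (@sbsum1 _ _ i) => [|j hj]; last first.
    by rewrite /idf (_ : (_ == _) = false) //; lia.
  rewrite binzN2 [X in _ - X]bsum_eq0 => [|j]; last first.
    by rewrite /idf (_ : (_ == _) = false) ?scaler0 //; lia.
  rewrite subr0 /idf (_ : (_ == _) = true); last by lia.
  rewrite -[i.+1%:R]/(i.+1%:Z%:~R).
  by congr (_%:~R *: f _ _); lia.
rewrite [X in X - _]bsum_eq0 => [|j]; last first.
  by rewrite /idf (_ : (_ == _) = false) ?f0 ?scaler0 //; lia.
have [->|n0] := eqVneq n 0.
  rewrite oppr0 scale0r [X in 0 - X]bsum_eq0 ?subr0 // => j.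
  by rewrite /idf (_ : (_ == _) = false) ?scaler0 //; lia.
have [i hi] : exists i : nat, n = i%:Z + 1 by exists `|(n - 1)%R|%N; lia.
rewrite (@sbsum1 _ _ i) => [|j hj]; last first.
  by rewrite /idf (_ : (_ == _) = false) //; lia.
rewrite binzN2 sub0r -scaleNr /idf (_ : (_ == _) = true); last by lia.
rewrite -[i.+1%:R]/(i.+1%:Z%:~R) -rmorphN /=.
by congr (_%:~R *: f _ _); lia.
Qed.
End Vacuum.

(** * The induction step of the commutator formula *)

Section CommutatorInduction.
Context (K : numFieldType) (V W : lmodType K) (VW : V -> int -> W -> W).
Local Notation binz := (@binz K).
Context (VWf : forall v, vfield (VW v)) (VWl : forall n w, linear (fun v => VW v n w)).
Context (aV bV eV : int -> V -> V) (aW bW eW : int -> W -> W) (p q z : K).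
Context (faV : vfield aV) (fbV : vfield bV) (feV : vfield eV).
Context (faW : vfield aW) (fbW : vfield bW) (feW : vfield eW).
Context (abV : forall m n w, aV m (bV n w) - bV n (aV m w) =
  p *: (binz m 1 *: eV (m + n - 1) w) + q *: (binz n 1 *: eV (m + n - 1) w)
  + z *: (binz m 3 *: idf (m + n - 3) w)).
Context (abW : forall m n w, aW m (bW n w) - bW n (aW m w) =
  p *: (binz m 1 *: eW (m + n - 1) w) + q *: (binz n 1 *: eW (m + n - 1) w)
  + z *: (binz m 3 *: idf (m + n - 3) w)).
Context (VWb : forall v k n w, VW (bV k v) n w = nprod bW k (VW v) n w).
Context (v : V).
Context (ev : forall l m n w, brak eW (VW v) l m n w
  = bsum m (fun i => VW (eV (l + i%:Z) v) (m + n - i%:Z) w)).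
Context (idv : forall l m n w, brak (@idf K W) (VW v) l m n w
  = bsum m (fun i => VW (idf (l + i%:Z) v) (m + n - i%:Z) w)).
Context (av : forall m n w, aW m (VW v n w) = VW v n (aW m w)
  + bsum m (fun i => VW (aV i%:Z v) (m + n - i%:Z) w)).

(** [nprod_comm] leaves brackets of [eW] and of the identity field with $v$. Their Borcherds
    identities turn them into modes of vectors $e_jv$ and $1_jv$, and the bracket relation in [V],
    having the same constants, reassembles these into $[a_i,b_k]v$. *)
Lemma commutator_step k m n w : aW m (VW (bV k v) n w) = VW (bV k v) n (aW m w)
  + bsum m (fun i => VW (aV i%:Z (bV k v)) (m + n - i%:Z) w).
Proof.
have VW0 n' w' : VW 0 n' w' = 0 by apply: (linear_fun0 (VWl _ _)).
have F0 : exists R, forall r, (R <= r)%N -> forall n w, VW (aV r%:Z v) n w = 0.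
  have [R hR] := vfield_large v 0 faV; exists R => r /hR.
  by rewrite add0r => -> *.
have finl (x : int -> V -> V) (s : int) (g : nat -> int) w' : vfield x ->
    fin (fun r => VW (x (r%:Z + s) v) (g r) w').
  move=> fx; have [R hR] := vfield_large v s fx; exists R => r /hR.
  by rewrite [s + _]addrC => ->.
rewrite !VWb (nprod_comm (VWf v) faW fbW feW abW (fun r => VWf (aV r%:Z v)) F0 (av m)).
rewrite -addrA; congr (_ + _).
pose X1 i := VW (bV k (aV i%:Z v)) (m + n - i%:Z) w.
pose X2 i := VW (eV (i%:Z + (k - 1)) v) (m + n - i%:Z) w.
pose X3 i := VW (idf (i%:Z + (k - 3)) v) (m + n - i%:Z) w.
have f2 : fin X2 by apply: finl.
have f3 : fin X3 by apply: finl; apply: idf_vfield.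
have f1 : fin X1.
  have [R hR] := vfield_large v 0 faV; exists R => r /hR.
  by rewrite add0r /X1 => ->; rewrite vfield0.
transitivity (bsum m X1 + (p *: bsum m (fun i => binz i 1 *: X2 i)
   + q *: (binz k 1 *: bsum m X2) + z *: bsum m (fun i => binz i 3 *: X3 i))).
  congr (_ + (_ *: _ + _ *: (_ *: _) + _ *: _)).
  - by apply: eq_bsum => i; rewrite -VWb.
  - rewrite ev bsum_weightr //; congr (_ *: _); apply: eq_bsum => i.
    by rewrite /X2; congr (VW (eV _ _) _ _); lia.
  - rewrite ev; apply: eq_bsum => i.
    by rewrite /X2; congr (VW (eV _ _) _ _); lia.
  - rewrite idv bsum_weightr //; congr (_ *: _); apply: eq_bsum => i.
    by rewrite /X3; congr (VW (idf _ _) _ _); lia.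
rewrite -!bsumZ; try exact: finZ; try by do ?[apply: finZ].
rewrite -!bsumD; try by do ?[apply: finZ | apply: finD].
apply: eq_bsum => i; rewrite /X1 /X2 /X3.
have /eqP := abV i%:Z k v; rewrite subr_eq => /eqP ->.
rewrite !(linear_funD (VWl _ _)) !(linear_funZ (VWl _ _)) [RHS]addrC.
by congr (_ + (_ *: (_ *: VW (eV _ _) _ _) + _ *: (_ *: VW (eV _ _) _ _) + _ *: (_ *: VW (idf
  _ _) _ _))); ring.
Qed.
End CommutatorInduction.

(** * Fields as a module over the Lie algebra *)

Section VertexFields.
Context (K : numFieldType) (W : lmodType K).

Definition vfield_pred : {pred int -> W -> W} := [pred A : int -> W -> W | `[< vfield A >]].

Fact vfield_submod : submod_closed vfield_pred.
Proof.
have fE c (A B : int -> W -> W) n w : (c *: A + B) n w = c *: A n w + B n w by [].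
split=> [|c A B /asboolP[lA tA] /asboolP[lB tB]]; apply/asboolP; split.
- by move=> n a x y; rewrite /GRing.zero /= scaler0 addr0.
- by move=> w; exists 0.
- move=> n a x y; rewrite !fE.
  by rewrite lA lB !scalerDr !scalerA mulrC addrACA.
- move=> w; have [[N hN] [M hM]] := (tA w, tB w).
  exists (Num.max N M) => n; rewrite ge_max => /andP[h1 h2].
  by rewrite fE hN // hM // scaler0 addr0.
Qed.

HB.instance Definition _ :=
  GRing.isSubmodClosed.Build K (int -> W -> W) vfield_pred
  vfield_submod.

(** Bundled so that the fields form a vector space, the target of the map out of $V(c)$. *)
Record vfields := VFields { vfields_val :> int -> W -> W; vfields_valP
  : vfields_val \in vfield_pred }.
HB.instance Definition _ := [isSub for vfields_val].
HB.instance Definition _ := [Choice of vfields by <:].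
HB.instance Definition _ := [SubChoice_isSubLmodule of vfields by <:].

Lemma vfieldsP (A : vfields) : vfield A.
Proof. by have /asboolP := vfields_valP A. Qed.

Lemma vfieldsPZ c (A B : vfields) n w : (c *: A + B : vfields) n w = c *: A n w + B n w.
Proof. by []. Qed.
Lemma vfieldsZ c (A : vfields) n w : (c *: A : vfields) n w = c *: A n w.
Proof. by []. Qed.
Lemma vfieldsB (A B : vfields) n w : (A - B : vfields) n w = A n w - B n w.
Proof. by []. Qed.

Lemma vfields_ext (A B : vfields) : (forall n w, A n w = B n w) -> A = B.
Proof. by move=> h; apply/val_inj/funext => n; apply/funext => w; exact: h. Qed.

Definition vf_mk A (fA : vfield A) : vfields := @VFields A (asboolT fA).
Definition vf_id : vfields := vf_mk (@idf_vfield K W).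
Definition vf_prod A (fA : vfield A) k (f : vfields) : vfields :=
  vf_mk (nprod_vfield k fA (vfieldsP f)).

Lemma vf_prod_linear A (fA : vfield A) k : linear (vf_prod fA k).
Proof.
move=> c f g; apply: vfields_ext => n w.
have [ff fg] := (vfieldsP f, vfieldsP g).
rewrite vfieldsPZ -[LHS]/(nprod A k (c *: f + g : vfields) n w) /vf_prod /= !nprodE.
have f1 h : vfield h -> fin (fun i => A (k - i%:Z) (h (n + i%:Z) w)).
  by move=> fh; apply: (prodm_fin fA fh (fun i => k - i%:Z)).
have f2 h : vfield h -> fin (fun i => h (k + n - i%:Z) (A i%:Z w)).
  move=> fh; have [N hN] := vfield_large w 0 fA; exists N => i /hN.
  by rewrite add0r => ->; apply: vfield0.
rewrite [sbsum k (fun i => A _ ((c *: f + g : vfields) _ _))](_ : _ =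
    c *: sbsum k (fun i => A (k - i%:Z) (f (n + i%:Z) w)) + sbsum k (fun i => A (k - i%:Z) (g
      (n + i%:Z) w))); last first.
  rewrite -sbsumZ; last exact: f1.
  rewrite -sbsumD; [|exact/finZ/f1|exact: f1].
  by apply: eq_sbsum => i; rewrite vfieldsPZ (vfield_lin _ fA).
rewrite [sbsum k (fun i => (c *: f + g : vfields) _ _)](_ : _ =
    c *: sbsum k (fun i => f (k + n - i%:Z) (A i%:Z w)) + sbsum k (fun i => g (k + n - i%:Z)
      (A i%:Z w))); last first.
  rewrite -sbsumZ; last exact: f2.
  by rewrite -sbsumD; [|exact/finZ/f2|exact: f2].
by rewrite scalerDr opprD addrACA scalerBr !scalerA mulrC.
Qed.
End VertexFields.

(** * Brackets of the generator modes *)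

Section Generators.
Context (K : numFieldType) (lam : K).
Local Notation mu := (- lam / 2).
Local Notation dsv := (dsv lam mu).
Local Notation binz := (@binz K).

Variant gen := gL | gM | gY.

(** The generating series [L(x)], [M(x)], [Y~(x)] are written [sum_n a_n x^(-n-1)];
    for [L] this shifts the index, [a_n = L_(n-1)]. *)
Definition gmode (a : gen) (n : int) : dsv :=
  match a with gL => dL lam mu (n - 1) | gM => dM lam mu n | gY => dY lam mu n end.

Definition gidx (a : gen) (n : int) : dsv_index :=
  match a with gL => iL (n - 1) | gM => iM n | gY => iY n end.

Lemma gmodeE a n : gmode a n = << gidx a n >>.
Proof. by case: a. Qed.

Lemma gidxP i : i = iC \/ exists a n, i = gidx a n.
Proof.
case: i => [m|m|m|]; [right; exists gL, (m + 1)|right; exists gM, m|right;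
  exists gY, m|by left] => //=.
by rewrite addrK.
Qed.

(** In terms of modes every bracket has the shape
    [[a_m, b_n] = (p m + q n) e_(m+n-1) + z binom(m, 3) delta_(m+n,2) C]. *)
Definition gbr_p (a b : gen) : K :=
  match a, b with
  | gL, gL => -1 | gL, gY => - ((lam + 1) / 2) | gL, gM => - lam
  | gY, gL => -1 | gM, gL => -1 | gY, gY => 1 | _, _ => 0
  end.
Definition gbr_q (a b : gen) : K :=
  match a, b with
  | gL, gL => 1 | gL, gY => 1 | gL, gM => 1
  | gY, gL => (lam + 1) / 2 | gM, gL => lam | gY, gY => -1 | _, _ => 0
  end.
Definition gbr_z (a b : gen) : K :=
  match a, b with gL, gL => 1 / 2 | _, _ => 0 end.
Definition gbr (a b : gen) : gen :=
  match a, b with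
  | gL, x => x | x, gL => x | _, _ => gM
  end.

(** The cocycle at $L_{m-1}$: $(m-1)^3-(m-1)=m(m-1)(m-2)=6\binom m3$, so the factor $1/12$ becomes
    the $1/2$ of [gbr_z]. *)
Lemma binz3 m : binz m 3 = ((m - 1) ^+ 3 - (m - 1))%:~R / 6.
Proof.
have h : 6 != 0 :> K by rewrite pnatr_eq0.
apply: (mulIf h); rewrite [RHS]divfK //; apply: (etrans (binz_fact K m 3)).
rewrite !big_ord_recl big_ord0 mulr1 -!rmorphM /=.
by congr (_%:~R); rewrite /bump /=; ring.
Qed.

(** With $L_{m-1}$ as $m$-th mode, the constant terms are $\lambda+2\mu$ in $[L,M]$ and
    $\lambda/2+\mu$ in $[L,Y]$; both vanish for this $\mu$. *)
Lemma lie_gmode a b m n : lie (gmode a m) (gmode b n) =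
  gbr_p a b *: (binz m 1 *: gmode (gbr a b) (m + n - 1))
  + gbr_q a b *: (binz n 1 *: gmode (gbr a b) (m + n - 1))
  + gbr_z a b *: (binz m 3 *: ((m + n - 3 == -1)%:R *: dC lam mu)).
Proof.
have e1 : 2 * mu = - lam by field.
have sc (x y : K) (v : dsv) : x = y -> x *: v = y *: v by move=> ->.
have [eL eY] : m - 1 + (n - 1) = m + n - 1 - 1 /\ m + n - 1 = m - 1 + n by split; ring.
have eY' : m + n - 1 = n - 1 + m by ring.
rewrite !gmodeE [LHS]dsv_lieE !binz1 !scalerA -!scalerDl.
case: a; case: b; rewrite [dsv_br _ _ _ _]/= /gbr_p /gbr_q /gbr_z /gbr /gidx.
all: rewrite ?mul0r ?(scale0r, scaler0, addr0, add0r).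
- rewrite eL; apply: f_equal2; apply: sc; first by rewrite !rmorphB /=; ring.
  rewrite /brLLC binz3; have -> : (m - 1 + (n - 1) == 0) = (m + n - 3 == -1) by lia.
  by case: (_ == _); rewrite ?mul0r ?mulr0 ?mul1r ?mulr1 //; field.
- by rewrite eY; apply: sc; rewrite /brLM e1 !rmorphB /=; ring.
- by rewrite eY; apply: sc; rewrite /brLY !rmorphB /=; field.
- by rewrite eY' -scaleNr; apply: sc; rewrite /brLM e1 !rmorphB /=; ring.
- reflexivity.
- reflexivity.
- by rewrite eY' -scaleNr; apply: sc; rewrite /brLY !rmorphB /=; field.
- reflexivity.
- by apply: sc; rewrite rmorphB /=; ring.
Qed.
End Generators.

Lemma linear_bracket (K : numFieldType) (V W : lmodType K) (L : V -> W) p b q b' z b'' d g C :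
  linear L -> L (p *: (b *: g) + q *: (b' *: g) + z *: (b'' *: (d *: C)))
  = p *: (b *: L g) + q *: (b' *: L g) + z *: (b'' *: (d *: L C)).
Proof. by move=> lL; rewrite !(linear_funD lL) !(linear_funZ lL). Qed.

Section GeneratorFields.
Context (K : numFieldType) (lam c : K).
Local Notation mu := (- lam / 2).
Local Notation dsv := (dsv lam mu).
Local Notation binz := (@binz K).
Context (W : lmodType K) (rho : lieModule dsv W).

Definition gfield (a : gen) : int -> W -> W := fun n w => rho (gmode lam a n) w.

Lemma gfield_restricted a : restricted rho -> vfield (gfield a).
Proof.
move=> rr; split=> [n|w]; first exact: lact_linr.
(* $L_{n-1}$ has degree $n-1$, which exceeds $N$ from $n=N+2$ on; [d] below counts half-steps above
   $N$. *)
have [N hN] := rr w; exists (N.+2 : int) => n hn; rewrite /gfield gmodeE.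
have hom r i : dsv_degree i = r -> dsv_homog r (<< i >> : dsv).
  by move=> <- j; rewrite mcoeffU; case: (i =P j) => [->|_] //; rewrite mulr0n eqxx.
have deg (d : int) (i : dsv_index) : (0 < d) -> dsv_degree i = N%:R + d%:~R / 2 ->
    rho << i >> w = 0.
  case: d => // d d0 e; apply: (hN d) => //; exact: hom.
case: a => /=.
- apply: (deg ((n - 1 - N%:Z) * 2)); first by lia.
  by rewrite /= !rmorphM !rmorphB /=; field.
- apply: (deg ((n - N%:Z) * 2)); first by lia.
  by rewrite /= !rmorphM !rmorphB /=; field.
- apply: (deg ((n - N%:Z) * 2 - 1)); first by lia.
  by rewrite /= !rmorphB !rmorphM !rmorphB /=; field.
Qed.

Context (rhoC : forall w, rho (dC _ _) w = c *: w).

Lemma gfield_bracket a b m n w :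
  gfield a m (gfield b n w) - gfield b n (gfield a m w) =
  gbr_p lam a b *: (binz m 1 *: gfield (gbr a b) (m + n - 1) w)
  + gbr_q lam a b *: (binz n 1 *: gfield (gbr a b) (m + n - 1) w)
  + (gbr_z K a b * c) *: (binz m 3 *: idf (m + n - 3) w).
Proof.
rewrite /gfield -(lact_lie rho) lie_gmode.
apply: etrans; first exact: (linear_bracket _ _ _ _ _ _ _ _ _ (lact_linl rho w)).
cbv beta; rewrite rhoC -scalerA; apply: f_equal2 => //; apply: f_equal2 => //.
rewrite [RHS]scalerA [c * _]mulrC -[RHS]scalerA; apply: f_equal2 => //.
rewrite /idf; case: (_ == _); first by rewrite scale1r.
by rewrite scale0r scaler0.
Qed.

Context (rf : forall a, vfield (gfield a)).

Local Notation E := (vfields W).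

(** The $n$-th mode of a generator acts as the $n$-th product; $m+1$ is the index shift of $L$. *)
Definition vf_gen (i : dsv_index) (f : E) : E :=
  match i with
  | iL m => vf_prod (rf gL) (m + 1) f
  | iM m => vf_prod (rf gM) m f
  | iY m => vf_prod (rf gY) m f
  | iC => c *: f
  end.

Lemma vf_gen_gidx a n f : vf_gen (gidx a n) f = vf_prod (rf a) n f.
Proof. by case: a; rewrite /= ?subrK. Qed.

Lemma vf_gen_linear i : linear (vf_gen i).
Proof.
case: (gidxP i) => [->|[a [n ->]]].
  by move=> x f g /=; rewrite scalerDr !scalerA mulrC.
by move=> x f g; rewrite !vf_gen_gidx vf_prod_linear.
Qed.

Definition vf_act (x : dsv) (f : E) : E := lext (vf_gen^~ f) x.

Lemma vf_act_linl f : linear (vf_act^~ f).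
Proof. exact: lext_linear. Qed.

Lemma vf_act_linr x : linear (vf_act x).
Proof.
move=> a f g; rewrite /vf_act /lext scaler_sumr -big_split; apply: eq_bigr => i _ /=.
by rewrite vf_gen_linear scalerDr !scalerA mulrC.
Qed.

Lemma vf_actU i f : vf_act << i >> f = vf_gen i f.
Proof. exact: lextU. Qed.

Lemma vf_act_gmode a k f : vf_act (gmode lam a k) f = vf_prod (rf a) k f.
Proof. by rewrite gmodeE vf_actU vf_gen_gidx. Qed.

(** Bilinearity reduces to basis elements. [C] acts as a scalar; for two modes this is [nprod_lie],
    where the product of the identity field with $f$ supplies the central term. *)
Lemma vf_act_lie x y f : vf_act (lie x y) f = vf_act x (vf_act y f) - vf_act y (vf_act x f).
Proof.
have linB (g h : dsv -> E) : linear g -> linear h -> linear (fun x => g x - h x).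
  by move=> lg lh a u v; rewrite lg lh opprD addrACA scalerBr.
have ll z : linear (fun x : dsv => vf_act (lie x z) f).
  by move=> a u v; rewrite (lie_linl z a u v) vf_act_linl.
have lr z : linear (fun x : dsv => vf_act (lie z x) f).
  by move=> a u v; rewrite (lie_linr z a u v) vf_act_linl.
have l2 z : linear (fun x : dsv => vf_act x (vf_act z f)) by apply: vf_act_linl.
have l3 z : linear (fun x : dsv => vf_act z (vf_act x f)).
  by move=> a u v; rewrite vf_act_linl vf_act_linr.
move: x; apply: malg_linear_ext; [exact: ll | exact: linB |] => i.
move: y; apply: malg_linear_ext; [exact: lr | exact: linB |] => j.
rewrite !vf_actU.
case: (gidxP i) => [->|[a [m ->]]].
  rewrite [X in vf_act X _](lieCx (<< j >> : dsv)) (linear_fun0 (vf_act_linl f)) /=.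
  by rewrite (linear_funZ (vf_gen_linear j)) subrr.
case: (gidxP j) => [->|[b [n ->]]].
  rewrite [X in vf_act X _](liexC (<< _ >> : dsv)) (linear_fun0 (vf_act_linl f)) /=.
  by rewrite (linear_funZ (vf_gen_linear _)) subrr.
rewrite -!gmodeE lie_gmode.
apply: etrans; first exact: (linear_bracket _ _ _ _ _ _ _ _ _ (vf_act_linl f)).
cbv beta; rewrite !vf_act_gmode !vf_gen_gidx vf_actU /=.
apply: vfields_ext => k w; rewrite vfieldsB.
rewrite [RHS](nprod_lie (vfieldsP f) (rf a) (rf b) (rf _) (gfield_bracket a b)).
rewrite nprod_idfl; last exact: vfieldsP.
rewrite !binz1 !scalerA -scalerDl vfieldsPZ -scalerA -scalerA; congr (_ + _).
rewrite !vfieldsZ; case: (_ == _); last by rewrite scale0r !scaler0.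
by rewrite scale1r scalerA -mulrA [binz m 3 * c]mulrC mulrA.
Qed.

Definition vf_module : lieModule dsv E := LieModule vf_act_linl vf_act_linr vf_act_lie.
End GeneratorFields.

(** * The induced module *)

Section InducedUniversal.
Context (K : numFieldType) (lam c : K).
Local Notation mu := (- lam / 2).
Local Notation dsv := (dsv lam mu).
Local Notation Vc := (Vc lam c).
Local Notation vac := (Vc_vac lam c).

Section Hom.
Context (N : lmodType K) (sigma : lieModule dsv N) (v0 : N).
Context (hv0 : forall x : dsv, x \in @dsv_plus_pred K lam -> sigma x v0 = (x@_iC * c) *: v0).

(** By [hv0] the map $n\mapsto n v_0$ from the one-dimensional module respects the action of the
    subalgebra. *)
Lemma ueval_vac t (n : K) :
  ueval sigma (uterm_incl t) (n *: v0) = (ueval (vac_module lam c) t n : K) *: v0.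
Proof.
elim: t n => [x|||s IHs t IHt|a s IHs|s IHs t IHt] n /=.
- rewrite (linear_funZ (lact_linr sigma _)) hv0; last exact: subLie_valP.
  by rewrite scalerA mulrC.
- by rewrite scale0r.
- by [].
- by rewrite IHs IHt scalerDl.
- by rewrite IHs scalerA.
- by rewrite IHt IHs.
Qed.

Lemma U_act_vac b (n : K) :
  U_act sigma (U_incl b) (n *: v0) = (U_act (vac_module lam c) b n : K) *: v0.
Proof. by elim/U_ind: b => t; rewrite U_inclE !U_actE ueval_vac. Qed.

Fixpoint teval (t : tterm (Uenv dsv) K^o) : N :=
  match t with
  | TPure x z => (z : K) *: U_act sigma x v0
  | TZero => 0
  | TAdd s t => teval s + teval t
  | TScale k s => k *: teval s
  end.

Lemma teval_teq s t :
  teq (@U_incl K dsv (dsv_plus lam)) (U_module (vac_module lam c)) s t -> teval s = teval t.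
Proof.
elim=> {s t} /=.
- by [].
- by move=> s t _ ->.
- by move=> s t u _ -> _ ->.
- by move=> s s' t t' _ -> _ ->.
- by move=> a s s' _ ->.
- by move=> s t u; rewrite addrA.
- by move=> s t; rewrite addrC.
- by move=> s; rewrite add0r.
- by move=> s; rewrite scaleN1r addNr.
- by move=> a b s; rewrite scalerA.
- by move=> s; rewrite scale1r.
- by move=> a s t; rewrite scalerDr.
- by move=> a b s; rewrite scalerDl.
- by move=> a b n; rewrite (linear_funD (U_act_linl sigma v0)) scalerDr.
- by move=> a n n'; rewrite scalerDl.
- by move=> k a n; rewrite (linear_funZ (U_act_linl sigma v0)) !scalerA mulrC.
- by move=> k a n; rewrite scalerA.
(* Balancing over the subalgebra is the relation that depends on [hv0]. *)
- move=> a b n; rewrite U_actM -[RHS](linear_funZ (U_act_linr sigma a)).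
  by rewrite -U_act_vac (linear_funZ (U_act_linr sigma _)) (linear_funZ (U_act_linr sigma _)).
Qed.

Definition Vc_lift (v : Vc) : N := teval (Trepr v).

Lemma Vc_liftE t : Vc_lift (Tpi _ _ t) = teval t.
Proof. exact/teval_teq/teq_repr. Qed.

Lemma Vc_lift_linear : linear Vc_lift.
Proof.
move=> a; elim/tensor_ind => s; elim/tensor_ind => t.
by rewrite -TpiZ -TpiD !Vc_liftE.
Qed.

Lemma Vc_lift_vac : Vc_lift vac = v0.
Proof. by rewrite Vc_liftE /= scale1r U_act1. Qed.

Lemma Vc_lift_act x v : Vc_lift (Vc_act lam c x v) = sigma x (Vc_lift v).
Proof.
elim/tensor_ind: v => t; rewrite [Vc_act _ _ _ _]tensor_actE !Vc_liftE.
elim: t => [y z||s IHs t IHt|k s IHs] /=.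
- by rewrite U_actM U_actE /= (linear_funZ (lact_linr sigma x)).
- by rewrite (linear_fun0 (lact_linr sigma x)).
- by rewrite IHs IHt (linear_funD (lact_linr sigma x)).
- by rewrite IHs (linear_funZ (lact_linr sigma x)).
Qed.
End Hom.

Section Span.
Context (P : Vc -> Prop).
Context (P0 : P 0) (PD : forall u v, P u -> P v -> P (u + v)) (PZ
  : forall k v, P v -> P (k *: v)).

(** [P] cuts out a subspace, and pure tensors $x\otimes z=z\,(x\cdot\mathbf 1)$ span, so stability
    under the Lie algebra suffices. *)
Lemma Vc_ind_act : P vac -> (forall x v, P v -> P (Vc_act lam c x v)) -> forall v, P v.
Proof.
move=> Pvac Pact.
have PU (t : uterm dsv) v : P v ->
    P (tensor_act (f := @U_incl K dsv (dsv_plus lam)) (act := U_module (vac_module lam c))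
      (Upi t) v).
  elim: t v => [x|||s IHs t IHt|a s IHs|s IHs t IHt] v Pv.
  - exact: Pact.
  - by rewrite (linear_fun0 (tensor_act_linl v)).
  - by rewrite tensor_act1.
  - rewrite -uaddE (linear_funD (tensor_act_linl v)); apply: PD; [exact: IHs|exact: IHt].
  - rewrite -uscaleE (linear_funZ (tensor_act_linl v)); apply: PZ; exact: IHs.
  - by rewrite -umulE tensor_actM; apply: IHs; apply: IHt.
elim/tensor_ind => t; elim: t => [x z||s IHs t IHt|k s IHs].
- rewrite -[z]mulr1; have -> : Tpi (@U_incl K dsv (dsv_plus lam)) (U_module (vac_module lam
  c)) (TPure x (z * 1 : K^o))
     = z *: Tpi _ _ (TPure x (1 : K^o)).
    by rewrite -TpiZ; apply/TpiP; exact: teq_pureZr.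
  apply: PZ; have := PU (Urepr x) vac Pvac; rewrite UreprK /Vc_vac /tpure tensor_actE /=.
  by rewrite mulr1.
- exact: P0.
- by rewrite TpiD; apply: PD.
- by rewrite TpiZ; apply: PZ.
Qed.
End Span.
End InducedUniversal.

(** * The module structure *)

Section JacobiBorcherds.
Context (K : numFieldType).
Local Notation binz := (@binz K).

(** A delta function confines the support to a ray in $\mathbb Z^2$; [h] parametrizes it by the
    exponent of the second variable in the expansion. *)
Lemma fsum_isum (W : zmodType) (h : nat -> int * int) (F : int * int -> W) :
  injective h -> (forall e, (forall k, h k <> e) -> F e = 0) ->
  \sum_(e \in [set: int * int]%classic) F e = isum (fun k => F (h k)).
Proof.
move=> hi F0; rewrite -(fsbig_widen (range h) setT) //; last first.
  by move=> e [_ ne]; apply: F0 => k hk; apply: ne; exists k.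
rewrite (@reindex_fsbig _ _ _ _ _ h setT) //; split.
- by move=> k _; exists k.
- by move=> x y _ _; apply: hi.
- by move=> e [k _ <-]; exists k.
Qed.

Context (V W : lmodType K) (Y : V -> fseries V) (YW : V -> fseries W).
Context (YWf : forall v, vfield (mode (YW v))).
Local Notation VY := (fun v => mode (Y v)).
Local Notation VW := (fun v => mode (YW v)).

Lemma jacobi_sum1 u v w p q r :
  \sum_(e \in [set: int * int]%classic)
     delta_coef (1 : K) (-1) p (q - e.1) (r - e.2) *: YW u e.1 (YW v e.2 w)
  = prodm (VW u) (VW v) (- 1 - p) (- q - 1) (- r - 1) w.
Proof.
(* The last exponent of the delta function is $r-e_2=k$, and the three exponents add up to $-1$,
   which fixes $e_1$. *)
pose h (k : nat) := (p + q + 1 + k%:Z, r - k%:Z).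
rewrite (@fsum_isum _ h).
- apply: eq_isum => k; rewrite /h /= /delta_coef scalerA.
  have -> : r - (r - k%:Z) = k by ring.
  have -> : (p + (q - (p + q + 1 + k%:Z)) + k == -1) = true by lia.
  rewrite mul1r exp1rz mulr1 [in RHS]/mode.
  congr ((binz _ _ * _) *: YW u _ (YW v _ w)); lia.
- by move=> i j [_]; lia.
- move=> [e1 e2] ne /=; rewrite /delta_coef.
  case e : (r - e2) => [k|k]; last by rewrite scale0r.
  case: eqP => [e'|_]; last by rewrite mul0r scale0r.
  by case: (ne k); rewrite /h; congr pair; lia.
Qed.

Lemma jacobi_sum2 u v w p q r :
  \sum_(e \in [set: int * int]%classic)
     delta_coef (-1 : K) 1 p (r - e.2) (q - e.1) *: YW v e.2 (YW u e.1 w)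
  = (-1) ^ (- 1 - p) *: prodm (VW v) (VW u) (- 1 - p) (- r - 1) (- q - 1) w.
Proof.
pose h (k : nat) := (q - k%:Z, p + r + 1 + k%:Z).
rewrite (@fsum_isum _ h).
- rewrite /prodm -sbsumZ; last exact: (prodm_fin (YWf v) (YWf u) (fun i => - 1 - p + (- r -
  1) - i%:Z)).
  apply: eq_isum => k; rewrite /h /= /delta_coef scalerA scalerA.
  have -> : q - (q - k%:Z) = k by ring.
  have -> : (p + (r - (p + r + 1 + k%:Z)) + k == -1) = true by lia.
  have -> : r - (p + r + 1 + k%:Z) = - 1 - p - k%:Z by ring.
  rewrite mul1r expr1n mulr1 signzB subrK [(-1) ^ _ * _]mulrC mulrA /mode.
  congr (_ *: YW v _ (YW u _ w)); lia.
- by move=> i j [_]; lia.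
- move=> [e1 e2] ne /=; rewrite /delta_coef.
  case e : (q - e1) => [k|k]; last by rewrite scale0r.
  case: eqP => [e'|_]; last by rewrite mul0r scale0r.
  by case: (ne k); rewrite /h; congr pair; lia.
Qed.

(** Here $k$ also enters the upper entry: the coefficient is $(-1)^k\binom{q+k}k$, which upper
    negation turns into $\binom{-q-1}k$. *)
Lemma jacobi_sum3 u v w p q r :
  \sum_(e \in [set: int * int]%classic)
     delta_coef (1 : K) (-1) (r - e.2) q (p - e.1) *: YW (Y u e.1 v) e.2 w
  = itprod VY VW u v (- 1 - p) (- q - 1) (- r - 1) w.
Proof.
pose h (k : nat) := (p - k%:Z, r + q + 1 + k%:Z).
rewrite (@fsum_isum _ h).
- apply: eq_isum => k; rewrite /h /= /delta_coef.
  have -> : p - (p - k%:Z) = k by ring.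
  have -> : (r - (r + q + 1 + k%:Z) + q + k == -1) = true by lia.
  rewrite mul1r exp1rz mulr1 mulrC binz_upper /mode.
  congr (binz _ _ *: YW (Y u _ v) _ w); lia.
- by move=> i j [_]; lia.
- move=> [e1 e2] ne /=; rewrite /delta_coef.
  case e : (p - e1) => [k|k]; last by rewrite scale0r.
  case: eqP => [e'|_]; last by rewrite mul0r scale0r.
  by case: (ne k); rewrite /h; congr pair; lia.
Qed.
End JacobiBorcherds.

Lemma brak_linearl (K : numFieldType) (W : lmodType K) (A A' C B : int -> W -> W) k l m n w :
  vfield A -> vfield A' -> vfield B -> (forall n w, C n w = k *: A n w + A' n w) ->
  brak C B l m n w = k *: brak A B l m n w + brak A' B l m n w.
Proof.
move=> fA fA' fB CE.
have e1 : prodm C B l m n w = k *: prodm A B l m n w + prodm A' B l m n w.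
  have f0 X : vfield X -> fin (fun i => X (l + m - i%:Z) (B (n + i%:Z) w)).
    by move=> fX; exact: (prodm_fin fX fB (fun i => l + m - i%:Z)).
  rewrite /prodm -sbsumZ; last exact: f0.
  rewrite -sbsumD; [|exact/finZ/f0|exact: f0].
  by apply: eq_sbsum => i.
have e2 : prodm B C l n m w = k *: prodm B A l n m w + prodm B A' l n m w.
  have f0 X : vfield X -> fin (fun i => B (l + n - i%:Z) (X (m + i%:Z) w)).
    by move=> fX; exact: (prodm_fin fB fX (fun i => l + n - i%:Z)).
  rewrite /prodm -sbsumZ; last exact: f0.
  rewrite -sbsumD; [|exact/finZ/f0|exact: f0].
  by apply: eq_sbsum => i; rewrite CE (vfield_lin _ fB).
by rewrite /brak e1 e2 scalerDr opprD addrACA scalerBr !scalerA [k * _]mulrC.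
Qed.

(** * Generator modes on the induced module *)

Section VacuumModule.
Context (K : numFieldType) (lam c : K).
Local Notation mu := (- lam / 2).
Local Notation dsv := (dsv lam mu).
Local Notation Vc := (Vc lam c).
Local Notation vac := (Vc_vac lam c).
Local Notation act := (Vc_act lam c).

Lemma lext_act (N : lmodType K) (sigma : lieModule dsv N) v x :
  sigma x v = lext (fun i => sigma (<< i >> : dsv) v) x.
Proof.
have ls : linear (fun x : dsv => sigma x v) by exact: (lact_linl sigma v).
move: x; apply: malg_linear_ext; [exact: ls | exact: lext_linear |] => i.
by rewrite lextU.
Qed.

(** On the vacuum [C] crosses the tensor sign, being in the subalgebra; centrality carries the
    scalar to every other vector. *)
Lemma Vc_C v : act (dC lam mu) v = c *: v.
Proof.
apply: (@Vc_ind_act K lam c (fun v => act (dC lam mu) v = c *: v)).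
- by rewrite (linear_fun0 (lact_linr act _)) scaler0.
- by move=> x y ex ey; rewrite (linear_funD (lact_linr act _)) ex ey scalerDr.
- by move=> k x ex; rewrite (linear_funZ (lact_linr act _)) ex !scalerA mulrC.
- have hC : dC lam mu \in lsub (dsv_plus lam).
    by apply/dsv_plusP => i hi; rewrite mcoeffU; case: (iC =P i) hi => [<-|].
  pose b := Uvar (SubLie hC).
  have eb : U_incl b = Uvar (dC lam mu) by rewrite /b /Uvar U_inclE.
  rewrite [LHS]tensor_actE /= mulr1 -eb -[U_incl b]mul1r.
  rewrite -[RHS]TpiZ; apply/TpiP; apply: (teq_trans (teq_balanced _ _ _ _ _)).
  have -> : U_module (vac_module lam c) b 1 = c *: (1 : K^o).
    by rewrite [LHS]U_actE /= /vac_act /= mcoeffUU mul1r.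
  exact: teq_pureZr.
- move=> x v' e; apply/eqP; rewrite -subr_eq0 -(linear_funZ (lact_linr act _)) -e.
  rewrite -(lact_lie act) [X in act X _](lieCx x) (linear_fun0 (lact_linl act _)).
  exact: eqxx.
Qed.

Lemma Vc_ind_gen (P : Vc -> Prop) : P 0 -> (forall u v, P u -> P v -> P (u + v)) ->
  (forall k v, P v -> P (k *: v)) -> P vac ->
  (forall a n v, P v -> P (gfield act a n v)) -> forall v, P v.
Proof.
move=> P0 PD PZ Pvac Pact; apply: Vc_ind_act => // x v Pv.
rewrite lext_act /lext; apply: big_ind => // i _; apply: (PZ).
case: (gidxP i) => [->|[a [n ->]]]; last by rewrite -gmodeE; apply: Pact.
by rewrite Vc_C; apply: PZ.
Qed.

(** With $L$ shifted, the subalgebra consists of the nonnegative modes together with [C]. *)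
Lemma gidx_plus a n : dsv_plus_index (gidx a n) = (0 <= n).
Proof. by case: a => //=; lia. Qed.
End VacuumModule.

Section FieldModuleVacuum.
Context (K : numFieldType) (lam c : K) (W : lmodType K).
Local Notation mu := (- lam / 2).
Local Notation dsv := (dsv lam mu).
Context (rho : lieModule dsv W) (rhoC : forall w, rho (dC _ _) w = c *: w).
Context (rf : forall a, vfield (gfield rho a)).

Lemma vf_id_vac (x : dsv) : x \in @dsv_plus_pred K lam ->
  vf_module rhoC rf x (vf_id W) = (x@_iC * c) *: vf_id W.
Proof.
move=> /allP hx; rewrite -[LHS]/(lext _ x).
transitivity (lext (fun i => if i == iC then c *: vf_id W else 0) x).
  rewrite /lext !big_seq; apply: eq_bigr => i /hx hi; congr (_ *: _).
  case: (gidxP i) hi => [-> //|[a [n ->]]]; rewrite gidx_plus => hn.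
  rewrite vf_gen_gidx (_ : _ == _ = false); last by case: (a).
  apply: vfields_ext => m w; rewrite [LHS]/(nprod _ _ _ _ _).
  by case: n hn => // n _; rewrite /nprod brak_idfr_ge0.
move: x {hx}; apply: malg_linear_ext; first exact: lext_linear.
  by move=> a x y; rewrite mcoeffD mcoeffZ !mulrDl scalerDl -!mulrA scalerA.
move=> i; rewrite lextU mcoeffU; case: (i =P iC) => [_|_]; first by rewrite mul1r.
by rewrite mulr0n mul0r scale0r.
Qed.
End FieldModuleVacuum.

(** * The vertex algebra module on a restricted module *)

Section RestrictedModule.
Context (K : numFieldType) (lam c : K).
Local Notation mu := (- lam / 2).
Local Notation dsv := (dsv lam mu).
Local Notation Vc := (Vc lam c).
Local Notation vac := (Vc_vac lam c).
Local Notation act := (Vc_act lam c).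
Context (Y : Vc -> fseries Vc) (D : Vc -> Vc) (va : is_vertex_algebra Y vac D).
Context (va_L : forall e v, Y (act (dL _ _ (-2)) vac) e v = genL act e v).
Context (va_Y : forall e v, Y (act (dY _ _ (-1)) vac) e v = genY act e v).
Context (va_M : forall e v, Y (act (dM _ _ (-1)) vac) e v = genM act e v).
Context (W : lmodType K) (rho : lieModule dsv W).
Context (rho_simple : simple_lieModule rho) (rho_restricted : restricted rho).
Context (rhoC : forall w, rho (dC _ _) w = c *: w).

Let vam := va_adjoint va.
Let VY v := mode (Y v).
Let rfW a : vfield (gfield rho a) := gfield_restricted a rho_restricted.
Let psi : Vc -> vfields W := Vc_lift (vf_module rhoC rfW) (vf_id W).
Let hv0 := @vf_id_vac K lam c W rho rhoC rfW.
Let VW v : int -> W -> W := psi v.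
(** The states $L_{-2}\mathbf 1$, $M_{-1}\mathbf 1$ and $Y_{-3/2}\mathbf 1$. *)
Let gvec a : Vc := act (gmode lam a (-1)) vac.

Let VYf v : vfield (VY v).
Proof.
split=> [n|w]; first exact: (vam_linear_r vam).
by have [N hN] := vam_trunc vam v w; exists N.
Qed.
Let VYl n w : linear (fun v => VY v n w).
Proof. exact: (vam_linear_l vam). Qed.

Let VY_gvec a n v : VY (gvec a) n v = gfield act a n v.
Proof.
have e : - (- n - 1) = n + 1 by ring.
have e2 : -1 - 1 = -2 :> int by [].
rewrite /VY /mode /gvec /gfield; case: a; rewrite /gmode.
- rewrite e2 va_L /genL; congr (act (dL _ _ _) v); lia.
- by rewrite va_M /genM; congr (act (dM _ _ _) v); lia.
- by rewrite va_Y /genY; congr (act (dY _ _ _) v); lia.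
Qed.

(** On $V(c)$ truncation comes from the vertex algebra axioms, since generator fields are vertex
    operators there. *)
Let rfV a : vfield (gfield act a).
Proof.
have -> : gfield act a = VY (gvec a).
  by apply/funext => n; apply/funext => v; rewrite VY_gvec.
exact: VYf.
Qed.

Let VY_vac n v : VY vac n v = idf n v.
Proof.
rewrite /VY /mode (vam_vac vam) /idf.
by have -> : (- n - 1 == 0) = (n == -1) by lia.
Qed.

Let VYb u v : borcherds VY VY u v.
Proof.
move=> l m n w; have := vam_jacobi vam u v w (- 1 - l) (- m - 1) (- n - 1).
rewrite jacobi_sum1 (jacobi_sum2 VYf) (@jacobi_sum3 K Vc Vc Y Y).
have -> : -1 - (-1 - l) = l by ring.
have -> : - (- m - 1) - 1 = m by ring.
by have -> : - (- n - 1) - 1 = n by ring.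
Qed.

Let VWf v : vfield (VW v). Proof. exact: vfieldsP. Qed.
Let VWl n w : linear (fun v => VW v n w).
Proof. by move=> k u v; rewrite /VW /psi (Vc_lift_linear hv0). Qed.

Let VW_act a k v n w : VW (gfield act a k v) n w = nprod (gfield rho a) k (VW v) n w.
Proof. by rewrite /VW /psi /gfield (Vc_lift_act hv0) [vf_module _ _ _ _]vf_act_gmode. Qed.

Let VW_vac n w : VW vac n w = idf n w.
Proof. by rewrite /VW /psi (Vc_lift_vac hv0). Qed.

Let VW_gvec a n w : VW (gvec a) n w = gfield rho a n w.
Proof.
rewrite VW_act (_ : VW vac = @idf K W) ?nprod_idfr //.
by apply/funext => m; apply/funext => u; rewrite VW_vac.
Qed.

Let VWvac_E : VW vac = @idf K W.
Proof. by apply/funext => m; apply/funext => u; rewrite VW_vac. Qed.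
Let VWgvec_E a : VW (gvec a) = gfield rho a.
Proof. by apply/funext => m; apply/funext => u; rewrite VW_gvec. Qed.

Let W_vac v : borcherds VY VW vac v.
Proof.
apply: borcherds_slices => // [m n w|l n w]; rewrite VWvac_E.
  rewrite bsum_eq0 => [|i]; last first.
    by rewrite VY_vac /idf (_ : (_ == _) = false) ?(linear_fun0 (VWl _ _)).
  by rewrite addr0 /idf; case: (_ == _) => //; rewrite vfield0.
rewrite -/(nprod _ _ _ _ _) nprod_idfl // VY_vac /idf.
by case: (_ == _) => //; rewrite (linear_fun0 (VWl _ _)).
Qed.

(** Quantified over all generators, since the step from $v$ to $b_kv$ uses the generator [gbr a b]
    with the same $v$. *)
Let commutes v := forall a m n w, gfield rho a m (VW v n w) = VW v n (gfield rho a m w)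
  + bsum m (fun i => VW (gfield act a i%:Z v) (m + n - i%:Z) w).

(** The iterate slice holds by the construction of [psi], so the commutator formula is the one slice
    to be supplied. *)
Let W_gen_comm a v : commutes v -> borcherds VY VW (gvec a) v.
Proof.
move=> cv; apply: borcherds_slices => // [m n w|l n w]; rewrite VWgvec_E.
  by rewrite cv; congr (_ + _); apply: eq_bsum => i; rewrite VY_gvec.
by rewrite VY_gvec VW_act.
Qed.

Let VW_fin a v (g : nat -> int) w : fin (fun i => VW (gfield act a i%:Z v) (g i) w).
Proof.
have [N hN] := vfield_large v 0 (rfV a); exists N => i /hN; rewrite add0r => ->.
exact: (linear_fun0 (VWl _ _)).
Qed.

Let all_commute v : commutes v.
Proof.
have VW0 n w : VW 0 n w = 0 by exact: (linear_fun0 (VWl n w)).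
have VWD u u' n w : VW (u + u') n w = VW u n w + VW u' n w by exact: (linear_funD (VWl n w)).
have VWZ k u n w : VW (k *: u) n w = k *: VW u n w by exact: (linear_funZ (VWl n w)).
apply: (@Vc_ind_gen K lam c commutes) v.
- move=> a m n w; rewrite !VW0 add0r vfield0 // bsum_eq0 // => i.
  by rewrite (vfield0 _ (rfV a)) VW0.
- move=> u v cu cv a m n w; rewrite !VWD (linear_funD (vfield_lin _ (rfW a))) cu cv.
  rewrite [LHS]addrACA -bsumD; try exact: VW_fin.
  congr (_ + _); apply: eq_bsum => i.
  by rewrite (linear_funD (vfield_lin _ (rfV a))) VWD.
- move=> k u cu a m n w; rewrite !VWZ (linear_funZ (vfield_lin _ (rfW a))) cu scalerDr.
  rewrite -bsumZ; last exact: VW_fin.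
  congr (_ + _); apply: eq_bsum => i.
  by rewrite (linear_funZ (vfield_lin _ (rfV a))) VWZ.
- move=> a m n w; rewrite VWvac_E bsum_eq0 => [|i]; last first.
    by rewrite VW_act VWvac_E /nprod brak_idfr_ge0.
  by rewrite addr0 /idf; case: (_ == _) => //; rewrite vfield0.
(* The field of the bracket is again a generator, so the induction hypothesis gives its full
   identity with $v$. *)
- move=> b k v cv a m n w.
  apply: (@commutator_step K Vc W VW VWf VWl _ _ _ _ _ _ _ _ _
    (rfV a) (rfV b) (rfV (gbr a b)) (rfW a) (rfW b) (rfW (gbr a b))
    (gfield_bracket (@Vc_C K lam c) a b) (gfield_bracket rhoC a b)).
  + by move=> *; exact: VW_act.
  + move=> l' m' n' w'; rewrite -VWgvec_E (W_gen_comm _ cv).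
    by apply: eq_bsum => i; rewrite VY_gvec.
  + move=> l' m' n' w'; rewrite -VWvac_E W_vac.
    by apply: eq_bsum => i; rewrite VY_vac.
  + exact: cv.
Qed.

Let W_gen a v : borcherds VY VW (gvec a) v.
Proof. exact: W_gen_comm. Qed.

Let W_all : forall u v, borcherds VY VW u v.
Proof.
have VW0 n w : VW 0 n w = 0 by exact: (linear_fun0 (VWl n w)).
have VWD u u' n w : VW (u + u') n w = VW u n w + VW u' n w by exact: (linear_funD (VWl n w)).
have VWZ k u n w : VW (k *: u) n w = k *: VW u n w by exact: (linear_funZ (VWl n w)).
(* Only the two slices have to be checked for a linear combination. *)
have lin k u1 u2 v : borcherds VY VW u1 v -> borcherds VY VW u2 v ->
    borcherds VY VW (k *: u1 + u2) v.
  have it u' l n w : borcherds VY VW u' v ->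
      VW (VY u' l v) n w = brak (VW u') (VW v) l 0 n w.
    by move=> ->; rewrite /itprod bsum0; congr (VW (VY _ _ _) _ _); lia.
  have fi u' (g : nat -> int) w : fin (fun i => VW (VY u' i%:Z v) (g i) w).
    have [N hN] := vfield_large v 0 (VYf u'); exists N => i /hN.
    by rewrite add0r => ->.
  move=> h1 h2; apply: borcherds_slices => // [m n w|l n w].
    rewrite !VWD !VWZ (borcherds_comm h1) (borcherds_comm h2).
    rewrite (linear_funD (vfield_lin _ (VWf v))) (linear_funZ (vfield_lin _ (VWf v))).
    rewrite scalerDr [LHS]addrACA -bsumZ; last exact: fi.
    rewrite -bsumD; [|exact/finZ/fi|exact: fi].
    by congr (_ + _); apply: eq_bsum => i; rewrite (VYl i v k u1 u2) VWD VWZ.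
  rewrite (VYl l v k u1 u2) VWD VWZ !it //; apply/esym/brak_linearl => //.
  by move=> n' w'; rewrite VWD VWZ.
have h0 v : borcherds VY VW 0 v.
  apply: borcherds_slices => // [m n w|l n w].
    rewrite !VW0 (vfield0 _ (VWf v)) add0r bsum_eq0 // => i.
    by rewrite (linear_fun0 (VYl _ _)) VW0.
  rewrite (linear_fun0 (VYl _ _)) VW0 /brak /prodm /sbsum !bsum_eq0 ?scaler0 ?subr0 // => i.
    by rewrite VW0 (vfield0 _ (VWf v)) scaler0.
  by rewrite VW0 scaler0.
apply: (@Vc_ind_gen K lam c (fun u => forall v, borcherds VY VW u v)).
- exact: h0.
- by move=> u u' hu hu' v; rewrite -[u]scale1r; apply: lin.
- by move=> k u hu v; rewrite -[k *: u]addr0; apply: lin.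
- exact: W_vac.
- move=> a n u hu v; rewrite -VY_gvec; apply: (borcherds_nprod VYf VWf VWl) => // v'.
Qed.

Let d w := - rho (dL lam mu (-1)) w.
Let YW v : fseries W := fun e w => VW v (- e - 1) w.

Let modeE v n w : mode (YW v) n w = VW v n w.
Proof. by rewrite /mode /YW; congr (VW _ _ _); ring. Qed.
Let modeYW v : mode (YW v) = VW v.
Proof. by apply/funext => n; apply/funext => w; exact: modeE. Qed.

(** By creation $Dv$ is the constant term of $Y(Dv,z)\mathbf 1$, hence the coefficient of $z$ in
    $Y(v,z)\mathbf 1$. *)
Let D_creation v : D v = VY v (-2) vac.
Proof.
rewrite -(va_creation0 va (D v)) (vam_deriv vam) /fderiv /VY /mode add0r.
by rewrite scale1r.
Qed.

(** Both operators annihilate the vacuum and have the same commutator $-n\,a_{n-1}$ with each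
    generator mode $a_n$. The zeroth mode of [gL] is $L_{-1}$. *)
Let D_L0 v : D v = - gfield act gL 0 v.
Proof.
have lD := vam_d_linear vam; have fL := rfV gL.
apply: (@Vc_ind_gen K lam c (fun v => D v = - gfield act gL 0 v)) v.
- by rewrite (linear_fun0 lD) vfield0 ?oppr0.
- move=> u v eu ev; rewrite (linear_funD lD) eu ev.
  by rewrite (linear_funD (vfield_lin _ fL)) opprD.
- move=> k u eu; rewrite (linear_funZ lD) eu.
  by rewrite (linear_funZ (vfield_lin _ fL)) scalerN.
(* $L_{-1}\mathbf 1$ is the zeroth mode of $L_{-2}\mathbf 1$ on the vacuum, which creation kills. *)
- rewrite D_creation VY_vac /idf (_ : (_ == _) = false) //.
  by rewrite -VY_gvec /VY /mode (va_creation va) ?oppr0.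
- move=> a n v e.
  have := vam_comm vam (gvec a) (- n - 1) v; rewrite -/(mode _ n _) -/(mode _ n _).
  have -> w : mode (Y (gvec a)) n w = gfield act a n w by exact: VY_gvec.
  have -> w : mode (Y (gvec a)) n w = gfield act a n w by exact: VY_gvec.
  rewrite (vam_deriv vam) /fderiv.
  have -> : Y (gvec a) (- n - 1 + 1) v = gfield act a (n - 1) v.
    by rewrite -VY_gvec /VY /mode; congr (Y _ _ _); ring.
  rewrite e => /eqP; rewrite subr_eq => /eqP ->.
  (* At $m=0$ the terms with $\binom m1$ and $\binom m3$ vanish, leaving $n\,a_{n-1}$. *)
  have := gfield_bracket (@Vc_C K lam c) gL a 0 n v.
  have -> : binz K 0 1 = 0 by rewrite binz1.
  have -> : binz K 0 3 = 0 by rewrite (@binz_small K 0 3).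
  rewrite !scale0r !scaler0 add0r addr0 => /eqP; rewrite subr_eq => /eqP ->.
  rewrite binz1 opprD -[- gfield act gL 0 v]scaleN1r.
  rewrite (linear_funZ (vfield_lin _ (rfV a))) scaleN1r; congr (_ + _).
  have -> : gbr_q lam gL a = 1 by case: (a).
  have -> : gbr gL a = a by case: (a).
  by rewrite scale1r add0r -scaleNr -rmorphN; congr (_%:~R *: _); ring.
Qed.

Lemma restricted_va_module : exists (d : W -> W) (YW : Vc -> fseries W),
  [/\ is_va_module Y vac D d YW,
      forall e w, YW (act (dL _ _ (-2)) vac) e w = genL rho e w,
      forall e w, YW (act (dY _ _ (-1)) vac) e w = genY rho e w,
      forall e w, YW (act (dM _ _ (-1)) vac) e w = genM rho e w
    & simple_va_module d YW].
Proof.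
have YWg a e w : YW (gvec a) e w = rho (gmode lam a (- e - 1)) w.
  by rewrite /YW VW_gvec.
exists d, YW; split.
- split.
  + by move=> k x y; rewrite /d (lact_linr rho) opprD scalerN.
  + by move=> e w; exact: VWl.
  + by move=> v e; exact: (vfield_lin _ (VWf v)).
  + by move=> v w; have [_ /(_ w)[N hN]] := VWf v; exists N => n hn; rewrite modeE hN.
  (* For the mode $L_{-1}$ the sum in the commutator formula has one term, the vertex operator of
     $L_{-1}v=-Dv$. *)
  + move=> v e w; have := all_commute v gL 0 (- e - 1) w.
    rewrite bsum0 add0r subr0 => e'; rewrite /YW /d D_L0.
    rewrite -[- gfield act gL 0 v]scaleN1r (linear_funZ (VWl _ _)) scaleN1r.
    rewrite -[- rho _ w]scaleN1r (linear_funZ (vfield_lin _ (VWf v))) scaleN1r opprK.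
    rewrite -[rho _ (VW v _ w)]/(gfield rho gL 0 (VW v (- e - 1) w)) e' opprD.
    by rewrite addrAC addNr add0r.
  (* Since $Dv=v_{-2}\mathbf 1$, the iterate formula makes its field the product of index $-2$ with
     the identity field, that is, the derivative. *)
  + move=> v e w; rewrite D_creation {1}/YW (borcherds_iter (W_all v vac)).
    rewrite -nprodE VWvac_E nprod_idfr2 // /fderiv /YW.
    by congr (_%:~R *: VW _ _ _); ring.
  + move=> e w; rewrite /YW VW_vac /idf.
    by have -> : (- e - 1 == -1) = (e == 0) by lia.
  + move=> u v w p q r.
    have YWf v' : vfield (mode (YW v')) by rewrite modeYW.
    rewrite jacobi_sum1 (jacobi_sum2 YWf) (@jacobi_sum3 K Vc W Y YW).
    rewrite !modeYW.
    have e : (fun v => mode (YW v)) = VW by apply/funext => v'; exact: modeYW.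
    by rewrite e; apply: W_all.
- move=> e w; have -> : act (dL _ _ (-2)) vac = gvec gL.
    by rewrite /gvec /gmode; congr (act (dL _ _ _) _).
  rewrite (YWg gL) /genL /gmode; congr (rho (dL _ _ _) w); lia.
- by move=> e w; rewrite (YWg gY).
- by move=> e w; rewrite (YWg gM).
(* A subspace stable under vertex operators is stable under the generator modes, which are
   coefficients of these, and under the scalar [C]; so it is a Lie submodule. *)
have [hex hsimple] := rho_simple; split=> // U subU dU YU; apply: hsimple => // x w wU.
have [U0 UD] := subU.
rewrite lext_act /lext; apply: (big_ind (fun z => z \in U)) => //.
  by move=> x' y' hx hy; rewrite -[x']scale1r; apply: UD.
move=> i _; rewrite -[_ *: _]addr0; apply: (UD) => //.
case: (gidxP i) => [->|[a [n ->]]].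
  by rewrite [rho _ _](rhoC w) -[_ *: _]addr0; apply: UD.
have := YU (gvec a) (- n - 1) w wU; rewrite YWg -gmodeE.
by have -> : - (- n - 1) - 1 = n by ring.
Qed.
End RestrictedModule.

Theorem corollary4p6 (R : realType) (lam c : R[i])
    (Y : Vc lam c -> fseries (Vc lam c)) (D : Vc lam c -> Vc lam c)
    (va : is_vertex_algebra Y (Vc_vac lam c) D)
    (va_L : forall e v,
       Y (Vc_act lam c (dL _ _ (-2)) (Vc_vac lam c)) e v
       = genL (Vc_act lam c) e v)
    (va_Y : forall e v,
       Y (Vc_act lam c (dY _ _ (-1)) (Vc_vac lam c)) e v
       = genY (Vc_act lam c) e v)
    (va_M : forall e v,
       Y (Vc_act lam c (dM _ _ (-1)) (Vc_vac lam c)) e v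
       = genM (Vc_act lam c) e v)
    (mu : R[i]) (hmu : mu = - lam / 2)
    (W : lmodType R[i]) (rho : lieModule (dsv lam mu) W)
    (rho_simple : simple_lieModule rho)
    (rho_restricted : restricted rho)
    (rho_C : forall w, rho (dC _ _) w = c *: w) :
  exists (d : W -> W) (YW : Vc lam c -> fseries W),
    [/\ is_va_module Y (Vc_vac lam c) D d YW,
        forall e w, YW (Vc_act lam c (dL _ _ (-2)) (Vc_vac lam c)) e w
                    = genL rho e w,
        forall e w, YW (Vc_act lam c (dY _ _ (-1)) (Vc_vac lam c)) e w
                    = genY rho e w,
        forall e w, YW (Vc_act lam c (dM _ _ (-1)) (Vc_vac lam c)) e w
                    = genM rho e w
      & simple_va_module d YW].
Proof.
subst mu; exact: restricted_va_module.
Qed.
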